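(* Let $K$ be a non-degenerate Calderón–Zygmund kernel on $\mathbb{R}^d$, let $k\in\{1,2,\ldots\}$ and $b\in L^k_{\mathrm{loc}}(\mathbb{R}^d;\mathbb{R})$. Let $$1<p\leq q<\infty,\qquad\alpha:=\frac dk\Big(\frac1p-\frac1q\Big)\geq0,$$ let $\kappa>0$ be a constant, and suppose that, for some $\Theta\geq0$, $$|\langle T_b^kf,g\rangle|=\Big|\iint(b(x)-b(y))^kK(x,y)f(y)g(x)\,dy\,dx\Big|\leq\Theta\cdot\|f\|_\infty|B|^{1/p}\cdot\|g\|_\infty|\tilde B|^{1/q'}$$ whenever $f\in L^\infty(B)$ and $g\in L^\infty(\tilde B)$ for any two balls $B,\tilde B$ of equal radius $r$ and distance $\operatorname{dist}(B,\tilde B)\geq\kappa r$. Then there is a constant $C$, depending only on $d,p,q,k,K,\kappa$ (not on $b$ or $\Theta$), such that: \begin{itemize} \item if $\alpha=0$, equivalently $p=q$, then $b\in\mathrm{BMO}(\mathbb{R}^d)$ and $\|b\|_{\mathrm{BMO}}^k\leq C\Theta$; \item if $\alpha\in(0,1]$, then $b\in\dot C^{0,\alpha}(\mathbb{R}^d)$ and $\|b\|_{\dot C^{0,\alpha}}^k\leq C\Theta$; \item if $\alpha>1$, then $b$ is constant, so in fact $T_b^k=0$. \end{itemize}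
   Context: $b$ is real-valued; $K,f,g$ may be complex-valued. $q'=q/(q-1)$; for a ball $B$, $L^\infty(B)=\{f\in L^\infty(\mathbb{R}^d):f=1_Bf\}$. $\langle T_b^kf,g\rangle$ is only an abbreviation for the displayed integral; no boundedness of an operator $T$ is assumed. Statements that $b$ is Hölder continuous or constant are understood after redefinition on a null set. An $\omega$-Calderón–Zygmund kernel is a measurable $K(x,y)$, $x\neq y$, with $|K(x,y)|\leq c_K|x-y|^{-d}$ and $$|K(x,y)-K(x',y)|+|K(y,x)-K(y,x')|\leq\frac1{|x-y|^d}\omega\Big(\frac{|x-x'|}{|x-y|}\Big)\quad\text{whenever }|x-x'|<\tfrac12|x-y|,$$ with $\omega:[0,1)\to[0,\infty)$ increasing. $K$ is a non-degenerate Calderón–Zygmund kernel if at least one of the following holds: (i) $K$ is an $\omega$-Calderón–Zygmund kernel with $\omega(t)\to0$ as $t\to0$, and for some $c_0>0$, for every $y\in\mathbb{R}^d$ and $r>0$ there exists $x\in B(y,r)^c$ with $|K(x,y)|\geq\frac1{c_0r^d}$; (ii) $K(x,y)=\frac{\Omega(x-y)}{|x-y|^d}$ where $\Omega(tx)=\Omega(x)$ for all $t>0$, and $\Omega\in L^1(S^{d-1})\setminus\{0\}$. $\|b\|_{\mathrm{BMO}}=\sup_B\frac1{|B|}\int_B|b-\langle b\rangle_B|$ over all balls $B$, with $\langle b\rangle_B=\frac1{|B|}\int_Bb$; $\|b\|_{\dot C^{0,\alpha}}=\sup_{x\neq y}\frac{|b(x)-b(y)|}{|x-y|^\alpha}$.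 *)

(* Defs.v *)
From HB Require Import structures.
From mathcomp Require Import all_boot all_order all_algebra.
From mathcomp Require Import complex.
From mathcomp Require Import all_classical all_reals all_analysis.
From mathcomp Require Import measurable_realfun.

Set Implicit Arguments.
Unset Strict Implicit.
Unset Printing Implicit Defensive.

Import Order.TTheory GRing.Theory Num.Def Num.Theory.
Import numFieldNormedType.Exports.
Import Normc.

Local Open Scope classical_set_scope.
Local Open Scope ring_scope.

Section measurable_rV.
Context {dT} {T : measurableType dT}.
Variable n : nat.

Let coord : 'I_n -> 'rV[T]_n -> T := fun i x => x ord0 i.

Let rV_set0 : g_sigma_preimage coord set0.
Proof. exact: sigma_algebra0. Qed.

Let rV_setC A : g_sigma_preimage coord A -> g_sigma_preimage coord (~` A).
Proof. exact: sigma_algebraC. Qed.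

Let rV_bigcup (F : _^nat) : (forall i, g_sigma_preimage coord (F i)) ->
  g_sigma_preimage coord (\bigcup_i (F i)).
Proof. exact: sigma_algebra_bigcup. Qed.

(* The product sigma-algebra; on 'rV[R]_n it is the Borel sigma-algebra. *)
HB.instance Definition _ := @isMeasurable.Build (measure_tuple_display dT)
  'rV[T]_n (g_sigma_preimage coord) rV_set0 rV_setC rV_bigcup.

End measurable_rV.

Section measurable_rV_theory.
Context dS dT (S : measurableType dS) (T : measurableType dT).

Lemma measurable_coord n (i : 'I_n) :
  measurable_fun [set: 'rV[T]_n] (fun x : 'rV[T]_n => x ord0 i).
Proof.
move=> _ Y mY; rewrite setTI; apply: sub_sigma_algebra => /=.
rewrite -bigcup_seq/=; exists i => /=; first by rewrite mem_index_enum.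
by exists Y => //; rewrite setTI.
Qed.

Lemma measurable_fun_rVP n (f : S -> 'rV[T]_n) :
  measurable_fun [set: S] f <->
  forall i, measurable_fun [set: S] (fun s => f s ord0 i).
Proof.
split=> [mf i|mf].
  exact: (measurableT_comp (@measurable_coord n i) mf).
apply: (measurability (\big[setU/set0]_(i < n)
  preimage_set_system setT (fun x : 'rV[T]_n => x ord0 i) measurable)) => //.
move=> _ [B + <-]; rewrite -bigcup_seq => -[i _ [C mC <-]].
by rewrite setTI; exact: mf.
Qed.

End measurable_rV_theory.

Section lebesgue_measure_rV.
Context {R : realType}.
Local Open Scope ereal_scope.

Definition cons_rV n (p : measurableTypeR R * 'rV[R]_n) : 'rV[R]_n.+1 :=
  row_mx (\row_(_ < 1) p.1) p.2.

Lemma cons_rV0 n (p : measurableTypeR R * 'rV[R]_n) :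
  cons_rV p ord0 ord0 = p.1.
Proof. by rewrite /cons_rV mxE; case: splitP => // j; rewrite mxE. Qed.

Lemma cons_rVS n (p : measurableTypeR R * 'rV[R]_n) (i : 'I_n) :
  cons_rV p ord0 (lift ord0 i) = p.2 ord0 i.
Proof.
rewrite /cons_rV mxE; case: splitP => [[[]//]|j [ij]].
by congr (p.2 _ _); apply/val_inj/esym.
Qed.

Lemma measurable_cons_rV n :
  measurable_fun [set: measurableTypeR R * 'rV[R]_n] (@cons_rV n).
Proof.
apply/measurable_fun_rVP => i; case: (unliftP ord0 i) => [j ->|->].
  under eq_fun do rewrite cons_rVS.
  exact: (measurableT_comp (measurable_coord j) measurable_snd).
under eq_fun do rewrite cons_rV0.
exact: measurable_fst.
Qed.

Section lebesgue_cons.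
Variables (n : nat) (m : {sigma_finite_measure set 'rV[R]_n -> \bar R}).

Definition lebesgue_cons : set 'rV[R]_n.+1 -> \bar R :=
  pushforward (@lebesgue_measure R \x m) (@cons_rV n).

HB.instance Definition _ := Measure.copy lebesgue_cons
  (measure_function_pushforward__canonical__measure_function_Measure
    (@lebesgue_measure R \x m) (@measurable_cons_rV n)).

Let lebesgue_cons_sigma_finite : sigma_finite setT lebesgue_cons.
Proof.
pose uncons (x : 'rV[R]_n.+1) : measurableTypeR R * 'rV[R]_n :=
  (x ord0 ord0, \row_i x ord0 (lift ord0 i))%R.
have consK : cancel (@cons_rV n) uncons.
  move=> [a v]; rewrite /uncons cons_rV0; congr pair.
  by apply/rowP => i; rewrite mxE cons_rVS.
have muncons : measurable_fun [set: 'rV[R]_n.+1] uncons.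
  apply/measurable_fun_pair; first exact: measurable_coord.
  apply/measurable_fun_rVP => i.
  under eq_fun do rewrite mxE.
  exact: measurable_coord.
have /sigma_finiteP[F [TF ndF Foo]] := sigma_finiteT (@lebesgue_measure R).
have /sigma_finiteP[G [TG ndG Goo]] := sigma_finiteT m.
exists (fun k => uncons @^-1` (F k `*` G k)).
  rewrite -preimage_bigcup (_ : \bigcup_k _ = setT) ?preimage_setT//.
  rewrite predeqE => -[x y]; split=> // _.
  have [i _ Fix] : (\bigcup_k F k) x by rewrite -TF.
  have [j _ Gjy] : (\bigcup_k G k) y by rewrite -TG.
  exists (maxn i j) => //; split => /=.
    by move: x Fix; exact/subsetPset/ndF/leq_maxl.
  by move: y Gjy; exact/subsetPset/ndG/leq_maxr.
move=> k; have [mF Fk] := Foo k; have [mG Gk] := Goo k; split.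
  by rewrite -[X in measurable X]setTI; apply: muncons => //; exact: measurableX.
rewrite /lebesgue_cons /pushforward.
rewrite (_ : _ @^-1` _ = F k `*` G k) ?product_measure1E//.
  by rewrite lte_mul_pinfty// ge0_fin_numE.
by apply/funext => z; rewrite /preimage /mkset consK.
Qed.

HB.instance Definition _ :=
  Measure_isSigmaFinite.Build _ _ _ lebesgue_cons lebesgue_cons_sigma_finite.

End lebesgue_cons.

Fixpoint lebesgue_rV n : {sigma_finite_measure set 'rV[R]_n -> \bar R} :=
  match n with
  | 0 => \d_(0%R : 'rV[R]_0)
  | n'.+1 => lebesgue_cons (lebesgue_rV n')
  end.

Lemma lebesgue_rV_box n (A : 'I_n -> set (measurableTypeR R)) :
  (forall i, measurable (A i)) ->
  lebesgue_rV n [set x | forall i, A i (x ord0 i)] =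
  \prod_(i < n) @lebesgue_measure R (A i).
Proof.
elim: n A => [|n ih] A mA /=.
  by rewrite big_ord0 diracE mem_set// => -[].
rewrite big_ord_recl -ih// -product_measure1E//; last first.
  rewrite [X in measurable X](_ : _ = \bigcap_(i in [set: 'I_n])
    ((fun x : 'rV[R]_n => x ord0 i) @^-1` A (lift ord0 i))); last first.
    by apply/seteqP; split=> x h => [i _|i]; [exact: h|exact: (h i Logic.I)].
  apply: fin_bigcap_measurable; first exact: finite_finset.
  move=> i _; rewrite -[X in measurable X]setTI.
  by apply: measurable_coord => //; exact: mA.
rewrite /lebesgue_cons /pushforward; congr (product_measure1 _ _ _).
apply/seteqP; split=> -[a v] /=.
  move=> h; split=> [|i]; first by have := h ord0; rewrite cons_rV0.
  by have := h (lift ord0 i); rewrite cons_rVS.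
move=> [Aa Av] i; case: (unliftP ord0 i) => [j ->|->].
  by rewrite cons_rVS; exact: Av.
by rewrite cons_rV0.
Qed.

End lebesgue_measure_rV.

Section euclidean.
Context {R : realType} {d : nat}.

Definition enorm (x : 'rV[R]_d) : R := Num.sqrt (\sum_i x ord0 i ^+ 2).

Definition eball (c : 'rV[R]_d) (r : R) : set 'rV[R]_d :=
  [set x | enorm (x - c) < r].

Definition set_dist (A B : set 'rV[R]_d) : R :=
  inf [set enorm (z.1 - z.2) | z in A `*` B].

Definition sphere : set 'rV[R]_d := [set x | enorm x = 1].

Definition sphere_proj (x : 'rV[R]_d) : 'rV[R]_d := (enorm x)^-1 *: x.

Let measurable_sqr : measurable_fun [set: 'rV[R]_d]
  (fun x : 'rV[R]_d => \sum_i x ord0 i ^+ 2).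
Proof.
apply: measurable_sum => i; apply: measurable_funX; exact: measurable_coord.
Qed.

Let sumsq_ge0 (x : 'rV[R]_d) : 0 <= \sum_i x ord0 i ^+ 2.
Proof. by apply: sumr_ge0 => i _; exact: sqr_ge0. Qed.

Lemma measurable_enorm : measurable_fun [set: 'rV[R]_d] enorm.
Proof.
rewrite (_ : enorm = fun x => (\sum_i x ord0 i ^+ 2) `^ 2^-1); last first.
  by apply/funext => x; rewrite powR12_sqrt.
exact: (measurableT_comp (measurable_powR 2^-1) measurable_sqr).
Qed.

Lemma measurable_sphere_proj : measurable_fun [set: 'rV[R]_d] sphere_proj.
Proof.
apply/measurable_fun_rVP => i; under eq_fun do rewrite mxE.
apply: measurable_funM; last exact: measurable_coord.
rewrite (_ : (fun _ => _) = fun x => enorm x `^ -1); last first.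
  by apply/funext => x; rewrite powR_inv1// sqrtr_ge0.
exact: (measurableT_comp (measurable_powR (-1)) measurable_enorm).
Qed.

Lemma measurable_unit_eball : measurable (eball 0 1).
Proof.
rewrite (_ : eball 0 1 = setT `&` enorm @^-1` `]-oo, 1[%classic).
  by apply: measurable_enorm => //; exact: measurable_itv.
by apply/seteqP; split=> x; rewrite /eball /= subr0 in_itv/=; [split|case].
Qed.

Definition cone_measure : set 'rV[R]_d -> \bar R :=
  pushforward (mrestr (lebesgue_rV d) measurable_unit_eball) sphere_proj.

HB.instance Definition _ := Measure.copy cone_measure
  (measure_function_pushforward__canonical__measure_function_Measure
    (mrestr (lebesgue_rV d) measurable_unit_eball) measurable_sphere_proj).

(* Surface measure of the unit sphere, as a measure on R^d: by polar
   coordinates, sigma(A) = d * |{x : 0 < |x| < 1, x / |x| in A}| for A in the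
   sphere. For d = 1 this is the counting measure on {-1, 1}. *)
Definition sphere_measure : {measure set 'rV[R]_d -> \bar R} :=
  mscale (NngNum (ler0n R d)) cone_measure.

End euclidean.

Arguments sphere R d : clear implicits.
Arguments sphere_measure R d : clear implicits.

Section complex_valued.
Context {dT} {T : measurableType dT} {R : realType}.

Definition measurable_funC (D : set T) (f : T -> R[i]) : Prop :=
  measurable_fun D (fun x => complex.Re (f x)) /\
  measurable_fun D (fun x => complex.Im (f x)).

Definition integrableC (mu : {measure set T -> \bar R}) (D : set T)
    (f : T -> R[i]) : Prop :=
  mu.-integrable D (fun x => (complex.Re (f x))%:E) /\
  mu.-integrable D (fun x => (complex.Im (f x))%:E).

Definition integralC (mu : {measure set T -> \bar R}) (D : set T)
    (f : T -> R[i]) : R[i] :=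
  Complex (\int[mu]_(x in D) complex.Re (f x))
          (\int[mu]_(x in D) complex.Im (f x)).

End complex_valued.

Section function_spaces.
Context {R : realType} {d : nat}.
Local Notation vec := 'rV[R]_d.
Local Notation leb := (lebesgue_rV d).

Definition Linfty_norm (f : vec -> R[i]) : \bar R :=
  Lnorm leb +oo%E (fun x => (normc (f x))%:E).

Definition Linfty_on (B : set vec) (f : vec -> R[i]) : Prop :=
  [/\ measurable_funC setT f, (Linfty_norm f < +oo)%E &
      forall x, ~ B x -> f x = 0].

Definition locally_Lpow (k : nat) (b : vec -> R) : Prop :=
  measurable_fun setT b /\
  forall A : set vec, compact A ->
    (\int[leb]_(x in A) (`|b x| ^+ k)%:E < +oo)%E.

Definition average (b : vec -> R) (B : set vec) : R :=
  (fine (leb B))^-1 * \int[leb]_(x in B) b x.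

Definition BMO_norm (b : vec -> R) : \bar R :=
  ereal_sup [set u | exists (c : vec) (r : R), 0 < r /\
    u = ((fine (leb (eball c r)))^-1%:E *
         \int[leb]_(x in eball c r) `|b x - average b (eball c r)|%:E)%E].

Definition BMO (b : vec -> R) : Prop :=
  locally_Lpow 1 b /\ (BMO_norm b < +oo)%E.

Definition Holder_norm (alpha : R) (b : vec -> R) : \bar R :=
  ereal_sup [set (`|b z.1 - b z.2| / enorm (z.1 - z.2) `^ alpha)%:E |
             z in [set z : vec * vec | z.1 <> z.2]].

Definition Holder (alpha : R) (b : vec -> R) : Prop :=
  (Holder_norm alpha b < +oo)%E.

End function_spaces.

Section kernels.
Context {R : realType} {d : nat}.
Local Notation vec := 'rV[R]_d.
Implicit Types K : vec -> vec -> R[i].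

(* Kernels are total functions; their values on the diagonal are irrelevant. *)
Definition omega_CZ_kernel (omega : R -> R) K : Prop :=
  [/\ (forall t, 0 <= t -> t < 1 -> 0 <= omega t),
      (forall s t, 0 <= s -> s <= t -> t < 1 -> omega s <= omega t),
      measurable_funC [set z : vec * vec | z.1 <> z.2] (fun z => K z.1 z.2),
      (exists cK : R, forall x y, x <> y ->
        normc (K x y) <= cK * enorm (x - y) ^- d) &
      (forall x x' y, enorm (x - x') < 2^-1 * enorm (x - y) ->
        normc (K x y - K x' y) + normc (K y x - K y x') <=
        enorm (x - y) ^- d * omega (enorm (x - x') / enorm (x - y)))].

Definition nondegenerate_CZ_kernel K : Prop :=
  (exists omega : R -> R,
    [/\ omega_CZ_kernel omega K,
        omega t @[t --> 0^'+] --> 0 &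
        exists2 c0 : R, 0 < c0 &
          forall (y : vec) (r : R), 0 < r -> exists2 x : vec,
            ~ eball y r x & (c0 * r ^+ d)^-1 <= normc (K x y)]) \/
  (exists Omega : vec -> R[i],
    [/\ (forall x y, x <> y ->
           K x y = Omega (x - y) / (enorm (x - y) ^+ d)%:C%C),
        (forall (t : R) (x : vec), 0 < t -> Omega (t *: x) = Omega x),
        integrableC (sphere_measure R d) (sphere R d) Omega &
        ~ {ae sphere_measure R d, forall x, sphere R d x -> Omega x = 0}]).

Definition commutator_form (k : nat) (b : vec -> R) K (f g : vec -> R[i]) :
    R[i] :=
  integralC (lebesgue_rV d \x lebesgue_rV d)%E setT
    (fun z => ((b z.1 - b z.2) ^+ k)%:C%C * K z.1 z.2 * f z.2 * g z.1).

End kernels.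

(* Main.v *)
(* The median method. For a ball B = B(y0, r), non-degeneracy gives a ball B' = B(x0, r) at
   distance comparable to r (and at least kappa * r) such that K is close in the mean to a
   constant h0 with |h0| >= c / r^d on B' x B: for smooth kernels by going far away compared
   with r, for rough homogeneous ones by zooming in at a Lebesgue point of Omega(u) / |u|^d.
   If a is a median of b on B', then b - a has a constant sign on half of B', opposite to its
   sign on the part of B where b >= a (resp. b <= a). Testing the form on the indicators of
   these sets gives
     |h0| |B| int_B |b - a|^k <= C Theta |B|^(1/p + 1/q') + small * |h0| |B| int_(B u B') |b - a|^k,
   and the same with B and B' exchanged. Medians being quasi-optimal, the sum of the two
   estimates absorbs the error terms, which are finite because b is in L^k_loc; hence the mean
   k-th power oscillation of b on B is at most C Theta r^(k alpha). This is BMO for alpha = 0 and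
   Campanato's characterization of Holder continuity for alpha > 0. *)
Require Import Defs.
From HB Require Import structures.
From mathcomp Require Import all_boot all_order all_algebra.
From mathcomp Require Import complex.
From mathcomp Require Import all_classical all_reals all_analysis.
From mathcomp Require Import measurable_realfun.
From mathcomp Require Import ess_sup_inf ring lra.

Set Implicit Arguments.
Unset Strict Implicit.
Unset Printing Implicit Defensive.

Import Order.TTheory GRing.Theory Num.Def Num.Theory.
Import numFieldNormedType.Exports.
Import Normc.

Local Open Scope classical_set_scope.
Local Open Scope ring_scope.

(** * Euclidean balls and Lebesgue measure *)

(** Uniformity shapes the proof. The relative kernel error [absorb k] that can be absorbed depends
    on [k] alone, so it is fixed before [b], [Theta] and the ball, and the kernel must meet it with
    a lower bound [c1] common to all balls. For rough kernels one good ball is found once, and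
    homogeneity carries it to every position and scale.

    Medians need a real kernel, so [K] is replaced by its real or imaginary part, whichever stays
    large. Since [b] and the indicators are real, the form of that part is bounded by the modulus of
    the complex form.

    Splitting [|b x - b y|] at a level [a] leaves an error on both balls, even when only one of them
    is being estimated. This is why neither of the two estimates closes by itself.

    The Lebesgue point comes from a density argument in dyadic cubes: the sets approximable by
    unions of cubes form a sigma-algebra. The Holder representative is built from averages over all
    balls at every point, and its equality with [b] almost everywhere is obtained from Fubini by
    averaging over centres. *)

Section enorm_theory.
Context {R : realType} {d : nat}.
Implicit Types (x y c : 'rV[R]_d) (r : R).

Lemma enorm_ge0 x : 0 <= enorm x.
Proof. exact: sqrtr_ge0. Qed.

Let sumsq_ge0 x : 0 <= \sum_i x ord0 i ^+ 2.
Proof. by apply: sumr_ge0 => i _; exact: sqr_ge0. Qed.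

Lemma sqr_enorm x : enorm x ^+ 2 = \sum_i x ord0 i ^+ 2.
Proof. by rewrite sqr_sqrtr. Qed.

Lemma enormZ (l : R) x : enorm (l *: x) = `|l| * enorm x.
Proof.
rewrite /enorm -sqrtr_sqr -sqrtrM ?sqr_ge0//; congr Num.sqrt.
by rewrite mulr_sumr; apply: eq_bigr => i _; rewrite mxE exprMn.
Qed.

Lemma enormN x : enorm (- x) = enorm x.
Proof. by rewrite -scaleN1r enormZ normrN1 mul1r. Qed.

Lemma enormB x y : enorm (x - y) = enorm (y - x).
Proof. by rewrite -enormN opprB. Qed.

Lemma enorm0 : enorm (0 : 'rV[R]_d) = 0.
Proof. by rewrite -(scale0r 0) enormZ normr0 mul0r. Qed.

Lemma enorm_coord x i : `|x ord0 i| <= enorm x.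
Proof.
rewrite -sqrtr_sqr ler_sqrt// (bigD1 i)//= lerDl.
by apply: sumr_ge0 => j _; exact: sqr_ge0.
Qed.

Lemma enorm_eq0 x : (enorm x == 0) = (x == 0).
Proof.
apply/eqP/eqP => [x0|->]; last exact: enorm0.
apply/rowP => i; rewrite mxE; apply/eqP; rewrite -normr_le0 -x0.
exact: enorm_coord.
Qed.

Lemma enorm_gt0 x : (0 < enorm x) = (x != 0).
Proof. by rewrite lt_neqAle enorm_ge0 andbT eq_sym enorm_eq0. Qed.

(** With [C] the inner product, the squared norm of [|y|^2 x - C y] is
    [|y|^2 (|x|^2 |y|^2 - C^2)]. *)
Lemma cauchy_schwarz x y : \sum_i x ord0 i * y ord0 i <= enorm x * enorm y.
Proof.
set C := \sum_i _.
have [y0|] := eqVneq (enorm y) 0.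
  move/eqP: (y0); rewrite enorm_eq0 => /eqP y0'; rewrite y0 mulr0 /C y0'.
  by rewrite big1// => i _; rewrite mxE mulr0.
move=> y0; have yp : 0 < enorm y by rewrite lt_neqAle eq_sym y0 enorm_ge0.
have : 0 <= \sum_i (enorm y ^+ 2 * x ord0 i - C * y ord0 i) ^+ 2.
  by apply: sumr_ge0 => i _; exact: sqr_ge0.
have -> : \sum_i (enorm y ^+ 2 * x ord0 i - C * y ord0 i) ^+ 2 =
    enorm y ^+ 2 * ((enorm x * enorm y) ^+ 2 - C ^+ 2).
  transitivity (\sum_i (enorm y ^+ 4 * x ord0 i ^+ 2 -
    2 * enorm y ^+ 2 * C * (x ord0 i * y ord0 i) + C ^+ 2 * y ord0 i ^+ 2)).
    by apply: eq_bigr => i _; ring.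
  rewrite big_split/= sumrB -!mulr_sumr -!sqr_enorm -/C; ring.
rewrite pmulr_rge0 ?exprn_gt0// => CC.
apply: (le_trans (ler_norm C)).
by rewrite -(@ler_pXn2r _ 2) ?nnegrE ?mulr_ge0 ?enorm_ge0// real_normK ?num_real//
  -subr_ge0.
Qed.

Lemma ler_enormD x y : enorm (x + y) <= enorm x + enorm y.
Proof.
rewrite -(@ler_pXn2r _ 2) ?nnegrE ?addr_ge0 ?enorm_ge0//.
have -> : enorm (x + y) ^+ 2 =
    enorm x ^+ 2 + 2 * (\sum_i x ord0 i * y ord0 i) + enorm y ^+ 2.
  rewrite !sqr_enorm mulr_sumr -!big_split/=.
  by apply: eq_bigr => i _; rewrite mxE; ring.
have := cauchy_schwarz x y; rewrite sqrrD => CS.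
lra.
Qed.

Lemma ler_enormB x y : enorm (x - y) <= enorm x + enorm y.
Proof. by rewrite -(enormN y) ler_enormD. Qed.

Lemma ler_enorm_dist y x z : enorm (x - z) <= enorm (x - y) + enorm (y - z).
Proof. by rewrite (le_trans _ (ler_enormD _ _))// addrA subrK. Qed.

Lemma enorm_le_coord x e : (forall i, `|x ord0 i| <= e) -> enorm x <= d%:R * e.
Proof.
move=> xe; case: d x xe => [x _|n x xe].
  by rewrite /enorm big_ord0 sqrtr0 mul0r.
have e0 : 0 <= e by rewrite (le_trans _ (xe ord0)).
rewrite -(@ler_pXn2r _ 2) ?nnegrE ?sqrtr_ge0 ?mulr_ge0// /enorm sqr_sqrtr; last first.
  by apply: sumr_ge0 => i _; exact: sqr_ge0.
rewrite (@le_trans _ _ (\sum_(i < n.+1) e ^+ 2))//.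
  by apply: ler_sum => i _; rewrite -real_normK ?num_real// lerXn2r ?nnegrE.
rewrite sumr_const card_ord exprMn -[leLHS]mulr_natl ler_wpM2r ?sqr_ge0//.
by rewrite expr2 ler_peMl ?ler0n// ler1n.
Qed.

End enorm_theory.

(** * Lebesgue measure under homotheties and reflections *)

Section lebesgue_rV_theory.
Context {R : realType}.
Local Notation leb n := (lebesgue_rV (R := R) n).


Let measure_pushforward d1 d2 (T1 : measurableType d1) (T2 : measurableType d2)
  (m : {measure set T1 -> \bar R}) (f : T1 -> T2) (mf : measurable_fun setT f) :
  {measure set T2 -> \bar R} :=
  measure_function_pushforward__canonical__measure_function_Measure m mf.

(** Uniqueness of Lebesgue measure on half-open intervals; a negative [l] moves the closed end
    without changing the length. Reflections are included because a rough kernel depends on [x - y],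
    so that integration in [y] reverses orientation. *)
Let lebesgue_affine1 (l v : R) (A : set (measurableTypeR R)) : l != 0 -> measurable A ->
  @lebesgue_measure R ((fun x => l * x + v) @^-1` A) =
  (`|l|^-1%:E * lebesgue_measure A)%E.
Proof.
move=> l0 mA.
have ml : measurable_fun [set: measurableTypeR R]
    (fun x => l * x + v : measurableTypeR R).
  by apply: measurable_funD => //; exact: measurable_funM.
have l0' : 0 < `|l| by rewrite normr_gt0.
pose m2 : {measure set _ -> \bar R} := mscale (NngNum (ltW l0'))
   (measure_pushforward (@lebesgue_measure R) ml).
suff : lebesgue_measure A = m2 A.
  rewrite /m2/= /mscale/= => ->; rewrite muleA -EFinM mulVf ?gt_eqF// mul1e //.
apply: lebesgue_measure_unique => //= _ [[a b]] _ <-.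
rewrite /m2/= /mscale/= /pushforward.
have [lp|] := ltP 0 l.
  have -> : (fun x => l * x + v) @^-1` `]a, b] = `](a - v) / l, (b - v) / l]%classic.
    apply/seteqP; split => x/=; rewrite !in_itv/= ltr_pdivrMr// ler_pdivlMr//;
    by rewrite ltrBlDr lerBrDr (mulrC x).
  rewrite !lebesgue_measure_itv/= !lte_fin ltr_pM2r ?invr_gt0// ltrD2r.
  case: ifPn => _; rewrite ?mule0// -!EFinB -EFinM; congr EFin.
  by rewrite gtr0_norm//; field.
rewrite le_eqVlt (negbTE l0)/= => ln.
have -> : (fun x => l * x + v) @^-1` `]a, b] = `[(b - v) / l, (a - v) / l[%classic.
  apply/seteqP; split => x/=; rewrite !in_itv/= ltr_ndivlMr// ler_ndivrMr//;
  by rewrite ltrBlDr lerBrDr (mulrC x) andbC.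
rewrite !lebesgue_measure_itv/= !lte_fin ltr_nM2r ?invr_lt0// ltrD2r.
case: ifPn => _; rewrite ?mule0// -!EFinB -EFinM; congr EFin.
by rewrite ltr0_norm//; field.
Qed.

Lemma measurable_affine_rV n (l : R) (v : 'rV[R]_n) :
  measurable_fun setT (fun x : 'rV[R]_n => l *: x + v).
Proof.
apply/measurable_fun_rVP => i; under eq_fun do rewrite !mxE.
by apply: measurable_funD => //; apply: measurable_funM => //; exact: measurable_coord.
Qed.

Lemma measurable_fun_preimage d1 d2 (T1 : measurableType d1) (T2 : measurableType d2)
  (f : T1 -> T2) A : measurable_fun setT f -> measurable A -> measurable (f @^-1` A).
Proof. by move=> mf mA; rewrite -[X in measurable X]setTI; exact: mf. Qed.

Let boxes n : set (set 'rV[R]_n) :=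
  [set B | exists2 A : 'I_n -> set (measurableTypeR R), (forall i, measurable (A i)) &
     B = [set x : 'rV[R]_n | forall i, A i (x ord0 i)]].

Lemma measurable_box n (A : 'I_n -> set (measurableTypeR R)) :
  (forall i, measurable (A i)) ->
  measurable [set x : 'rV[R]_n | forall i, A i (x ord0 i)].
Proof.
move=> mA; rewrite [X in measurable X](_ : _ = \bigcap_(i in [set: 'I_n])
  ((fun x : 'rV[R]_n => x ord0 i) @^-1` A i)); last first.
  by apply/seteqP; split=> x h => [i _|i]; [exact: h|exact: (h i Logic.I)].
apply: fin_bigcap_measurable; first exact: finite_finset.
by move=> i _; rewrite -[X in measurable X]setTI; apply: measurable_coord => //; exact: mA.
Qed.

Let measurable_boxes n : (measurable : set (set 'rV[R]_n)) = <<s @boxes n >>.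
Proof.
apply/seteqP; split => [|]; last first.
  apply: smallest_sub; first exact: sigma_algebra_measurable.
  by move=> _ [A mA ->]; exact: measurable_box.
apply: (@smallest_sub _ (sigma_algebra setT) (\big[setU/set0]_(i < n)
  preimage_set_system setT (fun x : 'rV[R]_n => x ord0 i) measurable)).
  exact: (smallest_sigma_algebra setT (@boxes n)).
move=> B; rewrite -bigcup_seq => -[i _ [C mC <-]]; apply: sub_sigma_algebra.
exists (fun j => if j == i then C else setT); first by move=> j; case: ifP.
rewrite setTI; apply/seteqP; split => x/=; last by move=> /(_ i); rewrite eqxx.
by move=> Cx j; case: eqP => // ->.
Qed.

Let boxes_setI n : setI_closed (@boxes n).
Proof.
move=> _ _ [A mA ->] [B mB ->]; exists (fun i => A i `&` B i).
  by move=> i; exact: measurableI.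
by apply/seteqP; split => x /=; [move=> [? ?] i; split | move=> h; split=> i; case: (h i)].
Qed.

(** Both sides are measures in [A] that agree on measurable boxes, a generating family stable under
    intersection; the cubes [g'] exhaust the space with finite measure. *)
Lemma lebesgue_rV_affine n (l : R) (v : 'rV[R]_n) (A : set 'rV[R]_n) :
  l != 0 -> measurable A ->
  leb n ((fun x => l *: x + v) @^-1` A) = ((`|l| ^- n)%:E * leb n A)%E.
Proof.
move=> l0 mA.
have l0' : 0 <= `|l| ^- n by rewrite invr_ge0 exprn_ge0.
pose m2 : {measure set _ -> \bar R} := mscale (NngNum l0') (leb n).
pose m1 := measure_pushforward (leb n) (measurable_affine_rV l v).
rewrite -[LHS]/(m1 A) -[RHS]/(m2 A).
pose g k : set 'rV[R]_n :=
  [set x | forall i, `]- k%:R, k%:R[%classic ((l *: x + v) ord0 i)].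
pose g' (k : nat) : set 'rV[R]_n :=
  [set x | forall i, `]- k%:R, k%:R[%classic (x ord0 i)].
have m12 (B : set 'rV[R]_n) : boxes B -> m1 B = m2 B.
  move=> [C mC ->]; rewrite /m1 /m2/= /mscale/= /pushforward.
  rewrite (_ : _ @^-1` _ = [set x : 'rV[R]_n | forall i,
      ((fun t => l * t + v ord0 i) @^-1` C i) (x ord0 i)]); last first.
    by apply/seteqP; split => x /= h i; have := h i; rewrite !mxE.
  rewrite (lebesgue_rV_box mC) (@lebesgue_rV_box _ n
    (fun i => (fun t => l * t + v ord0 i) @^-1` C i)); last first.
    move=> i; apply: (@measurable_fun_preimage _ _ (measurableTypeR R)
      (measurableTypeR R) (fun t => l * t + v ord0 i)) => //.
    by apply: measurable_funD => //; exact: measurable_funM.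
  under eq_bigr do rewrite lebesgue_affine1//.
  rewrite big_split/= prodEFin prodr_const card_ord; congr (_%:E * _)%E.
  by rewrite exprVn.
apply: (measure_unique (@boxes n) g' (@measurable_boxes n) (@boxes_setI n) _ _ m1 m2 m12 _ _ mA)
  => //.
- move=> k; exists (fun=> `]- k%:R, k%:R[%classic) => //.
- apply/seteqP; split => // x _; exists (Num.bound (enorm x)) => //= i.
  rewrite /= in_itv/= -ltr_norml; apply: (le_lt_trans (enorm_coord x i)).
  by rewrite archi_boundP// enorm_ge0.
- move=> k; rewrite m12; last by exists (fun=> `]- k%:R, k%:R[%classic).
  rewrite /m2/= /mscale/= /g' (@lebesgue_rV_box _ n (fun=> `]- k%:R, k%:R[%classic))//.
  apply: lte_mul_pinfty => //.
  rewrite lebesgue_measure_itv/= (_ : (if _ then _ else _) =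
    (if - k%:R < k%:R :> R then k%:R - (- k%:R) else 0 : R)%:E).
    by rewrite prodEFin ltry.
  by rewrite lte_fin; case: ifP.
Qed.


Lemma ge0_integral_affine_rV n (l : R) (v : 'rV[R]_n) (D : set 'rV[R]_n)
    (f : 'rV[R]_n -> \bar R) :
  l != 0 -> measurable D -> measurable_fun D f -> (forall x, D x -> 0 <= f x)%E ->
  (\int[leb n]_(x in (fun x => l *: x + v)%R @^-1` D) f (l *: x + v)%R =
   (`|l| ^- n)%:E * \int[leb n]_(x in D) f x)%E.
Proof.
move=> l0 mD mf f0.
have l0' : 0 <= `|l| ^- n by rewrite invr_ge0 exprn_ge0.
rewrite -(ge0_integral_mscale (leb n) mD (NngNum l0') mf)//.
rewrite -(@ge0_integral_pushforward _ _ _ _ _ _ (measurable_affine_rV l v) (leb n) D f)//.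
  apply: (@eq_measure_integral _ _ _ _ (mscale (NngNum l0') (leb n))
   (measure_pushforward (leb n) (measurable_affine_rV l v))) => A mA _.
  exact: lebesgue_rV_affine.
by move=> x; rewrite inE; exact: f0.
Qed.

End lebesgue_rV_theory.

(** * Volume of Euclidean balls *)

Section balls.
Context {R : realType} {d : nat}.
Local Notation leb := (lebesgue_rV (R := R) d).
Implicit Types (c x : 'rV[R]_d) (r : R).

Lemma measurable_fun_enorm_sub c :
  measurable_fun setT (fun x => enorm (x - c)).
Proof.
apply: (measurableT_comp measurable_enorm).
rewrite (_ : (fun x => x - c) = (fun x => 1 *: x + - c)).
  exact: measurable_affine_rV.
by apply/funext => x; rewrite scale1r.
Qed.

Lemma measurable_eball c r : measurable (eball c r).
Proof.
rewrite (_ : eball c r = (fun x => enorm (x - c)) @^-1` `]-oo, r[%classic).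
  exact: measurable_fun_preimage (measurable_fun_enorm_sub c) _.
by apply/seteqP; split => x; rewrite /eball/= in_itv.
Qed.

Lemma eball_center c r : 0 < r -> eball c r c.
Proof. by rewrite /eball/= subrr enorm0. Qed.

Lemma preimage_affine_eball (l : R) v c r : 0 < l ->
  (fun x => l *: x + v) @^-1` eball (l *: c + v) (l * r) = eball c r.
Proof.
move=> l0; apply/seteqP; split => x; rewrite /eball/= opprD addrACA subrr addr0;
by rewrite -scalerBr enormZ gtr0_norm// ltr_pM2l.
Qed.

Lemma sub_eball c c' r r' : enorm (c - c') + r <= r' -> eball c r `<=` eball c' r'.
Proof.
move=> h x; rewrite /eball/= => xc; apply: lt_le_trans h.
by rewrite (le_lt_trans (ler_enorm_dist c _ _))// addrC ltrD2l.
Qed.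


Lemma sub_eball_box c r :
  eball c r `<=` [set x : 'rV[R]_d | forall i, `[c ord0 i - r, c ord0 i + r]%classic (x ord0 i)].
Proof.
move=> x; rewrite /eball/= => xc i; rewrite /= in_itv/= -ler_distl.
by have := enorm_coord (x - c) i; rewrite !mxE => /le_trans->//; exact: ltW.
Qed.

(** The extra [e] turns the bound [d%:R * e] on a closed box into the strict inequality of an open
    ball, also when [d = 0]. *)
Lemma sub_box_eball c e : 0 < e ->
  [set x : 'rV[R]_d | forall i, `[c ord0 i - e, c ord0 i + e]%classic (x ord0 i)] `<=`
  eball c (d%:R * e + e).
Proof.
move=> e0 x h; rewrite /eball/= (@le_lt_trans _ _ (d%:R * e)) ?ltrDl//.
apply: enorm_le_coord => i; have := h i.
by rewrite !mxE/= in_itv/= ler_distl.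
Qed.

Let measurable_cube c e :
  measurable [set x : 'rV[R]_d | forall i, `[c ord0 i - e, c ord0 i + e]%classic (x ord0 i)].
Proof. exact: (@measurable_box _ _ (fun i => `[c ord0 i - e, c ord0 i + e]%classic)). Qed.

Let lebesgue_cube c e : 0 < e ->
  leb [set x : 'rV[R]_d | forall i, `[c ord0 i - e, c ord0 i + e]%classic (x ord0 i)]
  = ((2 * e) ^+ d)%:E.
Proof.
move=> e0.
rewrite (@lebesgue_rV_box _ _ (fun i => `[c ord0 i - e, c ord0 i + e]%classic))//.
rewrite (eq_bigr (fun=> (2 * e)%:E)) ?prodEFin ?prodr_const ?card_ord// => i _.
rewrite lebesgue_measure_itv/= lte_fin ltrD2l gtrN ?e0//.
by rewrite -EFinB; congr EFin; ring.
Qed.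

Lemma lebesgue_eball_lty c r : (leb (eball c r) < +oo)%E.
Proof.
have r1 : 0 < `|r| + 1 by rewrite ltr_wpDl.
apply: (@le_lt_trans _ _ ((2 * (`|r| + 1)) ^+ d)%:E); last exact: ltry.
rewrite -(lebesgue_cube c r1); apply: le_measure; rewrite ?inE//.
- exact: measurable_eball.
- apply: subset_trans (@sub_eball_box _ _).
  by apply: sub_eball; rewrite subrr enorm0 add0r ler_wpDr ?ler_norm.
Qed.

Lemma lebesgue_eball_gt0 c r : 0 < r -> (0 < leb (eball c r))%E.
Proof.
move=> r0; have d1 : 0 < d%:R + 1 :> R by rewrite ltr_wpDl.
have e0 : 0 < r / (d%:R + 1) by rewrite divr_gt0.
apply: (@lt_le_trans _ _ ((2 * (r / (d%:R + 1))) ^+ d)%:E).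
  by rewrite lte_fin exprn_gt0// mulr_gt0.
rewrite -(lebesgue_cube c e0); apply: le_measure; rewrite ?inE//.
- exact: measurable_eball.
- apply: subset_trans (sub_box_eball e0) _.
  by apply: sub_eball; rewrite subrr enorm0 add0r -{2}(mul1r (r / _)) -mulrDl
     mulrC divfK ?gt_eqF.
Qed.

Definition unit_vol : R := fine (leb (eball 0 1)).

Lemma unit_vol_gt0 : 0 < unit_vol.
Proof. by rewrite fine_gt0// lebesgue_eball_gt0//= lebesgue_eball_lty. Qed.

Lemma lebesgue_eball c r : 0 < r -> leb (eball c r) = (unit_vol * r ^+ d)%:E.
Proof.
move=> r0.
have := @lebesgue_rV_affine _ d r c (eball c r) (lt0r_neq0 r0) (measurable_eball c r).
have := @preimage_affine_eball r c 0 1 r0; rewrite scaler0 add0r mulr1 => -> H.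
rewrite /unit_vol EFinM fineK ?ge0_fin_numE ?lebesgue_eball_lty// H.
rewrite muleAC -EFinM gtr0_norm// mulVf ?mul1e//.
by rewrite expf_neq0// gt_eqF.
Qed.

(** [locally_Lpow] speaks of compact sets; the enclosing closed cube makes it usable on open
    balls. *)
Lemma sub_eball_compact c r : exists A : set 'rV[R]_d,
  [/\ compact A, measurable A & eball c r `<=` A].
Proof.
exists [set x : 'rV[R]_d | forall i, `[c ord0 i - r, c ord0 i + r]%classic (x ord0 i)].
split; [|exact: measurable_cube|exact: sub_eball_box].
by apply: (@rV_compact _ _ (fun i => `[c ord0 i - r, c ord0 i + r]%classic)) => i;
  exact: segment_compact.
Qed.

End balls.

(** * Medians and the two-ball estimate *)

(** [a] is the infimum of the levels [t] at which [{b <= t}] has measure at least [M / 2]; that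
    measure tends to [M] and to [0] at the two ends, so the infimum is finite. Continuity of measure
    along [a + 1/(n+1)] gives the first inequality. Levels below [a] fail the test, so [{b > t}]
    carries more than half of the mass there, and continuity along [a - 1/(n+1)] gives the
    second. *)
Lemma exists_median d (T : measurableType d) (R : realType)
    (mu : {measure set T -> \bar R}) (B : set T) (b : T -> R) (M : R) :
  measurable B -> measurable_fun setT b -> mu B = M%:E -> 0 < M ->
  exists a, ((M / 2)%:E <= mu (B `&` [set x | (b x <= a)%R]))%E /\
            ((M / 2)%:E <= mu (B `&` [set x | (a <= b x)%R]))%E.
Proof.
move=> mB mb muB M0.
have mle t : measurable (B `&` [set x | b x <= t]).
  rewrite (_ : [set x | b x <= t] = setT `&` b @^-1` `]-oo, t]%classic).
    by apply: measurableI => //; exact: mb.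
  by rewrite setTI; apply/seteqP; split => x /=; rewrite in_itv.
have mge t : measurable (B `&` [set x | t <= b x]).
  rewrite (_ : [set x | t <= b x] = setT `&` b @^-1` `[t, +oo[%classic).
    by apply: measurableI => //; exact: mb.
  by rewrite setTI; apply/seteqP; split => x /=; rewrite in_itv/= andbT.
have mgt t : measurable (B `&` [set x | t < b x]).
  rewrite (_ : [set x | t < b x] = setT `&` b @^-1` `]t, +oo[%classic).
    by apply: measurableI => //; exact: mb.
  by rewrite setTI; apply/seteqP; split => x /=; rewrite in_itv/= andbT.
have subM E : measurable E -> E `<=` B -> (mu E < +oo)%E.
  move=> mE EB; apply: (@le_lt_trans _ _ (mu B)); last by rewrite muB ltry.
  by apply: le_measure; rewrite ?inE.
pose m t := mu (B `&` [set x | b x <= t]).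
have m_mono s t : s <= t -> (m s <= m t)%E.
  move=> st; apply: le_measure; rewrite ?inE// => x [Bx /= bx]; split => //=.
  exact: le_trans st.
pose S := [set t | ((M / 2)%:E <= m t)%E].
have S0 : S !=set0.
  apply: contrapT => /forallNP S0.
  have : m n%:R @[n --> \oo] --> mu B.
    rewrite [X in mu X](_ : B = \bigcup_n (B `&` [set x | b x <= n%:R])); last first.
      apply/seteqP; split => [x Bx|x [n _ []]//]; exists (Num.bound `|b x|) => //.
      split => //=; rewrite (le_trans (ler_norm _))// ltW//.
      by rewrite archi_boundP.
    apply: nondecreasing_cvg_mu => //; first exact: bigcup_measurable.
    apply/nondecreasing_seqP => n; apply/subsetPset => x [Bx /= bx]; split => //=.
    by rewrite (le_trans bx)// ler_nat.
  move=> h; have : (mu B <= (M / 2)%:E)%E.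
    rewrite -(cvg_lim _ h)//; apply: lime_le; first by apply/cvg_ex; eexists; exact: h.
    by apply: nearW => n; have /negP := S0 n%:R; rewrite -ltNge => /ltW.
  by rewrite muB lee_fin; lra.
have [n Sn] : exists n, ~ S (- n%:R).
  apply: contrapT => /forallNP nS.
  have : m (- n%:R) @[n --> \oo] --> mu (\bigcap_n (B `&` [set x | b x <= - n%:R])).
    apply: nonincreasing_cvg_mu => //; first by apply: subM => // x [].
      exact: bigcapT_measurable.
    apply/nonincreasing_seqP => n; apply/subsetPset => x [Bx /= bx]; split => //=.
    by rewrite (le_trans bx)// lerN2 ler_nat.
  rewrite (_ : bigcap _ _ = set0) ?measure0; last first.
    apply/seteqP; split => // x /(_ (Num.bound `|b x|) Logic.I) [_ /=].
    apply/negP; rewrite -ltNge ltrNl (le_lt_trans _ (archi_boundP _))//.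
    by rewrite -normrN ler_norm.
  move=> h; have : ((M / 2)%:E <= 0)%E.
    rewrite -(cvg_lim _ h)//; apply: lime_ge; first by apply/cvg_ex; eexists; exact: h.
    by apply: nearW => n; have /contrapT := nS n.
  by rewrite lee_fin; lra.
have hS : has_inf S.
  split => //; exists (- n%:R) => t St; rewrite leNgt; apply/negP => tn.
  by apply: Sn; rewrite /S/= (le_trans St)// m_mono// ltW.
pose a := inf S; exists a; split.
  have : m (a + n.+1%:R^-1) @[n --> \oo] -->
      mu (\bigcap_n (B `&` [set x | b x <= a + n.+1%:R^-1])).
    apply: nonincreasing_cvg_mu => //; first by apply: subM => // x [].
      exact: bigcapT_measurable.
    apply/nonincreasing_seqP => k; apply/subsetPset => x [Bx /= bx]; split => //=.
    by rewrite (le_trans bx)// lerD2l lef_pV2 ?posrE// ler_nat.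
  rewrite (_ : bigcap _ _ = B `&` [set x | b x <= a]); last first.
    apply/seteqP; split => x /=; last first.
      move=> [Bx bx] k _; split => //=; apply: (le_trans bx).
      by rewrite lerDl invr_ge0.
    move=> h; split; first by case: (h 0%N Logic.I).
    apply/ler_addgt0Pr => e e0.
    have [_ /= /le_trans->//] := h (Num.truncn e^-1) Logic.I.
    rewrite lerD2l invf_ple ?posrE// ltW// truncnS_gt//.
  move=> h; rewrite -(cvg_lim _ h)//; apply: lime_ge.
    by apply/cvg_ex; eexists; exact: h.
  apply: nearW => k; have k0 : 0 < k.+1%:R^-1 :> R by rewrite invr_gt0.
  by have [s Ss /ltW/m_mono] := inf_adherent k0 hS; exact: le_trans.
have : mu (B `&` [set x | a - n.+1%:R^-1 < b x]) @[n --> \oo] -->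
      mu (\bigcap_n (B `&` [set x | a - n.+1%:R^-1 < b x])).
  apply: nonincreasing_cvg_mu => //; first by apply: subM => // x [].
    exact: bigcapT_measurable.
  apply/nonincreasing_seqP => k; apply/subsetPset => x [Bx /= bx]; split => //=.
  by rewrite (le_lt_trans _ bx)// lerD2l lerN2 lef_pV2 ?posrE// ler_nat.
rewrite (_ : bigcap _ _ = B `&` [set x | a <= b x]); last first.
  apply/seteqP; split => x /=; last first.
    move=> [Bx bx] k _; split => //=; apply: (lt_le_trans _ bx).
    by rewrite ltrBlDr ltrDl invr_gt0.
  move=> h; split; first by case: (h 0%N Logic.I).
  apply/ler_addgt0Pr => e e0.
  have [_ /=] := h (Num.truncn e^-1) Logic.I; rewrite ltrBlDr => /ltW/le_trans->//.
  rewrite lerD2l invf_ple ?posrE// ltW// truncnS_gt//.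
move=> h; rewrite -(cvg_lim _ h)//; apply: lime_ge.
  by apply/cvg_ex; eexists; exact: h.
apply: nearW => k; set t := a - _.
have nSt : ~ S t.
  move=> St; have := ge_inf (proj2 hS) St; rewrite -/a leNgt => /negP; apply.
  by rewrite ltrBlDr ltrDl invr_gt0.
have : mu B = (m t + mu (B `&` [set x | (t < b x)%R]))%E.
  rewrite -measureU//; last by apply/seteqP; split => // x [[_ /=]] + [_ /=]; case: ltP.
  congr (mu _); apply/seteqP; split => x; last by case=> -[].
  by move=> Bx /=; case: (leP (b x) t) => bt; [left|right].
have : (m t < (M / 2)%:E)%E by rewrite ltNge; apply/negP.
rewrite muB -(@fineK _ (m t)); last by rewrite ge0_fin_numE// subM// => x [].
rewrite -(@fineK _ (mu (B `&` [set x | t < b x]))); last first.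
  by rewrite ge0_fin_numE// subM// => x [].
by rewrite -EFinD lte_fin lee_fin => ? [?]; lra.
Qed.

Lemma ler_normD_expn (R : realDomainType) (s t : R) k :
  `|s + t| ^+ k <= 2 ^+ k * (`|s| ^+ k + `|t| ^+ k).
Proof.
wlog st : s t / `|s| <= `|t|.
  move=> H; have [/H//|/ltW/H] := leP `|s| `|t|.
  by rewrite addrC [X in _ <= _ * X]addrC.
apply: (@le_trans _ _ ((2 * `|t|) ^+ k)).
  rewrite lerXn2r ?nnegrE ?mulr_ge0//; apply: (le_trans (ler_normD _ _)).
  by rewrite mulr_natl mulr2n lerD2r.
by rewrite exprMn ler_wpM2l ?exprn_ge0// lerDr exprn_ge0.
Qed.

(** * The form on sets lying on opposite sides of a level *)

Section median_estimate.
Context {disp : measure_display} {T : measurableType disp} {R : realType}.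
Variable mu : {sigma_finite_measure set T -> \bar R}.
Local Notation mu2 := (mu \x mu)%E.

(** Schur-type bound: Tonelli with the variable of [P] outermost, so that only integrals of [G] in
    the other variable enter. *)
Lemma integral_prod_le2 (P : T -> R) (G : T * T -> R) (D : R) :
  measurable_fun setT P -> measurable_fun setT G ->
  (forall y, 0 <= P y) -> (forall z, 0 <= G z) ->
  (forall y, \int[mu]_x (G (x, y))%:E <= D%:E)%E ->
  (\int[mu2]_z (P z.2 * G z)%:E <= D%:E * \int[mu]_y (P y)%:E)%E.
Proof.
move=> mP mG P0 G0 GD.
have mPG : measurable_fun setT (fun z : T * T => (P z.2 * G z)%:E).
  apply/measurable_EFinP; apply: measurable_funM => //.
  exact: (measurableT_comp mP measurable_snd).
rewrite (fubini_tonelli2 (fun z => (P z.2 * G z)%:E))//; last first.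
  by move=> z; rewrite lee_fin mulr_ge0.
rewrite -ge0_integralZl//; last 3 first.
- by exact/measurable_EFinP.
- by move=> y _; rewrite lee_fin.
- by apply: le_trans (GD point); apply: integral_ge0 => x _; rewrite lee_fin.
apply: ge0_le_integral => //.
- move=> y _; apply: integral_ge0 => x _; by rewrite lee_fin mulr_ge0.
- by apply: measurable_fun_fubini_tonelli_G => // z; rewrite lee_fin mulr_ge0.
- by apply/measurable_EFinP; apply: measurable_funM.
move=> y _; rewrite /fubini_G/=.
under eq_integral do rewrite EFinM.
rewrite ge0_integralZl//.
- by rewrite muleC lee_wpmul2r// lee_fin.
- by apply/measurable_EFinP; exact: measurable_fun_pair1.
- by move=> x _; rewrite lee_fin.
- by rewrite lee_fin.
Qed.

Lemma integral_prod_le1 (P : T -> R) (G : T * T -> R) (D : R) :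
  measurable_fun setT P -> measurable_fun setT G ->
  (forall y, 0 <= P y) -> (forall z, 0 <= G z) ->
  (forall x, \int[mu]_y (G (x, y))%:E <= D%:E)%E ->
  (\int[mu2]_z (P z.1 * G z)%:E <= D%:E * \int[mu]_y (P y)%:E)%E.
Proof.
move=> mP mG P0 G0 GD.
have mPG : measurable_fun setT (fun z : T * T => (P z.1 * G z)%:E).
  apply/measurable_EFinP; apply: measurable_funM => //.
  exact: (measurableT_comp mP measurable_fst).
rewrite (fubini_tonelli1 (fun z => (P z.1 * G z)%:E))//; last first.
  by move=> z; rewrite lee_fin mulr_ge0.
rewrite -ge0_integralZl//; last 3 first.
- by exact/measurable_EFinP.
- by move=> y _; rewrite lee_fin.
- by apply: le_trans (GD point); apply: integral_ge0 => x _; rewrite lee_fin.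
apply: ge0_le_integral => //.
- by move=> y _; apply: integral_ge0 => x _; rewrite lee_fin mulr_ge0.
- by apply: measurable_fun_fubini_tonelli_F => // z; rewrite lee_fin mulr_ge0.
- by apply/measurable_EFinP; apply: measurable_funM.
move=> x _; rewrite /fubini_F/=.
under eq_integral do rewrite EFinM.
rewrite ge0_integralZl//.
- by rewrite muleC lee_wpmul2r// lee_fin.
- by apply/measurable_EFinP; exact: measurable_fun_pair2.
- by move=> y _; rewrite lee_fin.
- by rewrite lee_fin.
Qed.

Variables (b : T -> R) (h : T * T -> R) (k : nat) (B B' E F : set T) (h0 delta a t0 M : R).
Hypotheses (mb : measurable_fun setT b) (mh : measurable_fun setT h).
Hypotheses (mB : measurable B) (mB' : measurable B').
Hypotheses (mE : measurable E) (mF : measurable F) (EB : E `<=` B) (FB' : F `<=` B').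
Hypotheses (BM : (mu B <= M%:E)%E) (B'M : (mu B' <= M%:E)%E).
Hypothesis hB : forall y, B y -> (\int[mu]_(x in B') `|h (x, y) - h0|%:E <= delta%:E)%E.
Hypothesis hB' : forall x, B' x -> (\int[mu]_(y in B) `|h (x, y) - h0|%:E <= delta%:E)%E.
Hypothesis Efin : (\int[mu]_(y in E) (`|b y - a| ^+ k)%:E < +oo)%E.
Hypothesis Ffin : (\int[mu]_(x in F) (`|b x - a| ^+ k)%:E < +oo)%E.
Hypothesis delta0 : 0 <= delta.
Hypothesis form : `|\int[mu2]_z ((b z.1 - b z.2) ^+ k * h z * \1_E z.2 * \1_F z.1)| <= t0.
Hypothesis opposite :
  (forall x y, F x -> E y -> b x <= a <= b y) \/ (forall x y, F x -> E y -> b y <= a <= b x).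

Let u A (y : T) : R := `|b y - a| ^+ k * \1_A y.
Let G (z : T * T) : R := \1_F z.1 * \1_E z.2.
(** The tested integrand without the kernel, in absolute value. Since [b x - b y] keeps one sign on
    [F] times [E], nothing is lost by taking it. *)
Let W (z : T * T) : R := `|b z.1 - b z.2| ^+ k * G z.

Let M0 : 0 <= M. Proof. by rewrite -lee_fin (le_trans _ BM). Qed.

Let mu_ A : measurable A -> measurable_fun setT (u A).
Proof.
move=> mA; apply: measurable_funM; last exact: measurable_indic.
apply: measurable_funX; apply: measurableT_comp => //.
exact: measurable_funB.
Qed.

Let u0 A y : 0 <= u A y.
Proof. by rewrite mulr_ge0// exprn_ge0. Qed.

Let mG : measurable_fun setT G.
Proof.
apply: measurable_funM.
  exact: (measurableT_comp (measurable_indic mF) measurable_fst).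
exact: (measurableT_comp (measurable_indic mE) measurable_snd).
Qed.

Let G0 z : 0 <= G z. Proof. by rewrite mulr_ge0. Qed.

Let mb1 : measurable_fun setT (fun z : T * T => b z.1).
Proof. exact: (measurableT_comp mb measurable_fst). Qed.

Let mb2 : measurable_fun setT (fun z : T * T => b z.2).
Proof. exact: (measurableT_comp mb measurable_snd). Qed.

Let mW : measurable_fun setT W.
Proof.
apply: measurable_funM => //.
apply: measurable_funX; apply: measurableT_comp => //.
exact: measurable_funB.
Qed.

Let W0 z : 0 <= W z. Proof. by rewrite mulr_ge0// exprn_ge0. Qed.

Let int_u A : measurable A ->
  (\int[mu]_y (u A y)%:E = \int[mu]_(y in A) (`|b y - a| ^+ k)%:E)%E.
Proof.
move=> mA; rewrite [RHS]integral_mkcond; apply: eq_integral => y _.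
rewrite /u patchE indicE; case: ifPn => yA; rewrite ?mulr1 ?mulr0//.
Qed.

(** [|b x - b y|^k] is at most [2^k (|b y - a|^k + |b x - a|^k)]. Each term involves one variable
    only, and [g] is integrated in the other. The choice [g = 1] yields integrability of [W], and
    [g = |h - h0|] the error term. *)
Let W_bound (g : T * T -> R) (D : R) : measurable_fun setT g -> (forall z, 0 <= g z) ->
  0 <= D ->
  (forall y, B y -> (\int[mu]_(x in B') (g (x, y))%:E <= D%:E)%E) ->
  (forall x, B' x -> (\int[mu]_(y in B) (g (x, y))%:E <= D%:E)%E) ->
  (\int[mu2]_z (W z * g z)%:E <=
   (2 ^+ k * D)%:E * (\int[mu]_(y in E) (`|b y - a| ^+ k)%:E
                      + \int[mu]_(x in F) (`|b x - a| ^+ k)%:E))%E.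
Proof.
move=> mg g0 D0 gB gB'.
have mGg : measurable_fun setT (fun z => G z * g z) by exact: measurable_funM.
have Gg0 z : 0 <= G z * g z by rewrite mulr_ge0.
have mE2 : measurable_fun setT (fun z : T * T => u E z.2 * (G z * g z)).
  apply: measurable_funM => //.
  exact: (measurableT_comp (mu_ mE) measurable_snd).
have mF1 : measurable_fun setT (fun z : T * T => u F z.1 * (G z * g z)).
  apply: measurable_funM => //.
  exact: (measurableT_comp (mu_ mF) measurable_fst).
apply: (@le_trans _ _ (\int[mu2]_z ((2 ^+ k)%:E *
    ((u E z.2 * (G z * g z))%:E + (u F z.1 * (G z * g z))%:E)))%E).
  apply: ge0_le_integral => //.
  - by move=> z _; rewrite lee_fin mulr_ge0.
  - by apply/measurable_EFinP; exact: measurable_funM.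
  - apply/measurable_EFinP; apply: measurable_funM => //.
    exact: measurable_funD.
  move=> z _; rewrite -EFinD -EFinM lee_fin /W /u /G !indicE.
  case: (boolP (z.1 \in F)) => _; last by rewrite !(mul0r, mulr0, addr0).
  case: (boolP (z.2 \in E)) => _; last by rewrite !(mul0r, mulr0, addr0).
  rewrite !mulr1 !mul1r -mulrDl mulrA ler_wpM2r//.
  have -> : b z.1 - b z.2 = (a - b z.2) + (b z.1 - a) by ring.
  by rewrite (le_trans (ler_normD_expn _ _ _))// (distrC a).
rewrite ge0_integralZl//; last 2 first.
- by apply/measurable_EFinP; exact: measurable_funD.
- by move=> z _; rewrite -EFinD lee_fin addr_ge0// mulr_ge0.
rewrite ge0_integralD//; last 4 first.
- by move=> z _; rewrite lee_fin mulr_ge0.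
- exact/measurable_EFinP.
- by move=> z _; rewrite lee_fin mulr_ge0.
- exact/measurable_EFinP.
rewrite EFinM -muleA lee_wpmul2l ?lee_fin ?exprn_ge0//.
rewrite ge0_muleDr ?integral_ge0//; try by move=> y _; rewrite lee_fin exprn_ge0.
rewrite -!int_u//; apply: leeD.
- apply: (integral_prod_le2 (mu_ mE) mGg (u0 E) Gg0) => y.
  have [yE|yE] := boolP (y \in E); last first.
    rewrite integral0_eq ?lee_fin// => x _.
    by rewrite /G/= !indicE (negbTE yE) mulr0 mul0r.
  apply: le_trans (gB y _); last by apply: EB; exact/set_mem.
  rewrite [leRHS]integral_mkcond; apply: ge0_le_integral => //.
  + by move=> x _; rewrite lee_fin.
  + by apply/measurable_EFinP; exact: (measurable_fun_pair1 y mGg).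
  + apply/measurable_restrict => //; rewrite ?setTI; apply: measurable_funTS.
    by apply/measurable_EFinP; exact: (measurable_fun_pair1 y mg).
  + move=> x _; rewrite patchE /G/= !indicE yE mulr1.
    have [xF|xF] := boolP (x \in F).
      by rewrite mul1r mem_set//; apply: FB'; exact/set_mem.
    by rewrite mul0r; case: ifP => // _; rewrite lee_fin.
- apply: (integral_prod_le1 (mu_ mF) mGg (u0 F) Gg0) => x.
  have [xF|xF] := boolP (x \in F); last first.
    rewrite integral0_eq ?lee_fin// => y _.
    by rewrite /G/= !indicE (negbTE xF) !mul0r.
  apply: le_trans (gB' x _); last by apply: FB'; exact/set_mem.
  rewrite [leRHS]integral_mkcond; apply: ge0_le_integral => //.
  + by move=> y _; rewrite lee_fin.
  + by apply/measurable_EFinP; exact: (measurable_fun_pair2 x mGg).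
  + apply/measurable_restrict => //; rewrite ?setTI; apply: measurable_funTS.
    by apply/measurable_EFinP; exact: (measurable_fun_pair2 x mg).
  + move=> y _; rewrite patchE /G/= !indicE xF mul1r.
    have [yE|yE] := boolP (y \in E).
      by rewrite mul1r mem_set//; apply: EB; exact/set_mem.
    by rewrite mul0r; case: ifP => // _; rewrite lee_fin.
Qed.

Let int_uE_uF : (\int[mu]_(y in E) (`|b y - a| ^+ k)%:E
                      + \int[mu]_(x in F) (`|b x - a| ^+ k)%:E < +oo)%E.
Proof. by rewrite lte_add_pinfty. Qed.

Let W_int : mu2.-integrable setT (EFin \o W).
Proof.
apply/integrableP; split; first exact/measurable_EFinP.
under eq_integral do rewrite /= ger0_norm//.
apply: (@le_lt_trans _ _ (\int[mu2]_z (W z * 1)%:E)%E).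
  by rewrite (eq_integral (fun z => (W z * 1)%:E))// => z _; rewrite mulr1.
apply: (le_lt_trans (W_bound (D := M) _ _ _ _ _)) => //.
- by move=> y _; rewrite integral_cst// mul1e.
- by move=> y _; rewrite integral_cst// mul1e.
- by rewrite lte_mul_pinfty// lee_fin mulr_ge0// exprn_ge0.
Qed.

Let m_hh0 : measurable_fun setT (fun z => `|h z - h0|).
Proof. apply: measurableT_comp => //; exact: measurable_funB. Qed.

Let Wh_bound : (\int[mu2]_z (W z * `|h z - h0|)%:E <=
   (2 ^+ k * delta)%:E * (\int[mu]_(y in E) (`|b y - a| ^+ k)%:E
                      + \int[mu]_(x in F) (`|b x - a| ^+ k)%:E))%E.
Proof. exact: (W_bound m_hh0). Qed.

Let Whh0_int : mu2.-integrable setT (EFin \o (fun z => W z * (h z - h0))).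
Proof.
apply/integrableP; split.
  by apply/measurable_EFinP; apply: measurable_funM => //; exact: measurable_funB.
under eq_integral do rewrite /= normrM (ger0_norm (W0 _)).
apply: (le_lt_trans Wh_bound).
by rewrite lte_mul_pinfty// lee_fin mulr_ge0// exprn_ge0.
Qed.



(** Integrability must be known before the real-valued integral of [W * h] is split in [W_form]. *)
Let Wh_int : mu2.-integrable setT (EFin \o (fun z => W z * h z)).
Proof.
rewrite (_ : _ \o _ = (EFin \o (fun z => W z * (h z - h0))) \+
    (fun z => h0%:E * (EFin \o W) z)%E).
  by apply: integrableD => //; exact: integrableZl.
by apply/funext => z /=; rewrite -EFinM -EFinD; congr EFin; ring.
Qed.

(** On [F] times [E], [(b x - b y)^k = s |b x - b y|^k] with [s = (-1)^k] or [s = 1] according to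
    the alternative in [opposite], so the tested integrand is [s W h]. *)
Let Wh_t0 : `|\int[mu2]_z (W z * h z)| <= t0.
Proof.
suff [s s1 hs] : exists2 s : R, `|s| = 1 &
    forall z, (b z.1 - b z.2) ^+ k * h z * \1_E z.2 * \1_F z.1 = s * (W z * h z).
  apply: le_trans form.
  rewrite [X in _ <= `|X|](@eq_Rintegral _ _ _ _ _ (fun z => s * (W z * h z))); last first.
    by move=> z _; exact: hs.
  by rewrite RintegralZl// normrM s1 mul1r.
have WE s : (forall x y, F x -> E y -> (b x - b y) ^+ k = s * `|b x - b y| ^+ k) ->
    forall z, (b z.1 - b z.2) ^+ k * h z * \1_E z.2 * \1_F z.1 = s * (W z * h z).
  move=> hs [x y]; rewrite /W /G/= !indicE.
  have [xF|] := boolP (x \in F); last by rewrite !(mulr0, mul0r).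
  have [yE|] := boolP (y \in E); last by rewrite !(mulr0, mul0r).
  by rewrite hs; [ring|exact/set_mem|exact/set_mem].
case: opposite => ab.
  exists ((- 1) ^+ k); first by rewrite normrX normrN1 expr1n.
  apply: WE => x y Fx Ey; have /andP[xa ay] := ab x y Fx Ey.
  rewrite -exprMn ler0_norm ?mulN1r ?opprK//; lra.
exists 1; first by rewrite normr1.
apply: WE => x y Fx Ey; have /andP[xa ay] := ab x y Fx Ey.
by rewrite mul1r ger0_norm//; lra.
Qed.

Let W_form : (`|h0|%:E * (\int[mu2]_z (W z)%:E) <=
  t0%:E + \int[mu2]_z (W z * `|h z - h0|)%:E)%E.
Proof.
have fW : (\int[mu2]_z (W z)%:E)%E \is a fin_num by exact: (integrable_fin_num _ W_int).
have fWh : (\int[mu2]_z (W z * `|h z - h0|)%:E)%E \is a fin_num.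
  have := integrable_fin_num measurableT (integrable_abse Whh0_int).
  congr (_ \is a _); apply: eq_integral => z _ /=.
  by rewrite normrM (ger0_norm (W0 z)).
have hI : \int[mu2]_z (W z * h z) = \int[mu2]_z (W z * (h z - h0)) + h0 * \int[mu2]_z (W z).
  rewrite -RintegralZl// -RintegralD//; last exact: (integrableZl measurableT h0 W_int).
  by apply: eq_Rintegral => z _; ring.
rewrite -(fineK fW) -(fineK fWh) -EFinM -EFinD lee_fin.
rewrite -[fine (\int[mu2]_z (W z)%:E)%E]/(\int[mu2]_z W z).
rewrite -[fine (\int[mu2]_z (W z * _)%:E)%E]/(\int[mu2]_z (W z * `|h z - h0|)).
have : `|\int[mu2]_z (W z * (h z - h0))| <= \int[mu2]_z (W z * `|h z - h0|).
  apply: (le_trans (le_normr_Rintegral _ Whh0_int)) => //.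
  rewrite le_eqVlt; apply/orP; left; apply/eqP; apply: eq_Rintegral => z _.
  by rewrite normrM (ger0_norm (W0 z)).
have : 0 <= \int[mu2]_z W z by apply: Rintegral_ge0.
move=> IW0; rewrite -[X in _ * X](ger0_norm IW0) -normrM.
have := Wh_t0; rewrite hI; set p := h0 * _; set q := \int[mu2]_z (W z * (h z - h0)).
set r := \int[mu2]_z _ => H1 H2.
have -> : p = (q + p) - q by ring.
by rewrite (le_trans (ler_normB _ _))// lerD.
Qed.

Let opp_dist x y : F x -> E y -> `|b y - a| <= `|b x - b y| /\ `|b x - a| <= `|b x - b y|.
Proof.
move=> Fx Ey; case: opposite => /(_ x y Fx Ey) /andP[h1 h2].
  by split; rewrite (ler0_norm (_ : b x - b y <= 0)) ?ler_norml; lra.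
by split; rewrite (ger0_norm (_ : 0 <= b x - b y)) ?ler_norml; lra.
Qed.

Let int_u_ge0 A : (0 <= \int[mu]_(y in A) (`|b y - a| ^+ k)%:E)%E.
Proof. by apply: integral_ge0 => y _; rewrite lee_fin exprn_ge0. Qed.

(** As [a] separates the values of [b] on [E] and [F], [|b x - b y| >= |b y - a|]; integrating over
    [x] in [F] produces the factor [mu F]. *)
Let W_lowerE : (mu F * \int[mu]_(y in E) (`|b y - a| ^+ k)%:E <= \int[mu2]_z (W z)%:E)%E.
Proof.
have mF1 : measurable_fun setT (fun z : T * T => \1_F z.1 : R).
  exact: (measurableT_comp (measurable_indic mF) measurable_fst).
have muE : measurable_fun setT (fun z : T * T => u E z.2 * \1_F z.1).
  apply: measurable_funM => //; exact: (measurableT_comp (mu_ mE) measurable_snd).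
apply: (@le_trans _ _ (\int[mu2]_z (u E z.2 * \1_F z.1)%:E)%E); last first.
  apply: ge0_le_integral => //.
  - by move=> z _; rewrite lee_fin mulr_ge0.
  - exact/measurable_EFinP.
  - exact/measurable_EFinP.
  move=> [x y] _; rewrite lee_fin /W /u /G/= !indicE.
  have [xF|] := boolP (x \in F); last by rewrite !(mulr0, mul0r).
  have [yE|] := boolP (y \in E); last by rewrite !(mulr0, mul0r).
  rewrite !mulr1 lerXn2r ?nnegrE//.
  by case: (@opp_dist x y) => //; exact/set_mem.
rewrite (fubini_tonelli2 (fun z => (u E z.2 * \1_F z.1)%:E))//; last 2 first.
- exact/measurable_EFinP.
- by move=> z; rewrite lee_fin mulr_ge0.
rewrite -int_u// -ge0_integralZl//; last 2 first.
- exact/measurable_EFinP/mu_.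
- by move=> y _; rewrite lee_fin.
rewrite le_eqVlt; apply/orP; left; apply/eqP; apply: eq_integral => y _.
rewrite /fubini_G/=; under [RHS]eq_integral do rewrite EFinM.
rewrite ge0_integralZl//; last 2 first.
- exact/measurable_EFinP/measurable_indic.
- by rewrite lee_fin.
by rewrite integral_indic// setIT muleC.
Qed.

Let W_lowerF : (mu E * \int[mu]_(y in F) (`|b y - a| ^+ k)%:E <= \int[mu2]_z (W z)%:E)%E.
Proof.
have mE1 : measurable_fun setT (fun z : T * T => \1_E z.2 : R).
  exact: (measurableT_comp (measurable_indic mE) measurable_snd).
have muF : measurable_fun setT (fun z : T * T => u F z.1 * \1_E z.2).
  apply: measurable_funM => //; exact: (measurableT_comp (mu_ mF) measurable_fst).
apply: (@le_trans _ _ (\int[mu2]_z (u F z.1 * \1_E z.2)%:E)%E); last first.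
  apply: ge0_le_integral => //.
  - by move=> z _; rewrite lee_fin mulr_ge0.
  - exact/measurable_EFinP.
  - exact/measurable_EFinP.
  move=> [x y] _; rewrite lee_fin /W /u /G/= !indicE.
  have [xF|] := boolP (x \in F); last by rewrite !(mulr0, mul0r).
  have [yE|] := boolP (y \in E); last by rewrite !(mulr0, mul0r).
  rewrite !mulr1 lerXn2r ?nnegrE//.
  by case: (@opp_dist x y) => //; exact/set_mem.
rewrite (fubini_tonelli1 (fun z => (u F z.1 * \1_E z.2)%:E))//; last 2 first.
- exact/measurable_EFinP.
- by move=> z; rewrite lee_fin mulr_ge0.
rewrite -int_u// -ge0_integralZl//; last 2 first.
- exact/measurable_EFinP/mu_.
- by move=> y _; rewrite lee_fin.
rewrite le_eqVlt; apply/orP; left; apply/eqP; apply: eq_integral => x _.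
rewrite /fubini_F/=; under [RHS]eq_integral do rewrite EFinM.
rewrite ge0_integralZl//; last 2 first.
- exact/measurable_EFinP/measurable_indic.
- by rewrite lee_fin.
by rewrite integral_indic// setIT muleC.
Qed.

(* The sign of [(b x - b y) ^+ k] is constant for [x] in [F] and [y] in [E]. *)
Lemma opposite_sides_estimate :
  (`|h0|%:E * (mu F * \int[mu]_(y in E) (`|b y - a| ^+ k)%:E) <= t0%:E +
   (2 ^+ k * delta)%:E * (\int[mu]_(y in E) (`|b y - a| ^+ k)%:E
                      + \int[mu]_(x in F) (`|b x - a| ^+ k)%:E))%E /\
  (`|h0|%:E * (mu E * \int[mu]_(x in F) (`|b x - a| ^+ k)%:E) <= t0%:E +
   (2 ^+ k * delta)%:E * (\int[mu]_(y in E) (`|b y - a| ^+ k)%:E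
                      + \int[mu]_(x in F) (`|b x - a| ^+ k)%:E))%E.
Proof.
by split; (apply: (@le_trans _ _ (`|h0|%:E * (\int[mu2]_z (W z)%:E))%E);
  first by rewrite lee_wpmul2l ?lee_fin);
  apply: (le_trans W_form); rewrite leeD2l.
Qed.

End median_estimate.

(** * Absorption of the errors between two balls *)

Section two_balls.
Context {disp : measure_display} {T : measurableType disp} {R : realType}.
Variable mu : {sigma_finite_measure set T -> \bar R}.
Local Notation mu2 := (mu \x mu)%E.
Variables (b : T -> R) (k : nat).
Hypothesis mb : measurable_fun setT b.

Definition osc (A : set T) (a : R) : \bar R := (\int[mu]_(y in A) (`|b y - a| ^+ k)%:E)%E.

Lemma osc_ge0 A a : (0 <= osc A a)%E.
Proof. by apply: integral_ge0 => y _; rewrite lee_fin exprn_ge0. Qed.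

Let mp a (A : set T) : measurable_fun A (fun y => (`|b y - a| ^+ k)%:E).
Proof.
apply: measurable_funTS; apply/measurable_EFinP.
apply: measurable_funX; apply: measurableT_comp => //.
exact: measurable_funB.
Qed.

Lemma osc_sub (A B : set T) a : measurable A -> measurable B -> A `<=` B ->
  (osc A a <= osc B a)%E.
Proof.
move=> mA mB AB; apply: ge0_subset_integral => // y _.
Qed.

Lemma measurable_le_set (A : set T) a : measurable A ->
  measurable (A `&` [set x | b x <= a]).
Proof.
move=> mA; rewrite (_ : [set x | b x <= a] = setT `&` b @^-1` `]-oo, a]%classic).
  by apply: measurableI => //; exact: mb.
by rewrite setTI; apply/seteqP; split => x /=; rewrite in_itv.
Qed.

Lemma measurable_ge_set (A : set T) a : measurable A ->
  measurable (A `&` [set x | a <= b x]).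
Proof.
move=> mA; rewrite (_ : [set x | a <= b x] = setT `&` b @^-1` `[a, +oo[%classic).
  by apply: measurableI => //; exact: mb.
by rewrite setTI; apply/seteqP; split => x /=; rewrite in_itv/= andbT.
Qed.

Lemma osc_split (A : set T) a : measurable A ->
  (osc A a <= osc (A `&` [set x | (a <= b x)%R]) a + osc (A `&` [set x | (b x <= a)%R]) a)%E.
Proof.
move=> mA; pose A' := A `\` [set x | a <= b x].
have mA' : measurable A'.
  rewrite (_ : A' = A `\` (A `&` [set x | a <= b x])).
    by apply: measurableD => //; exact: measurable_ge_set.
  by apply/seteqP; split => x /= [Ax]; [move=> nx; split => // -[]|move=> nx; split => // ?; exact: nx].
rewrite (_ : osc A a = osc (A `&` [set x | (a <= b x)%R]) a + osc A' a)%E.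
  rewrite leeD2l// osc_sub//; first exact: measurable_le_set.
  by move=> x [Ax /= /negP]; rewrite -ltNge => /ltW.
rewrite /osc -ge0_integral_setU//.
- by rewrite /A' setUIDK.
- exact: measurable_ge_set.
- by apply/disj_setPS => x [[_ +] [_]].
Qed.

Let half_bound (M a : R) (A D : set T) : 0 <= M -> measurable A -> measurable D ->
  D `<=` A -> ((M / 2)%:E <= mu D)%E -> forall c : R,
  (forall y, D y -> c <= `|b y - a|) -> 0 <= c -> ((c ^+ k * (M / 2))%:E <= osc A a)%E.
Proof.
move=> M0 mA mD DA MD c cD c0; apply: le_trans (osc_sub a mD mA DA).
apply: (@le_trans _ _ (\int[mu]_(y in D) (c ^+ k)%:E)%E).
  by rewrite integral_cst// EFinM lee_wpmul2l// lee_fin exprn_ge0.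
apply: ge0_le_integral => //.
- by move=> y _; rewrite lee_fin exprn_ge0.
- by move=> y Dy; rewrite lee_fin lerXn2r ?nnegrE// cD.
Qed.

(** At least half of [A] lies on the side of [m] away from [a], where [|b - a| >= |a - m|]; hence
    [|a - m|^k M <= 2 osc A a], and [ler_normD_expn] gives the factor [2^k (1 + 2)]. *)
Lemma osc_median (A : set T) (M m a : R) : measurable A -> 0 < M ->
  mu A = M%:E ->
  ((M / 2)%:E <= mu (A `&` [set x | (b x <= m)%R]))%E ->
  ((M / 2)%:E <= mu (A `&` [set x | (m <= b x)%R]))%E ->
  (osc A m <= (3 * 2 ^+ k)%:E * osc A a)%E.
Proof.
move=> mA M0 muA mle mge.
have am : ((`|a - m| ^+ k * (M / 2))%:E <= osc A a)%E.
  have [am|ma] := leP a m.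
    apply: (half_bound (ltW M0) mA (measurable_ge_set m mA)) => // y [_ /= my].
    by rewrite ler0_norm ?ger0_norm; lra.
  apply: (half_bound (ltW M0) mA (measurable_le_set m mA)) => // y [_ /= my].
  by rewrite gtr0_norm ?ler0_norm; lra.
apply: (@le_trans _ _ (\int[mu]_(y in A) ((2 ^+ k)%:E *
    ((`|b y - a| ^+ k)%:E + (`|a - m| ^+ k)%:E)))%E).
  apply: ge0_le_integral => //.
  - by apply: measurable_funeM; apply: emeasurable_funD.
  - move=> y _; rewrite -EFinD -EFinM lee_fin.
    have -> : b y - m = (b y - a) + (a - m) by ring.
    exact: ler_normD_expn.
rewrite ge0_integralZl//; [|by apply: emeasurable_funD|by move=> y _; rewrite adde_ge0].
rewrite ge0_integralD// [X in (_ * (_ + X))%E](_ : _ = (`|a - m| ^+ k)%:E * M%:E)%E;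
  last by rewrite integral_cst// -muA.
rewrite -/(osc A a).
rewrite (mulrC 3) EFinM -muleA lee_wpmul2l ?lee_fin ?exprn_ge0//.
have -> : (3%:E * osc A a = osc A a + 2%:E * osc A a)%E.
  rewrite (_ : 3 = 1 + 2)%R; last by ring.
  by rewrite EFinD ge0_muleDl ?mul1e ?lee_fin.
rewrite leeD2l// -EFinM (_ : _ * M = 2 * (`|a - m| ^+ k * (M / 2))); last by field.
by rewrite EFinM lee_wpmul2l ?lee_fin.
Qed.

Variables (h : T * T -> R) (B B' : set T) (h0 t0 M : R).
Hypotheses (mh : measurable_fun setT h).
Hypotheses (mB : measurable B) (mB' : measurable B') (M0 : 0 < M).
Hypotheses (BM : mu B = M%:E) (B'M : mu B' = M%:E).
Hypothesis Bfin : forall a, (osc B a < +oo)%E.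
Hypothesis B'fin : forall a, (osc B' a < +oo)%E.

(* With this relative mean oscillation of the kernel, the error terms of
   [opposite_sides_estimate] are absorbed by the main terms; the factor [3 * 2 ^+ k] comes from
   [osc_median]. *)
Definition absorb : R := (2 ^+ (k + 3) * (1 + 3 * 2 ^+ k))^-1.

Let delta : R := absorb * `|h0| * M.

Hypothesis hB : forall y, B y -> (\int[mu]_(x in B') `|h (x, y) - h0|%:E <= delta%:E)%E.
Hypothesis hB' : forall x, B' x -> (\int[mu]_(y in B) `|h (x, y) - h0|%:E <= delta%:E)%E.
Hypothesis form : forall E F, measurable E -> measurable F -> E `<=` B -> F `<=` B' ->
  `|\int[mu2]_z ((b z.1 - b z.2) ^+ k * h z * \1_E z.2 * \1_F z.1)| <= t0.

Lemma absorb_gt0 : 0 < absorb.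
Proof. by rewrite invr_gt0 mulr_gt0 ?exprn_gt0// addr_gt0// mulr_gt0 ?exprn_gt0. Qed.

Let delta0 : 0 <= delta.
Proof. by rewrite !mulr_ge0// ltW// absorb_gt0. Qed.

Let X a := fine (osc B a).
Let Y a := fine (osc B' a).

Let XE a : osc B a = (X a)%:E. Proof. by rewrite fineK// ge0_fin_numE// osc_ge0. Qed.
Let YE a : osc B' a = (Y a)%:E. Proof. by rewrite fineK// ge0_fin_numE// osc_ge0. Qed.

Let X0 a : 0 <= X a. Proof. by rewrite fine_ge0// osc_ge0. Qed.
Let Y0 a : 0 <= Y a. Proof. by rewrite fine_ge0// osc_ge0. Qed.

Let Ble a := B `&` [set x | b x <= a].
Let Bge a := B `&` [set x | a <= b x].
Let B'le a := B' `&` [set x | b x <= a].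
Let B'ge a := B' `&` [set x | a <= b x].

Let pair_bound a E F : measurable E -> measurable F -> E `<=` B -> F `<=` B' ->
  (forall x y, F x -> E y -> b x <= a <= b y) \/ (forall x y, F x -> E y -> b y <= a <= b x) ->
  (`|h0|%:E * (mu F * osc E a) <= (t0 + 2 ^+ k * delta * (X a + Y a))%:E)%E /\
  (`|h0|%:E * (mu E * osc F a) <= (t0 + 2 ^+ k * delta * (X a + Y a))%:E)%E.
Proof.
move=> mE mF EB FB' opp.
have fE : (osc E a < +oo)%E by apply: le_lt_trans (Bfin a); exact: osc_sub.
have fF : (osc F a < +oo)%E by apply: le_lt_trans (B'fin a); exact: osc_sub.
have bnd : (t0%:E + (2 ^+ k * delta)%:E * (osc E a + osc F a) <=
            (t0 + 2 ^+ k * delta * (X a + Y a))%:E)%E.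
  have kd0 : (0 <= (2 ^+ k * delta)%:E)%E.
    by rewrite lee_fin (mulr_ge0 _ delta0)// exprn_ge0.
  rewrite EFinD leeD2l// (EFinM _ (X a + Y a)) lee_wpmul2l//.
  by rewrite EFinD -XE -YE leeD// osc_sub.
have leM A : mu A = M%:E -> (mu A <= M%:E)%E by move=> ->.
have [H1 H2] := opposite_sides_estimate mb mh mB mB' mE mF EB FB' (leM _ BM) (leM _ B'M)
  hB hB' fE fF delta0 (form mE mF EB FB') opp.
by split; [exact: le_trans H1 bnd|exact: le_trans H2 bnd].
Qed.

Let lin a : R := t0 + 2 ^+ k * delta * (X a + Y a).

Let med_bound (c d : \bar R) (a : R) : (0 <= d)%E -> ((M / 2)%:E <= c)%E ->
  (`|h0|%:E * (c * d) <= (lin a)%:E)%E -> (`|h0|%:E * ((M / 2)%:E * d) <= (lin a)%:E)%E.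
Proof.
move=> d0 Mc; apply: le_trans; rewrite lee_wpmul2l ?lee_fin//.
by rewrite lee_wpmul2r.
Qed.

Let sum_bound (x y z : \bar R) (s t : R) : (0 <= x)%E -> (0 <= y)%E -> (z <= x + y)%E ->
  (`|h0|%:E * ((M / 2)%:E * x) <= s%:E)%E ->  (`|h0|%:E * ((M / 2)%:E * y) <= t%:E)%E ->
  (`|h0|%:E * ((M / 2)%:E * z) <= (s + t)%:E)%E.
Proof.
move=> x0 y0 xyz hx hy.
apply: (@le_trans _ _ (`|h0|%:E * ((M / 2)%:E * (x + y)))%E).
  by rewrite !lee_wpmul2l ?lee_fin ?divr_ge0// ltW.
have M2 : (0 <= (M / 2)%:E)%E by rewrite lee_fin divr_ge0// ltW.
by rewrite ge0_muleDr// ge0_muleDr ?mule_ge0// EFinD leeD.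
Qed.

Lemma two_balls_estimate :
  exists a, (`|h0|%:E * (M%:E * osc B a) <= (16 * t0)%:E)%E.
Proof.
(* The roles cross: the median [a] of [B'] serves to estimate [B], and the median [a'] of [B] to
   estimate [B']. *)
have [a [le_a ge_a]] := exists_median mB' mb B'M M0.
have [a' [le_a' ge_a']] := exists_median mB mb BM M0.
exists a.
have mle := measurable_le_set. have mge := measurable_ge_set.
have H1 : (`|h0|%:E * ((M / 2)%:E * osc B a) <= (lin a + lin a)%:E)%E.
  apply: (sum_bound _ _ (osc_split a mB)); rewrite ?osc_ge0//.
  - apply: (med_bound _ le_a); first exact: osc_ge0.
    apply: (pair_bound (a := a) (mge _ _ mB) (mle _ _ mB') _ _ _).1; [by move=> x []|by move=> x []|].
    by left => x y [_ /= ->] [_ /= ->].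
  - apply: (med_bound _ ge_a); first exact: osc_ge0.
    apply: (pair_bound (a := a) (mle _ _ mB) (mge _ _ mB') _ _ _).1; [by move=> x []|by move=> x []|].
    by right => x y [_ /= ->] [_ /= ->].
have H2 : (`|h0|%:E * ((M / 2)%:E * osc B' a') <= (lin a' + lin a')%:E)%E.
  apply: (sum_bound _ _ (osc_split a' mB')); rewrite ?osc_ge0//.
  - apply: (med_bound _ le_a'); first exact: osc_ge0.
    apply: (pair_bound (a := a') (mle _ _ mB) (mge _ _ mB') _ _ _).2; [by move=> x []|by move=> x []|].
    by right => x y [_ /= ->] [_ /= ->].
  - apply: (med_bound _ ge_a'); first exact: osc_ge0.
    apply: (pair_bound (a := a') (mge _ _ mB) (mle _ _ mB') _ _ _).2; [by move=> x []|by move=> x []|].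
    by left => x y [_ /= ->] [_ /= ->].
have := osc_median a' mB' M0 B'M le_a ge_a.
have := osc_median a mB M0 BM le_a' ge_a'.
move: H1 H2; rewrite !XE !YE -!EFinM !lee_fin /lin.
set x := X a; set y' := X a'; set y := Y a; set x' := Y a'.
have x0 : 0 <= x by exact: X0. have x'0 : 0 <= x' by exact: Y0.
move=> H1 H2 H3 H4.
pose N := `|h0| * M; have N0 : 0 <= N by rewrite mulr_ge0// ltW.
have k0 : 0 < 2 ^+ k :> R by rewrite exprn_gt0.
(* By [H3] and [H4], [y' <= 3 2^k x] and [y <= 3 2^k x'], so the total error
   [2^k delta (x + y + x' + y')] is at most [N / 8 (x + x')]. Adding [H1] and [H2] then leaves
   [N / 4 (x + x') <= 4 t0], which is the origin of 16. *)
have dE : 2 ^+ k * delta * (1 + 3 * 2 ^+ k) = N / 8.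
  rewrite /delta /absorb /N exprD -!mulrA.
  field; rewrite ?gt_eqF ?exprn_gt0//= ?gt_eqF ?ltr_wpDr//; nra.
have kd0 : 0 <= 2 ^+ k * delta by rewrite (mulr_ge0 _ delta0)// ltW.
have : 2 ^+ k * delta * (x + y + x' + y') <= N / 8 * (x + x').
  rewrite -dE -[leRHS]mulrA ler_wpM2l//; lra.
have : 0 <= N * x' by rewrite mulr_ge0.
rewrite /N; lra.
Qed.

End two_balls.

(** * Almost constant pieces of non-degenerate kernels *)

Section density_point.
Context {disp : measure_display} {T : measurableType disp} {R : realType}.
Variable nu : {measure set T -> \bar R}.
Hypothesis nu_lty : (nu setT < +oo)%E.
Variable q : nat -> T -> nat.
Hypothesis mq : forall n j, measurable (q n @^-1` [set j]).

Let mqS n S : measurable (q n @^-1` S).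
Proof.
rewrite (_ : q n @^-1` S = \bigcup_(j in S) q n @^-1` [set j]).
  exact: bigcup_measurable.
by apply/seteqP; split => [x Sx|x [j Sj /= qj]]; [exists (q n x)|rewrite /= qj].
Qed.

Let sdist n A S := (nu (A `\` q n @^-1` S) + nu (q n @^-1` S `\` A))%E.

(* [q n] stands for the index of the dyadic cube of side [2 ^- n] containing a point. *)
Definition approximable (A : set T) : Prop := measurable A /\
  forall e, 0 < e -> exists n0, forall n, (n0 <= n)%N -> exists S, (sdist n A S <= e%:E)%E.

Let le_nu A B : measurable A -> measurable B -> A `<=` B -> (nu A <= nu B)%E.
Proof. by move=> mA mB AB; apply: le_measure; rewrite ?inE. Qed.

Lemma approximable0 : approximable set0.
Proof.
split=> // e e0; exists 0%N => n _; exists set0.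
by rewrite /sdist preimage_set0 setD0 measure0 adde0 lee_fin ltW.
Qed.

Lemma approximableC A : approximable A -> approximable (setT `\` A).
Proof.
move=> [mA hA]; split; first exact: measurableD.
move=> e /hA[n0 hn0]; exists n0 => n /hn0[S hS]; exists (~` S).
rewrite /sdist preimage_setC setTD addeC.
by rewrite [_ `\` ~` A]setDE setCK setIC -setDE [~` A `\` _]setDE setCK setIC -setDE.
Qed.

(** Approximation is required at all large levels, so that two sets can be approximated at a common
    one. *)
Lemma approximableU A B : approximable A -> approximable B -> approximable (A `|` B).
Proof.
move=> [mA hA] [mB hB]; split; first exact: measurableU.
move=> e e0; have e2 : 0 < e / 2 by rewrite divr_gt0.
have [n1 h1] := hA _ e2; have [n2 h2] := hB _ e2.
exists (maxn n1 n2) => n; rewrite geq_max => /andP[/h1[S hS] /h2[S' hS']].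
exists (S `|` S'); rewrite (splitr e) EFinD.
apply: le_trans (leeD hS hS'); rewrite /sdist preimage_setU addeACA.
apply: leeD; (apply: le_trans; last by apply: measureU2; exact: measurableD).
  apply: le_nu; [by apply: measurableD; exact: measurableU|
    by apply: measurableU; exact: measurableD|].
  by move=> x [[Ax|Bx] /not_orP[nS nS']]; [left|right].
apply: le_nu; [by apply: measurableD; exact: measurableU|
    by apply: measurableU; exact: measurableD|].
by move=> x [[Sx|Sx] /not_orP[nA nB]]; [left|right].
Qed.

Let nu_cvg0 (F : (set T)^nat) : (forall n, measurable (F n)) ->
  {homo F : m n / (m <= n)%N >-> (n <= m)%O} -> \bigcap_n F n = set0 ->
  forall e, 0 < e -> exists n0, forall n, (n0 <= n)%N -> (nu (F n) <= e%:E)%E.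
Proof.
move=> mF ndF F0 e e0.
have : nu (F n) @[n --> \oo] --> nu (\bigcap_n F n).
  apply: nonincreasing_cvg_mu => //.
    by apply: le_lt_trans nu_lty; exact: le_nu.
  exact: bigcapT_measurable.
rewrite F0 measure0 => /fine_cvgP[_].
move/cvgrPdist_le => /(_ _ e0) [n0 _ h]; exists n0 => n /h /=.
rewrite sub0r normrN => hn.
have fF : nu (F n) \is a fin_num.
  by rewrite ge0_fin_numE//; apply: le_lt_trans nu_lty; exact: le_nu.
by rewrite -(fineK fF) lee_fin (le_trans _ hn)// ler_norm.
Qed.

(** As [nu] is finite, some finite union [G N] exhausts the countable one up to [e / 2]; it remains
    to approximate [G N]. *)
Lemma approximable_bigcup (F : (set T)^nat) : (forall n, approximable (F n)) ->
  approximable (\bigcup_n F n).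
Proof.
move=> hF; have mF n : measurable (F n) by case: (hF n).
have mU : measurable (\bigcup_n F n) by exact: bigcup_measurable.
split=> // e e0; have e2 : 0 < e / 2 by rewrite divr_gt0.
pose G n := \big[setU/set0]_(i < n) F i.
have aG n : approximable (G n).
  rewrite /G; elim: n => [|n ih]; first by rewrite big_ord0; exact: approximable0.
  by rewrite big_ord_recr/=; exact: approximableU.
have mG n : measurable (G n) by case: (aG n).
have [|||N hN] := @nu_cvg0 (fun n => \bigcup_i F i `\` G n) _ _ _ _ e2.
- by move=> n; exact: measurableD.
- move=> m n mn; apply/subsetPset => x [Ux nGx]; split=> // Gx; apply: nGx.
  by move: x Gx {Ux}; exact: subset_bigsetU.
- apply/seteqP; split=> // x h; have [[i _ Fix] _] := h 0%N Logic.I.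
  have [_] := h i.+1 Logic.I; apply; rewrite /G -bigcup_mkord; exists i => //=.
have [_ /(_ _ e2) [n0 hn0]] := aG N; exists n0 => n /hn0 [S hS]; exists S.
rewrite (splitr e) EFinD; apply: le_trans (leeD (hN N (leqnn N)) hS).
have GU : G N `<=` \bigcup_i F i by move=> x; rewrite /G -bigcup_mkord => -[i _ ?]; exists i.
rewrite /sdist addeA; apply: leeD; last first.
  apply: le_nu; [exact: measurableD|exact: measurableD|].
  by move=> x [Sx nU]; split => // /GU.
apply: le_trans; last by apply: measureU2; exact: measurableD.
apply: le_nu; [exact: measurableD|by apply: measurableU; exact: measurableD|].
move=> x [Ux nS]; have [Gx|Gx] := pselect (G N x); [by right|by left].
Qed.

Lemma approximable_sigma_algebra : sigma_algebra setT approximable.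
Proof.
split; [exact: approximable0|exact: approximableC|exact: approximable_bigcup].
Qed.

(** Let [U] be the union of the fibers over [S], which approximates [A]. If every fiber had at least
    the proportion [e] of its mass outside [A], summation would give
    [e nu(U) <= nu(U - A) <= delta], while [nu(A) <= delta + nu(U)]. The choice of [delta] makes
    this impossible. *)
Lemma density_fiber (A : set T) (e : R) : approximable A -> (0 < nu A)%E -> 0 < e ->
  exists n0, forall n, (n0 <= n)%N -> exists j,
    (nu (q n @^-1` [set j] `\` A) < e%:E * nu (q n @^-1` [set j]))%E.
Proof.
move=> [mA hA] A0 e0.
have fin B : measurable B -> nu B \is a fin_num.
  by move=> mB; rewrite ge0_fin_numE//; apply: le_lt_trans nu_lty; exact: le_nu.
pose v := fine (nu A); have vE : nu A = v%:E by rewrite fineK// fin.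
have v0 : 0 < v by rewrite -lte_fin -vE.
pose delta := e * v / (2 * (1 + e)).
have e1 : 0 < 1 + e by rewrite addr_gt0.
have d0 : 0 < delta by rewrite divr_gt0 ?mulr_gt0.
have [n0 h] := hA _ d0; exists n0 => n /h[S hS]; apply: contrapT => /forallNP nj.
have tQ : trivIset S (fun j => q n @^-1` [set j]).
  by apply/trivIsetP => i j _ _ ij; apply/seteqP; split => // x [/= qi qj];
     move: ij; rewrite -qi -qj eqxx.
have SE : q n @^-1` S = \bigcup_(j in S) q n @^-1` [set j].
  by apply/seteqP; split => [x Sx|x [j Sj /= qj]]; [exists (q n x)|rewrite /= qj].
have : (e%:E * nu (q n @^-1` S) <= nu (q n @^-1` S `\` A))%E.
  rewrite SE setDE setI_bigcupl !measure_bigcup//; last 2 first.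
  - by move=> j _; apply: measurableI => //; exact: measurableC.
  - by apply: trivIset_setIr.
  rewrite -nneseriesZl//; apply: lee_nneseries.
    by move=> j _ _; rewrite mule_ge0// lee_fin ltW.
  by move=> j _; rewrite leNgt; apply/negP; rewrite -setDE; exact: nj.
have : (nu A <= nu (A `\` q n @^-1` S) + nu (q n @^-1` S))%E.
  rewrite {1}(measureDI nu mA (mqS n S)) leeD2l//.
  by apply: le_nu; [exact: measurableI| |exact: subIsetr].
have m1 : measurable (A `\` q n @^-1` S) by exact: measurableD.
have m2 : measurable (q n @^-1` S `\` A) by exact: measurableD.
move: hS; rewrite /sdist vE -(fineK (fin _ m1)) -(fineK (fin _ m2)) -(fineK (fin _ (mqS n S))).
have := fine_ge0 (measure_ge0 nu (A `\` q n @^-1` S)).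
have := fine_ge0 (measure_ge0 nu (q n @^-1` S `\` A)).
rewrite -!EFinD -EFinM !lee_fin.
set x := fine _; set y := fine _; set z := fine _ => x0 y0 h1 h2 h3.
have : delta * (1 + e) = e * v / 2 by rewrite /delta; field; rewrite gt_eqF.
nra.
Qed.

End density_point.

Section density_measure.
Context {disp : measure_display} {T : measurableType disp} {R : realType}.
Variables (mu : {measure set T -> \bar R}) (f : T -> R).
Hypotheses (mf : measurable_fun setT f) (f0 : forall x, 0 <= f x).

Let density (A : set T) : \bar R := (\int[mu]_(x in A) (f x)%:E)%E.

Let density0 : density set0 = 0%E.
Proof. exact: integral_set0. Qed.

Let density_ge0 A : (0 <= density A)%E.
Proof. by apply: integral_ge0 => x _; rewrite lee_fin. Qed.

Let density_sigma_additive : semi_sigma_additive density.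
Proof.
move=> F mF tF mUF; rewrite /density ge0_integral_bigcup//.
- by apply: is_cvg_ereal_nneg_natsum => n _; exact: density_ge0.
- by apply/measurable_funTS/measurable_EFinP.
- by move=> x _; rewrite lee_fin.
Qed.

Definition density_measure : {measure set T -> \bar R} :=
  HB.pack density (isMeasure.Build _ _ _ density density0 density_ge0 density_sigma_additive).

Lemma density_measureE A : density_measure A = (\int[mu]_(x in A) (f x)%:E)%E.
Proof. by []. Qed.

End density_measure.

(** * Dyadic cubes *)

Section dyadic_cubes.
Context {R : realType} {d : nat}.
Local Notation vec := 'rV[R]_d.

Definition dyadic_index (n : nat) (x : vec) : {ffun 'I_d -> int} :=
  [ffun i => Num.floor (2 ^+ n * x ord0 i)].

Lemma dyadic_index_coord n x y i : dyadic_index n x = dyadic_index n y ->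
  `|x ord0 i - y ord0 i| <= 2 ^- n.
Proof.
move=> /ffunP/(_ i); rewrite !ffunE => xy.
have := floor_le (2 ^+ n * x ord0 i); have := floorD1_gt (2 ^+ n * x ord0 i).
have := floor_le (2 ^+ n * y ord0 i); have := floorD1_gt (2 ^+ n * y ord0 i).
rewrite xy intrD; set t := _%:~R => h1 h2 h3 h4.
have n0 : 0 < 2 ^+ n :> R by rewrite exprn_gt0.
rewrite -(ler_pM2l n0) mulfV ?gt_eqF//.
by rewrite -[in leLHS](gtr0_norm n0) -normrM mulrBr ler_norml; lra.
Qed.

Definition dyadic_center (n : nat) (t : {ffun 'I_d -> int}) : vec :=
  \row_i (2 ^- n * ((t i)%:~R + 2^-1)).

Lemma dyadic_index_ball n t x : eball (dyadic_center n t) (2 ^- n / 2) x ->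
  dyadic_index n x = t.
Proof.
rewrite /eball/= => xz; apply/ffunP => i; rewrite ffunE; apply/floor_def.
have := le_lt_trans (enorm_coord _ i) xz; rewrite !mxE.
have n0 : 0 < 2 ^+ n :> R by rewrite exprn_gt0.
rewrite ltr_norml -(ltr_pM2l n0) -[X in _ && X](ltr_pM2l n0) mulrN mulrBr !mulrA.
by rewrite mulfV ?gt_eqF// !mul1r intrD => h; lra.
Qed.

Let q n (x : vec) : nat := pickle (dyadic_index n x).

Lemma measurable_dyadic_fiber n j : measurable (q n @^-1` [set j]).
Proof.
have [[t tj]|nt] := pselect (exists t : {ffun 'I_d -> int}, pickle t = j); last first.
  rewrite (_ : _ @^-1` _ = set0)//; apply/seteqP; split => // x /= xj.
  by apply: nt; exists (dyadic_index n x).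
have n0 : 0 < 2 ^+ n :> R by rewrite exprn_gt0.
rewrite (_ : _ @^-1` _ = [set x : vec | forall i,
  `[2 ^- n * (t i)%:~R, 2 ^- n * ((t i)%:~R + 1)[%classic (x ord0 i)]).
  exact: (@measurable_box _ _ (fun i => `[2 ^- n * (t i)%:~R, 2 ^- n * ((t i)%:~R + 1)[%classic)).
have iE (x : R) (m : int) : (x \in `[2 ^- n * m%:~R, 2 ^- n * (m%:~R + 1)[) =
    (Num.floor (2 ^+ n * x) == m).
  rewrite in_itv/= mulrC ler_pdivrMr// (mulrC _ (_ + 1)) ltr_pdivlMr// (mulrC x).
  apply/idP/eqP; first by move=> h; apply: floor_def; rewrite intrD.
  by move=> <-; rewrite floor_le/= -(intrD _ _ 1) floorD1_gt.
apply/seteqP; split => x /=.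
  rewrite -tj => /(pcan_inj pickleK)/ffunP xt i.
  by have := xt i; rewrite ffunE /= => /eqP; rewrite -iE.
move=> h; rewrite -tj; congr pickle; apply/ffunP => i; rewrite ffunE.
by apply/eqP; rewrite -iE; exact: h.
Qed.

(** A half-space [t <= x_i] is approximated by the cubes of side [2^-n] that meet it: the excess
    lies in the slab [t - 2^-n <= x_i < t], whose measure tends to zero. Half-spaces generate the
    sigma-algebra. *)
Lemma approximable_dyadic (nu : {measure set vec -> \bar R}) (A : set vec) :
  (nu setT < +oo)%E -> measurable A -> approximable nu q A.
Proof.
move=> nuoo; have sA := approximable_sigma_algebra nuoo measurable_dyadic_fiber.
have [s0 sC sU] := sA.
have ray i t : approximable nu q [set x : vec | t <= x ord0 i].
  have mray s : measurable [set x : vec | s <= x ord0 i].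
    rewrite (_ : mkset _ = (fun x : vec => x ord0 i) @^-1` `[s, +oo[%classic).
      rewrite -[X in measurable X]setTI; apply: measurable_coord => //.
    by apply/seteqP; split => x /=; rewrite in_itv/= andbT.
  split=> // e e0.
  pose F n := [set x : vec | t - 2 ^- n <= x ord0 i] `\` [set x : vec | t <= x ord0 i].
  have mF n : measurable (F n) by exact: measurableD.
  have : nu (F n) @[n --> \oo] --> nu (\bigcap_n F n).
    apply: nonincreasing_cvg_mu => //.
    - by apply: le_lt_trans nuoo; apply: le_measure; rewrite ?inE.
    - exact: bigcapT_measurable.
    move=> m n mn; apply/subsetPset => x [/= h1 h2]; split => //=.
    apply: le_trans h1; rewrite lerD2l lerN2 lef_pV2 ?posrE ?exprn_gt0//.
    by rewrite ler_weXn2l ?ler1n.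
  rewrite (_ : \bigcap_n F n = set0) ?measure0; last first.
    apply/seteqP; split => // x h; have [_ /= nt] := h 0%N Logic.I.
    apply: nt; apply/ler_addgt0Pr => r r0; rewrite -lerBlDr.
    pose n := Num.bound r^-1.
    have [/= + _] := h n Logic.I; apply: le_trans.
    rewrite lerD2l lerN2 -[leRHS]invrK lef_pV2 ?posrE ?exprn_gt0// ?invr_gt0//.
    apply: (@le_trans _ _ n%:R); first by rewrite ltW// archi_boundP// invr_ge0 ltW.
    by rewrite -natrX ler_nat ltnW// ltn_expl.
  move=> /fine_cvgP[_] /cvgrPdist_le /(_ _ e0) [n0 _ h]; exists n0 => n nn.
  exists (q n @` [set x : vec | t <= x ord0 i]).
  rewrite (_ : _ `\` _ = set0); last first.
    by apply/seteqP; split => // x [tx] /= []; exists x.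
  rewrite measure0 add0e; apply: (@le_trans _ _ (nu (F n))).
    apply: le_measure; rewrite ?inE//.
      apply: measurableD => //.
      rewrite (_ : _ @^-1` _ = \bigcup_(j in q n @` [set x : vec | t <= x ord0 i])
          q n @^-1` [set j]); last first.
        apply/seteqP; split => [x [y ty yx]|x [j [y ty yj] /= qj]].
          by exists (q n x) => //; exists y.
        by rewrite /= qj; exists y.
      by apply: bigcup_measurable => j _; exact: measurable_dyadic_fiber.
    move=> x [[y /= ty /(pcan_inj pickleK) yx] nx]; split => //=.
    by have := dyadic_index_coord i yx; rewrite ler_norml; lra.
  have := h n nn; rewrite /= sub0r normrN => hn.
  have fF : nu (F n) \is a fin_num.
    by rewrite ge0_fin_numE//; apply: le_lt_trans nuoo; apply: le_measure; rewrite ?inE.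
  by rewrite -(fineK fF) lee_fin (le_trans _ hn)// ler_norm.
have coord i (C : set (measurableTypeR R)) : measurable C ->
    approximable nu q ((fun x : vec => x ord0 i) @^-1` C).
  rewrite RGenCInfty.measurableE; apply: (@smallest_sub _ (sigma_algebra setT) (@RGenCInfty.G R)
    [set C' | approximable nu q ((fun x : vec => x ord0 i) @^-1` C')]).
    split=> [|C' hC'|C' hC'].
    - by rewrite /= preimage_set0.
    - by rewrite /mkset setTD preimage_setC -[~` _]setTD; exact: sC.
    - by rewrite /= preimage_bigcup; exact: sU.
  move=> _ [t ->] /=; rewrite (_ : _ @^-1` _ = [set x : vec | t <= x ord0 i])//.
  by apply/seteqP; split => x /=; rewrite in_itv/= andbT.
move: A; apply: (@smallest_sub _ (sigma_algebra setT) (\big[setU/set0]_(i < d)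
  preimage_set_system setT (fun x : 'rV[R]_d => x ord0 i) measurable)) => //.
move=> B; rewrite -bigcup_seq => -[i _ [C mC <-]]; rewrite setTI; exact: coord.
Qed.

End dyadic_cubes.

(** * Balls on which a profile is nearly constant *)

Section lebesgue_point.
Context {R : realType} {d : nat}.
Local Notation vec := 'rV[R]_d.
Local Notation leb := (lebesgue_rV (R := R) d).
Variable H : vec -> R.
Hypothesis mH : measurable_fun setT H.

Let annulus (e f : R) : set vec := [set u | e <= enorm u < f].

Let measurable_annulus e f : measurable (annulus e f).
Proof.
rewrite (_ : annulus e f = enorm @^-1` `[e, f[%classic).
  exact: measurable_fun_preimage measurable_enorm _.
by apply/seteqP; split => x /=; rewrite in_itv.
Qed.

Let level (c t : R) : set vec := [set u | `|H u - c| <= t].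

Let measurable_level c t : measurable (level c t).
Proof.
rewrite (_ : level c t = (fun u => `|H u - c|) @^-1` `]-oo, t]%classic).
  apply: measurable_fun_preimage => //.
  apply: measurableT_comp => //; exact: measurable_funB.
by apply/seteqP; split => x /=; rewrite in_itv.
Qed.

(** For [x > 0], any rational between [x / (1 + t)] and [x] will do. Rational levels keep the
    covering in [exists_level] countable. *)
Let rational_approx (x t : R) : x != 0 -> 0 < t -> t <= 1 ->
  exists2 c : rat, ratr c != 0 :> R & `|x - ratr c| <= t * `|ratr c|.
Proof.
move=> x0 t0 t1.
wlog xp : x x0 / 0 < x.
  move=> W; have [xn|xp|] := ltgtP x 0; [|exact: W|by move/eqP; rewrite (negbTE x0)].
  have [||c c0 hc] := W (- x); rewrite ?oppr_eq0 ?oppr_gt0//.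
  exists (- c); first by rewrite rmorphN oppr_eq0.
  rewrite rmorphN/= normrN opprK (_ : x + _ = - (- x - ratr c)) ?normrN//; ring.
have /rat_in_itvoo [c] : x / (1 + t) < x.
  by rewrite ltr_pdivrMr ?addr_gt0// ltr_pMr// ltrDl.
rewrite in_itv/= ltr_pdivrMr ?addr_gt0// => /andP[h1 h2].
have cp : 0 < ratr c :> R by nra.
exists c; first by rewrite gt_eqF.
by rewrite (gtr0_norm cp) ger0_norm; lra.
Qed.

Hypothesis H_int : forall e, 0 < e ->
  (\int[leb]_(u in [set u | (e <= enorm u < 1)%R]) `|H u|%:E < +oo)%E.
Hypothesis H_neq0 :
  ~ leb.-negligible [set u | 0 < enorm u < 1 /\ H u <> 0].

(** The sets with rational [c] and [e = 1/(m+1)] are countably many and cover the points of the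
    punctured unit ball where [H] is nonzero; if all were null, this would contradict [H_neq0]. *)
Let exists_level (t : R) : 0 < t -> t <= 1 -> exists (e c : R), [/\ 0 < e, c != 0 &
  (0 < leb (annulus e (1 - e) `&` level c (t * `|c|)))%E].
Proof.
move=> t0 t1; apply: contrapT => nex; apply: H_neq0.
pose F (k : nat) : set vec := if unpickle k is Some (m, c) then
   annulus (m.+1%:R^-1) (1 - m.+1%:R^-1) `&` level (ratr c) (t * `|ratr c|) `&`
   [set _ | ratr c <> 0 :> R] else set0.
apply: (@negligibleS _ _ _ _ (\bigcup_k F k)); last first.
  apply: negligible_bigcup => k; rewrite /F; case: unpickle => [[m c]|]; last first.
    exact: negligible_set0.
  have [c0|c0] := eqVneq (ratr c : R) 0.
    by rewrite (_ : _ `&` _ = set0); [exact: negligible_set0|apply/seteqP; split => // x [_ /=]].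
  apply: (@negligibleS _ _ _ _ (annulus (m.+1%:R^-1) (1 - m.+1%:R^-1) `&` level (ratr c) (t * `|ratr c|))).
    by move=> x [].
  exists (annulus (m.+1%:R^-1) (1 - m.+1%:R^-1) `&` level (ratr c) (t * `|ratr c|)).
  split=> //; first exact: measurableI.
  apply/eqP; rewrite eq_le measure_ge0 andbT leNgt; apply/negP => pos.
  by apply: nex; exists m.+1%:R^-1, (ratr c); split => //; rewrite invr_gt0.
move=> u [/andP[u0 u1] /eqP Hu0].
have [c c0 hc] := rational_approx Hu0 t0 t1.
pose e := Num.min (enorm u) (1 - enorm u).
have e0 : 0 < e by rewrite lt_min u0 subr_gt0.
pose m := Num.bound e^-1.
exists (pickle (m, c)) => //; rewrite /F pickleK; split; last exact/eqP.
split => //.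
have me : m.+1%:R^-1 < e.
  rewrite invf_plt ?posrE// (@lt_le_trans _ _ m%:R)//; last by rewrite ler_nat.
  by rewrite archi_boundP// invr_ge0 ltW.
move: me; rewrite lt_min => /andP[m1 m2]; rewrite /annulus/=.
by rewrite (ltW m1)/= ltrBrDl -ltrBrDr.
Qed.

(* For the measure [(1 + |H|) dx], some small dyadic cube is filled up to a small proportion by
   a set on which [H] is close to [c]; the weight [1 + |H|] controls the rest of the cube. *)
Lemma exists_lebesgue_ball (eta L : R) : 0 < eta -> 0 < L ->
  exists (z : vec) (s c : R), [/\ 0 < s, c != 0, L * s <= enorm z &
    (\int[leb]_(u in eball z (2 * s)) `|H u - c|%:E <= (eta * `|c| * s ^+ d)%:E)%E].
Proof.
move=> eta0 L0.
(* The cube found below has side [4 s] and lies in a ball of radius [4 (d + 1) s], hence has volume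
   at most [V s^d]; [t] is taken with [t V <= eta]. *)
pose V : R := unit_vol (R := R) (d := d) * (4 * (d%:R + 1)) ^+ d.
have d1 : 0 < d%:R + 1 :> R by rewrite ltr_wpDl.
have V0 : 0 < V by rewrite mulr_gt0 ?unit_vol_gt0// exprn_gt0// mulr_gt0.
pose t := Num.min 1 (eta / V).
have t0 : 0 < t by rewrite lt_min ltr01 divr_gt0.
have t1 : t <= 1 by rewrite ge_min lexx.
have tV : t * V <= eta by rewrite -ler_pdivlMr// ge_min lexx orbT.
have t2 : 0 < t / 2 by rewrite divr_gt0.
have [|e [c [e0 c0 Apos]]] := exists_level t2; first by lra.
set A := annulus e (1 - e) `&` level c (t / 2 * `|c|) in Apos.
have mA : measurable A by exact: measurableI.
have cp : 0 < `|c| by rewrite normr_gt0.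
(* [D] is wider than the annulus of [A] on both sides, so that a small cube meeting [A] stays inside
   [D], where the weight is [1 + |H|]. *)
pose D := annulus (e / 2) 1.
have mD : measurable D by exact: measurable_annulus.
have AD : A `<=` D.
  move=> x [/andP[h1 h2] _]; apply/andP; split; last by lra.
  by rewrite (le_trans _ h1)//; lra.
pose f (u : vec) : R := (1 + `|H u|) * \1_D u.
have mabsH : measurable_fun setT (fun u => `|H u|) by exact: measurableT_comp.
have mf : measurable_fun setT f.
  apply: measurable_funM; last exact: measurable_indic.
  exact: measurable_funD.
have f0 u : 0 <= f u by rewrite mulr_ge0// addr_ge0.
pose nu := density_measure leb mf f0.
have f_D u : D u -> f u = 1 + `|H u| by move=> Du; rewrite /f indicE mem_set// mulr1.
have nu_lty : (nu setT < +oo)%E.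
  rewrite /nu density_measureE.
  rewrite (_ : (\int[leb]_(x in _) _)%E = (\int[leb]_(x in D) (1%:E + `|H x|%:E))%E); last first.
    rewrite [RHS]integral_mkcond; apply: eq_integral => x _.
    by rewrite patchE /f indicE; case: ifPn => _; rewrite ?mulr0// mulr1 EFinD.
  rewrite ge0_integralD//; last exact/measurable_funTS/measurable_EFinP.
  rewrite integral_cst// mul1e lte_add_pinfty//; last first.
    by apply: H_int; rewrite divr_gt0.
  apply: (@le_lt_trans _ _ (leb (eball 0 1))); last exact: lebesgue_eball_lty.
  apply: le_measure; rewrite ?inE//; first exact: measurable_eball.
  by move=> x /andP[_]; rewrite /eball/= subr0.
have nuA : (0 < nu A)%E.
  apply: lt_le_trans Apos _; rewrite /nu density_measureE.
  rewrite -[leLHS]mul1e -integral_cst//; apply: ge0_le_integral => //.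
  - exact/measurable_funTS/measurable_EFinP.
  - by move=> x /AD Dx; rewrite lee_fin f_D// lerDl.
(* Off [A] the integral over the cube is at most [(1 + |c|)] times the weighted mass, itself at most
   [2 ep (1 + 2 |c|) V s^d]; this [ep] brings the product down to [t |c| V s^d / 2], the same bound
   as inside [A]. The cap [1/2] allows [nu (Q - A) < ep nu Q] to be solved as
   [nu (Q - A) <= 2 ep nu (Q & A)]. *)
pose ep := Num.min 2^-1 (t * `|c| / (4 * (1 + `|c|) * (1 + 2 * `|c|))).
have den0 : 0 < 4 * (1 + `|c|) * (1 + 2 * `|c|).
  by rewrite !mulr_gt0// addr_gt0// mulr_gt0.
have ep0 : 0 < ep by rewrite lt_min invr_gt0 ltr0n divr_gt0// mulr_gt0.
have ep2 : ep <= 2^-1 by rewrite ge_min lexx.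
have epc : ep * (4 * (1 + `|c|) * (1 + 2 * `|c|)) <= t * `|c|.
  by rewrite -ler_pdivlMr// ge_min lexx orbT.
have [n0 hn0] := density_fiber nu_lty measurable_dyadic_fiber (approximable_dyadic nu_lty mA) nuA ep0.
(* The first bound puts every cube meeting [A] inside [D]; the second gives [L s <= e / 2], hence
   [L s <= enorm z]. *)
pose g := Num.min (e / (2 * (d%:R + 1))) (2 * e / L).
have g0 : 0 < g by rewrite lt_min !divr_gt0// mulr_gt0.
pose n := maxn n0 (Num.bound g^-1).
have ng : 2 ^- n <= g.
  rewrite invf_ple ?posrE// ?exprn_gt0// (@le_trans _ _ n%:R)//; last first.
    by rewrite -natrX ler_nat ltnW// ltn_expl.
  rewrite (@le_trans _ _ (Num.bound g^-1)%:R)//; last by rewrite ler_nat leq_maxr.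
  by rewrite ltW// archi_boundP// invr_ge0 ltW.
have [j hj] := hn0 n (leq_maxl _ _).
set Q := _ @^-1` _ in hj.
have mQ : measurable Q by exact: measurable_dyadic_fiber.
have n2 : 0 < 2 ^- n :> R by rewrite invr_gt0 exprn_gt0.
have fin B : measurable B -> nu B \is a fin_num.
  by move=> mB; rewrite ge0_fin_numE//; apply: le_lt_trans nu_lty; apply: le_measure; rewrite ?inE.
have [x0 [Qx0 Ax0]] : exists x, Q x /\ A x.
  apply: contrapT => nx; move: hj; rewrite (_ : Q `\` A = Q); last first.
    by apply/seteqP; split => [x []|x Qx]//; split => // Ax; apply: nx; exists x.
  rewrite -(fineK (fin _ mQ)) -EFinM lte_fin ltNge => /negP; apply.
  by rewrite ler_piMl ?fine_ge0//; lra.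
pose z := dyadic_center (R := R) n (dyadic_index n x0).
have zQ u : eball z (2 ^- n / 2) u -> Q u.
  by move=> /dyadic_index_ball; rewrite /Q/= => ->.
have Qdist u v : Q u -> Q v -> enorm (u - v) <= d%:R * 2 ^- n.
  move=> Qu Qv; apply: enorm_le_coord => i; rewrite !mxE; apply: dyadic_index_coord.
  by apply: (pcan_inj pickleK); rewrite Qu.
have Qz : Q z by apply/zQ/eball_center; rewrite divr_gt0.
have QD : Q `<=` D.
  move=> u Qu; case: Ax0 => /andP[h1 h2] _.
  have ux : enorm (u - x0) <= e / 2.
    apply: (le_trans (Qdist _ _ Qu Qx0)).
    apply: (@le_trans _ _ ((d%:R + 1) * g)).
      by rewrite ler_pM// ?ltW// ltrDl.
    rewrite mulrC -ler_pdivlMr// ge_min; apply/orP; left.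
    by rewrite -mulrA -invfM.
  have h3 := ler_enormD (x0 - u) u; have h4 := ler_enormD (u - x0) x0.
  move: h3 h4; rewrite !subrK (enormB x0) => h3 h4.
  by apply/andP; split; lra.
(* The ball of radius [2 s] about [z] is the one inscribed in the cube. The factor 2 will
   accommodate differences of points of two balls of radius [s]. *)
pose s : R := 2 ^- n / 4.
have s0 : 0 < s by rewrite divr_gt0.
exists z, s, c; split => //.
  have /andP[hz _] := QD z Qz; apply: le_trans hz.
  rewrite mulrC -ler_pdivlMr// /s.
  have : 2 ^- n <= 2 * e / L by rewrite (le_trans ng)// ge_min lexx orbT.
  have -> : 2 * e / L = 4 * (e / 2 / L) by field; rewrite gt_eqF.
  lra.
have sz : eball z (2 * s) `<=` Q by move=> u; rewrite /s => h; apply: zQ; rewrite (_ : _ / _ = 2 * (2 ^- n / 4))//; field.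
have mHc : measurable_fun setT (fun u => `|H u - c|%:E).
  by apply/measurable_EFinP; apply: measurableT_comp => //; exact: measurable_funB.
apply: (@le_trans _ _ (\int[leb]_(u in Q) `|H u - c|%:E)%E).
  by apply: ge0_subset_integral => //; [exact: measurable_eball|exact: measurable_funTS].
have mQA : measurable (Q `&` A) by exact: measurableI.
have mQdA : measurable (Q `\` A) by exact: measurableD.
have lQ : (leb Q <= (V * s ^+ d)%:E)%E.
  have r0 : 0 < (d%:R + 1) * 2 ^- n :> R by rewrite mulr_gt0.
  apply: (@le_trans _ _ (leb (eball z ((d%:R + 1) * 2 ^- n)))).
    apply: le_measure; rewrite ?inE//; first exact: measurable_eball.
    move=> u Qu; rewrite /eball/=; apply: (le_lt_trans (Qdist _ _ Qu Qz)).
    by rewrite ltr_pM2r// ltrDl.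
  rewrite lebesgue_eball// lee_fin /V -mulrA -exprMn.
  by rewrite le_eqVlt /s; apply/orP; left; apply/eqP; congr (_ * _ ^+ _); field.
have nuQA : (nu (Q `&` A) <= ((1 + 2 * `|c|) * (V * s ^+ d))%:E)%E.
  rewrite /nu density_measureE EFinM.
  apply: le_trans (lee_wpmul2l _ lQ); last by rewrite lee_fin addr_ge0// mulr_ge0.
  apply: (@le_trans _ _ (\int[leb]_(x in Q `&` A) (1 + 2 * `|c|)%:E)%E).
    apply: ge0_le_integral => //.
    - by move=> x _; rewrite lee_fin.
    - exact/measurable_funTS/measurable_EFinP.
    - move=> x [Qx [_]]; rewrite /level/= => Hx; rewrite lee_fin f_D; last exact: QD.
      have : `|H x| <= `|H x - c| + `|c| by rewrite -{1}(subrK c (H x)) ler_normD.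
      nra.
  rewrite integral_cst// lee_wpmul2l// ?lee_fin ?addr_ge0 ?mulr_ge0//.
  by apply: le_measure; rewrite ?inE//; exact: subIsetl.
have nuQdA : (nu (Q `\` A) <= (2 * ep * (1 + 2 * `|c|) * (V * s ^+ d))%:E)%E.
  have nuQE : (nu Q = nu (Q `\` A) + nu (Q `&` A))%E := measureDI nu mQ mA.
  move: hj; rewrite nuQE; move: nuQA.
  rewrite -(fineK (fin _ mQdA)) -(fineK (fin _ mQA)) -EFinD -EFinM !lee_fin lte_fin.
  have := fine_ge0 (measure_ge0 nu (Q `\` A)).
  have := fine_ge0 (measure_ge0 nu (Q `&` A)).
  set x := fine _; set y := fine _; set w := _ * (V * _) => x0' y0' h1 h2.
  have -> : 2 * ep * (1 + 2 * `|c|) * (V * s ^+ d) = 2 * ep * w by rewrite /w; ring.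
  nra.
rewrite (_ : \int[leb]_(u in Q) _ = \int[leb]_(u in Q `\` A) `|H u - c|%:E +
   \int[leb]_(u in Q `&` A) `|H u - c|%:E)%E; last first.
  rewrite -ge0_integral_setU//.
  - by rewrite setUC setUIDK.
  - exact: measurable_funTS.
  - by apply/disj_setPS => x [[_ +] [_]].
have I1 : (\int[leb]_(u in Q `&` A) `|H u - c|%:E <= (t / 2 * `|c| * (V * s ^+ d))%:E)%E.
  rewrite EFinM; apply: le_trans (lee_wpmul2l _ lQ); last first.
    by rewrite lee_fin mulr_ge0// ltW.
  apply: (@le_trans _ _ (\int[leb]_(x in Q `&` A) (t / 2 * `|c|)%:E)%E).
    apply: ge0_le_integral => //.
    - exact: measurable_funTS.
    - by move=> x [_ [_]]; rewrite lee_fin.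
  have tc0 : 0 <= t / 2 * `|c| by rewrite mulr_ge0// ltW.
  rewrite integral_cst// lee_wpmul2l// ?lee_fin//.
  by apply: le_measure; rewrite ?inE//; exact: subIsetl.
have I2 : (\int[leb]_(u in Q `\` A) `|H u - c|%:E <=
    ((1 + `|c|) * (2 * ep * (1 + 2 * `|c|) * (V * s ^+ d)))%:E)%E.
  rewrite EFinM; apply: le_trans (lee_wpmul2l _ nuQdA); last by rewrite lee_fin addr_ge0.
  rewrite /nu density_measureE -ge0_integralZl//.
  - apply: ge0_le_integral => //.
    + exact: measurable_funTS.
    + by apply: measurable_funTS; apply: measurable_funeM; exact/measurable_EFinP.
    + move=> x [Qx _]; rewrite -EFinM lee_fin f_D; last exact: QD.
      rewrite (le_trans (ler_normB _ _))//.
      have := normr_ge0 (H x); have := normr_ge0 c; nra.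
  - exact/measurable_funTS/measurable_EFinP.
  - by move=> x _; rewrite lee_fin.
apply: (le_trans (leeD I2 I1)); rewrite -EFinD lee_fin.
have Vs0 : 0 < V * s ^+ d by rewrite mulr_gt0// exprn_gt0.
apply: (@le_trans _ _ (t * `|c| * (V * s ^+ d))).
  have := ler_wpM2r (ltW Vs0) epc; set w := V * s ^+ d; lra.
have -> : t * `|c| * (V * s ^+ d) = (t * V) * `|c| * s ^+ d by ring.
by rewrite -[leLHS]mulrA -[leRHS]mulrA ler_wpM2r// mulr_ge0// exprn_ge0// ltW.
Qed.

End lebesgue_point.

Section complex_norm.
Context {R : realType}.
Implicit Types z : R[i].

Lemma normc_nonneg z : 0 <= normc z.
Proof. by case: z => a b; exact: sqrtr_ge0. Qed.

Lemma normc_ge_absRe z : `|complex.Re z| <= normc z.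
Proof. by case: z => a b; rewrite /normc -sqrtr_sqr ler_wsqrtr// lerDl sqr_ge0. Qed.

Lemma normc_ge_absIm z : `|complex.Im z| <= normc z.
Proof. by case: z => a b; rewrite /normc -sqrtr_sqr ler_wsqrtr// lerDr sqr_ge0. Qed.

Lemma normc_le_absReDIm z : normc z <= `|complex.Re z| + `|complex.Im z|.
Proof.
case: z => a b; rewrite /normc/= -(@ler_pXn2r _ 2) ?nnegrE ?sqrtr_ge0 ?addr_ge0//.
rewrite sqr_sqrtr ?addr_ge0 ?sqr_ge0// sqrrD !real_normK ?num_real//.
by rewrite lerD2r lerDl mulrn_wge0// mulr_ge0.
Qed.

End complex_norm.

(** * Smooth kernels *)

Section almost_constant_kernels.
Context {R : realType} {d : nat}.
Local Notation vec := 'rV[R]_d.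
Local Notation leb := (lebesgue_rV (R := R) d).
Local Notation vol := (unit_vol (R := R) (d := d)).

(** The error is measured relative to [|h0|] times the volume of the balls, the form of the
    threshold in [two_balls_estimate]; [c1] is common to all balls. *)
Definition almost_constant_kernel (K : vec -> vec -> R[i]) (kappa eps c1 : R) : Prop :=
  forall (y0 : vec) (r : R), 0 < r -> exists (x0 : vec) (h : vec * vec -> R) (h0 : R),
  [/\ h = (fun z => complex.Re (K z.1 z.2)) \/ h = (fun z => complex.Im (K z.1 z.2)),
      kappa * r <= set_dist (eball y0 r) (eball x0 r),
      c1 <= `|h0| * r ^+ d,
      (forall y, eball y0 r y -> \int[leb]_(x in eball x0 r) `|h (x, y) - h0|%:E <=
         (eps * `|h0| * (vol * r ^+ d))%:E)%E &
      (forall x, eball x0 r x -> \int[leb]_(y in eball y0 r) `|h (x, y) - h0|%:E <=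
         (eps * `|h0| * (vol * r ^+ d))%:E)%E].

Lemma set_dist_eball (x y : vec) (r e : R) : 0 < r -> e <= enorm (x - y) - 2 * r ->
  e <= set_dist (eball y r) (eball x r).
Proof.
move=> r0 he; apply: lb_le_inf.
  exists (enorm (y - x)), (y, x) => //=; split; exact: eball_center.
move=> _ [[u v] [/= yu xv] <-]; move: yu xv; rewrite /eball/= => yu xv.
apply: (le_trans he); rewrite enormB.
have := ler_enorm_dist u y x; have := ler_enorm_dist v u x.
rewrite (enormB y u); lra.
Qed.

(* The values of [K] on the diagonal are arbitrary, possibly non-measurable, but do not affect
   the commutator form, where [(b x - b y) ^+ k] vanishes. *)
Definition offdiag (K : vec -> vec -> R[i]) (x y : vec) : R[i] :=
  if x == y then 0 else K x y.

Lemma offdiagE K x y : x <> y -> offdiag K x y = K x y.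
Proof. by move=> /eqP/negbTE xy; rewrite /offdiag xy. Qed.

Lemma measurable_fun_rV_sub : measurable_fun setT (fun z : vec * vec => z.1 - z.2).
Proof.
apply/measurable_fun_rVP => i; under eq_fun do rewrite !mxE.
apply: measurable_funB.
  exact: (measurableT_comp (measurable_coord i) measurable_fst).
exact: (measurableT_comp (measurable_coord i) measurable_snd).
Qed.

Let measurable_offdiagonal : measurable [set z : vec * vec | z.1 <> z.2].
Proof.
have mB := measurableT_comp measurable_enorm measurable_fun_rV_sub.
rewrite (_ : mkset _ = (fun z : vec * vec => enorm (z.1 - z.2)) @^-1` `]0, +oo[%classic).
  exact: measurable_fun_preimage mB _.
apply/seteqP; split => z /=; rewrite in_itv/= andbT enorm_gt0 subr_eq0.
  by move/eqP.
by move=> /eqP.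
Qed.

Lemma measurable_offdiag K : measurable_funC [set z : vec * vec | z.1 <> z.2] (fun z => K z.1 z.2) ->
  measurable_funC setT (fun z => offdiag K z.1 z.2).
Proof.
have E (c : R[i] -> R) : c 0 = 0 -> (fun z : vec * vec => c (offdiag K z.1 z.2)) =
    (fun z : vec * vec => c (K z.1 z.2)) \_ [set z : vec * vec | z.1 <> z.2].
  move=> c0; apply/funext => z; rewrite patchE /offdiag.
  case: ifPn => [/eqP zz|/eqP zz]; case: ifPn => //.
    by move=> /set_mem.
  by rewrite notin_setE => /(_ zz).
by move=> [mR mI]; split; rewrite E//; apply/measurable_restrict => //; rewrite setTI.
Qed.

(** Non-degeneracy is used at radius [A * r]. Moving [y0] to [y] and then [x0] to [x] changes [K] by
    at most [eps / 2] times [|K0|], and the larger of the real and imaginary parts of [K0] is at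
    least half its modulus, which costs the remaining factor 2. *)
Lemma CZ_almost_constant (omega : R -> R) K (c0 kappa eps : R) :
  omega_CZ_kernel omega K -> omega t @[t --> 0^'+] --> 0 -> 0 < c0 ->
  (forall (y : vec) (r : R), 0 < r -> exists2 x : vec,
            ~ eball y r x & (c0 * r ^+ d)^-1 <= normc (K x y)) ->
  0 < kappa -> 0 < eps ->
  exists2 c1, 0 < c1 & almost_constant_kernel (offdiag K) kappa eps c1.
Proof.
move=> [om0 om_mono mK _ Ksmooth] om_cvg c0_gt0 Knd kappa0 eps0.
(* Each of the two moves costs [(A r / 2)^-d eta]; together this is [eps / 2] times
   [(c0 A^d r^d)^-1], a lower bound of [|K0|]. *)
pose eta := eps / (2 ^+ (d + 2) * c0).
have eta0 : 0 < eta by rewrite divr_gt0// mulr_gt0.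
have [t [t0 t1 omt]] : exists t, [/\ 0 < t, t < 1 & omega t <= eta].
  move/cvgrPdist_le : om_cvg => /(_ _ eta0) om_near.
  have /filter_ex [t [[t0 t1] /= ht]] : \forall t \near 0^'+,
      (0 < t /\ t < 1) /\ `|0 - omega t| <= eta.
    near=> t; split; last by near: t.
    by split; near: t; [exact: nbhs_right_gt|exact: nbhs_right_lt].
  exists t; split => //; move: ht; rewrite sub0r normrN; apply: le_trans; exact: ler_norm.
(* [A >= kappa + 2] separates the balls by [kappa r]; [A > 4] puts displacements below [r] within
   the range of the smoothness condition at distances at least [A r / 2]; [A >= 2 / t] makes the
   relative displacements at most [t]. *)
pose A := kappa + 5 + 2 / t.
have t2 : 0 < 2 / t by rewrite divr_gt0.
have A0 : 0 < A by rewrite /A; lra.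
have At : 2 / A <= t by rewrite ler_pdivrMr// mulrC -ler_pdivrMr// /A; lra.
exists (2 * c0 * A ^+ d)^-1; first by rewrite invr_gt0 !mulr_gt0// exprn_gt0.
move=> y0 r r0.
have Ar : 0 < A * r by rewrite mulr_gt0.
have [x0 nx0 Kx0] := Knd y0 _ Ar.
have Dx0 : A * r <= enorm (x0 - y0) by rewrite leNgt; apply/negP.
pose K0 := K x0 y0.
have K0lb : (c0 * A ^+ d * r ^+ d)^-1 <= normc K0 by rewrite -mulrA -exprMn.
have osc_bound x y : eball x0 r x -> eball y0 r y ->
    normc (offdiag K x y - K0) <= eps / 2 * normc K0.
  rewrite /eball/= => xx0 yy0.
  have E0 : A * r / 2 <= enorm (x0 - y).
    have := ler_enorm_dist y x0 y0; rewrite /A in Dx0 *.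
    have : 0 < (kappa + 2 / t) * r by rewrite mulr_gt0//; lra.
    nra.
  have E1 : A * r / 2 <= enorm (y0 - x0) by rewrite enormB; lra.
  have r5 : 5 * r < A * r by rewrite ltr_pM2r// /A; lra.
  have Ar2 : 0 < A * r / 2 by rewrite divr_gt0.
  have ratio (a E : R) : 0 <= a -> a < r -> A * r / 2 <= E ->
      E ^- d * omega (a / E) <= (A * r / 2) ^- d * eta.
    move=> a0 ar hE; have Ep : 0 < E by rewrite (lt_le_trans Ar2).
    have aE0 : 0 <= a / E by rewrite divr_ge0// ltW.
    have aEt : a / E <= t.
      apply: le_trans At; rewrite ler_pdivrMr//.
      have A2 : 0 <= 2 / A by rewrite divr_ge0// ltW.
      apply: le_trans (ler_wpM2l A2 hE).
      by rewrite (_ : _ * (_ / 2) = r) ?ltW//; field; rewrite gt_eqF.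
    apply: ler_pM; rewrite ?invr_ge0 ?exprn_ge0 ?(ltW Ep)//.
    - by apply: om0 => //; lra.
    - rewrite lef_pV2 ?posrE ?exprn_gt0//; apply: lerXn2r; rewrite ?nnegrE// ltW//.
    - by apply: le_trans omt; exact: om_mono.
  have xy : x <> y.
    move=> xy; move: xx0; rewrite xy enormB => h.
    have : enorm (x0 - y) < r by []. lra.
  rewrite offdiagE//.
  have H1 : normc (K x0 y - K x y) <= (A * r / 2) ^- d * eta.
    have xx0' : enorm (x0 - x) < r by rewrite enormB.
    have c1 : enorm (x0 - x) < 2^-1 * enorm (x0 - y) by lra.
    have := Ksmooth _ _ _ c1; have := ratio _ _ (enorm_ge0 (x0 - x)) xx0' E0.
    have : 0 <= normc (K y x0 - K y x) by exact: normc_nonneg.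
    lra.
  have H2 : normc (K x0 y0 - K x0 y) <= (A * r / 2) ^- d * eta.
    have yy0' : enorm (y0 - y) < r by rewrite enormB.
    have c1 : enorm (y0 - y) < 2^-1 * enorm (y0 - x0) by lra.
    have := Ksmooth _ _ _ c1; have := ratio _ _ (enorm_ge0 (y0 - y)) yy0' E1.
    have : 0 <= normc (K y0 x0 - K y x0) by exact: normc_nonneg.
    lra.
  have -> : K x y - K0 = - ((K x0 y - K x y) + (K x0 y0 - K x0 y)).
    by rewrite /K0; ring.
  rewrite normcN (le_trans (le_normcD _ _))//.
  apply: (le_trans (lerD H1 H2)).
  have -> : (A * r / 2) ^- d * eta + (A * r / 2) ^- d * eta =
      eps / 2 * (c0 * A ^+ d * r ^+ d)^-1.
    rewrite /eta !exprMn exprVn exprD; field.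
    by rewrite !expf_neq0 ?gt_eqF//.
  by rewrite ler_pM2l// divr_gt0.
have fin_bound (h : vec * vec -> R) (h0 : R) :
    (forall x y, `|h (x, y) - h0| <= normc (offdiag K x y - K0)) ->
    normc K0 <= 2 * `|h0| ->
    forall x y, eball x0 r x -> eball y0 r y -> `|h (x, y) - h0| <= eps * `|h0|.
  move=> hh hK x y xx yy; apply: (le_trans (hh x y)).
  apply: (le_trans (osc_bound x y xx yy)); nra.
suff [h [h0 [hK hh hK0]]] : exists (h : vec * vec -> R) (h0 : R),
    [/\ h = (fun z => complex.Re (offdiag K z.1 z.2)) \/
        h = (fun z => complex.Im (offdiag K z.1 z.2)),
       forall x y, `|h (x, y) - h0| <= normc (offdiag K x y - K0) &
       normc K0 <= 2 * `|h0|].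
  have hb := fin_bound _ _ hh hK0.
  have mh : measurable_fun setT h by case: hK => ->; case: (measurable_offdiag mK).
  have h00 : 0 <= eps * `|h0| by rewrite mulr_ge0// ltW.
  have ball_bound (f : vec -> R) (c : vec) : measurable_fun setT f ->
      (forall x, eball c r x -> `|f x| <= eps * `|h0|) ->
      (\int[leb]_(x in eball c r) `|f x|%:E <= (eps * `|h0| * (vol * r ^+ d))%:E)%E.
    move=> mf hf; rewrite EFinM -(lebesgue_eball c r0).
    have mB := measurable_eball c r.
    rewrite -integral_cst//; apply: ge0_le_integral => //.
    by apply/measurable_EFinP; apply: measurableT_comp => //; exact: measurable_funTS.
  exists x0, h, h0; split => //.
  - apply: set_dist_eball => //; apply: le_trans (_ : A * r - 2 * r <= _); last by lra.
    by rewrite -mulrBl ler_pM2r// /A; lra.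
  - apply: (@le_trans _ _ (normc K0 / 2 * r ^+ d)); last first.
      by rewrite ler_wpM2r ?exprn_ge0 ?(ltW r0)//; lra.
    have rd : 0 < r ^+ d by rewrite exprn_gt0.
    rewrite -ler_pdivrMr// ler_pdivlMr//; apply: le_trans Kx0.
    rewrite exprMn le_eqVlt; apply/orP; left; apply/eqP; field.
    by rewrite !gt_eqF ?exprn_gt0.
  - move=> y yy; apply: ball_bound => [|x xx]; last exact: hb.
    by apply: measurable_funB => //; exact: (measurable_fun_pair1 y mh).
  - move=> x xx; apply: ball_bound => [|y yy]; last exact: hb.
    by apply: measurable_funB => //; exact: (measurable_fun_pair2 x mh).
have := normc_le_absReDIm K0.
have ReB (z w : R[i]) : complex.Re (z - w) = complex.Re z - complex.Re w by case: z; case: w.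
have ImB (z w : R[i]) : complex.Im (z - w) = complex.Im z - complex.Im w by case: z; case: w.
have [hIR|hRI] := leP `|complex.Im K0| `|complex.Re K0| => hn.
  exists (fun z => complex.Re (offdiag K z.1 z.2)), (complex.Re K0).
  split; [by left| |by lra].
  by move=> x y /=; rewrite -ReB normc_ge_absRe.
exists (fun z => complex.Im (offdiag K z.1 z.2)), (complex.Im K0).
split; [by right| |by lra].
by move=> x y /=; rewrite -ImB normc_ge_absIm.
Unshelve. all: by end_near.
Qed.

End almost_constant_kernels.

(** * Rough homogeneous kernels *)

Section rough_kernels.
Context {R : realType} {d : nat}.
Local Notation vec := 'rV[R]_d.
Local Notation leb := (lebesgue_rV (R := R) d).
Local Notation vol := (unit_vol (R := R) (d := d)).
Local Notation sph := (sphere R d).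
Local Notation sigma := (sphere_measure R d).

Lemma measurable_sphere : measurable sph.
Proof.
rewrite (_ : sph = enorm @^-1` [set 1]).
  exact: measurable_fun_preimage measurable_enorm _.
by apply/seteqP; split.
Qed.

Lemma sphere_proj_sphere (u : vec) : u != 0 -> sph (sphere_proj u).
Proof.
rewrite -enorm_gt0 => u0; rewrite /sphere/sphere_proj/= enormZ gtr0_norm ?invr_gt0//.
by rewrite mulVf// gt_eqF.
Qed.

Lemma sphere_proj0 : sphere_proj (0 : vec) = 0.
Proof. by rewrite /sphere_proj scaler0. Qed.

Variable Om : vec -> R.
Hypothesis d_gt0 : (0 < d)%N.
Hypothesis Om_homo : forall (t : R) (x : vec), 0 < t -> Om (t *: x) = Om x.
Hypothesis Om_int : sigma.-integrable sph (EFin \o Om).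
Hypothesis Om_neq0 : ~ {ae sigma, forall x, sph x -> Om x = 0}.

Definition rough_profile (u : vec) : R := if u == 0 then 0 else Om u / enorm u ^+ d.
Local Notation H := rough_profile.

(** Measurability of [Om] is given on the sphere only. Extended by zero and composed with
    [sphere_proj], it becomes a measurable function on the whole space equal to [Om] away from the
    origin. *)
Let g : vec -> R := Om \_ sph.

Let mg : measurable_fun setT g.
Proof.
apply/measurable_restrict => //; first exact: measurable_sphere.
by rewrite setTI; apply/measurable_EFinP; case/integrableP: Om_int.
Qed.

Let g_proj u : u != 0 -> g (sphere_proj u) = Om u.
Proof.
move=> u0; rewrite /g patchE mem_set; last exact: sphere_proj_sphere.
by rewrite Om_homo// invr_gt0 enorm_gt0.
Qed.

Let g_proj0 : g (sphere_proj 0) = 0.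
Proof.
rewrite sphere_proj0 /g patchE memNset// /sphere/= enorm0 => /eqP.
by rewrite eq_sym oner_eq0.
Qed.

Let HE u : H u = g (sphere_proj u) * (enorm u ^+ d) `^ (-1).
Proof.
rewrite /H; case: eqP => [->|/eqP u0]; first by rewrite g_proj0 mul0r.
by rewrite g_proj// powR_inv1// exprn_ge0// enorm_ge0.
Qed.

Let mgp : measurable_fun setT (g \o (@sphere_proj R d)).
Proof. exact: (measurableT_comp mg measurable_sphere_proj). Qed.

Lemma measurable_rough_profile : measurable_fun setT H.
Proof.
rewrite (_ : H = fun u => g (sphere_proj u) * (enorm u ^+ d) `^ (-1)); last first.
  by apply/funext => u; exact: HE.
apply: measurable_funM => //.
apply: (measurableT_comp (measurable_powR (-1))).
exact: measurable_funX measurable_enorm.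
Qed.

Lemma rough_profile_homo (l : R) u : 0 < l -> H (l *: u) = l ^- d * H u.
Proof.
move=> l0; rewrite /H scaler_eq0 gt_eqF//=; case: eqP => u0; first by rewrite mulr0.
by rewrite Om_homo// enormZ gtr0_norm// exprMn invfM mulrCA.
Qed.

(** [sphere_measure] is [d] times the image of Lebesgue measure on the unit ball under
    [sphere_proj], so integrability passes from the sphere to the ball by change of variables;
    [0 < d] excludes the product [0 * +oo]. *)
Let ball_int : (\int[leb]_(u in eball 0 1) `|g (sphere_proj u)|%:E < +oo)%E.
Proof.
have mabs : measurable_fun setT (fun u => `|g u|%:E).
  by apply/measurable_EFinP; exact: measurableT_comp.
have mabsp : measurable_fun setT (fun u => `|g (sphere_proj u)|%:E).
  by apply/measurable_EFinP; apply: measurableT_comp.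
have : (\int[sigma]_x `|g x|%:E < +oo)%E.
  case/integrableP: Om_int => _; apply: le_lt_trans.
  rewrite [leRHS]integral_mkcond le_eqVlt; apply/orP; left; apply/eqP.
  by apply: eq_integral => x _; rewrite /g !patchE; case: ifPn => //=; rewrite normr0.
rewrite /sphere_measure ge0_integral_mscale//.
rewrite ltNge => /negP h; rewrite ltNge; apply/negP => h2; apply: h.
have {}h2 : (\int[leb]_(u in eball 0 1) `|g (sphere_proj u)|%:E = +oo)%E.
  by apply/eqP; rewrite eq_le leey.
suff -> : (\int[@cone_measure R d]_x `|g x|%:E = +oo)%E.
  by rewrite gt0_muley// lte_fin ltr0n.
apply/eqP; rewrite eq_le leey/= -h2.
rewrite (@eq_measure_integral _ _ _ _ (mrestr leb (@measurable_unit_eball R d))); last first.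
  by move=> A mA AB; rewrite /= /mrestr setIidl.
have := @ge0_integral_pushforward _ _ _ _ R _ (@measurable_sphere_proj R d)
  (mrestr leb (@measurable_unit_eball R d)) setT (fun x => `|g x|%:E) measurableT mabs.
rewrite preimage_setT => -> //.
apply: ge0_subset_integral => //.
exact: measurable_unit_eball.
Qed.

Lemma rough_profile_int e : 0 < e ->
  (\int[leb]_(u in [set u | (e <= enorm u < 1)%R]) `|H u|%:E < +oo)%E.
Proof.
move=> e0.
have mA : measurable [set u : vec | e <= enorm u < 1].
  rewrite (_ : mkset _ = enorm @^-1` `[e, 1[%classic).
    exact: measurable_fun_preimage measurable_enorm _.
  by apply/seteqP; split => x /=; rewrite in_itv.
have mabsp : measurable_fun setT (fun u => `|g (sphere_proj u)|%:E).
  by apply/measurable_EFinP; apply: measurableT_comp.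
have ed : 0 <= e ^- d by rewrite invr_ge0 exprn_ge0// ltW.
apply: (@le_lt_trans _ _ ((e ^- d)%:E * \int[leb]_(u in eball 0 1) `|g (sphere_proj u)|%:E)%E).
  rewrite -ge0_integralZl//; last 2 first.
  - exact: measurable_unit_eball.
  - exact: measurable_funTS.
  apply: (@le_trans _ _ (\int[leb]_(u in [set u | (e <= enorm u < 1)%R])
     ((e ^- d)%:E * `|g (sphere_proj u)|%:E))%E).
    apply: ge0_le_integral => //.
    - apply/measurable_EFinP/measurable_funTS.
      exact: (measurableT_comp _ measurable_rough_profile).
    - by apply: measurable_funTS; exact: measurable_funeM.
    - move=> u /andP[eu _]; have u0 : u != 0 by rewrite -enorm_gt0 (lt_le_trans e0).
      rewrite -EFinM lee_fin g_proj// /H (negbTE u0) normrM mulrC ler_wpM2r//.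
      rewrite ger0_norm ?invr_ge0 ?exprn_ge0 ?enorm_ge0//.
      by rewrite lef_pV2 ?posrE ?exprn_gt0 ?enorm_gt0// lerXn2r ?nnegrE ?enorm_ge0// ltW.
  apply: ge0_subset_integral => //.
  - exact: measurable_unit_eball.
  - by apply: measurable_funTS; exact: measurable_funeM.
  - by move=> u _; rewrite mule_ge0.
  - by move=> u /andP[_]; rewrite /eball/= subr0.
by rewrite lte_mul_pinfty.
Qed.

(** If the part of the unit ball that projects into the set where [Om] is nonzero were null, that
    set would be null for the surface measure. *)
Lemma rough_profile_neq0 : ~ leb.-negligible [set u | 0 < enorm u < 1 /\ H u <> 0].
Proof.
move=> [N [mN N0 sN]]; apply: Om_neq0.
pose Z := [set x | g x != 0].
have mZ : measurable Z.
  rewrite (_ : Z = ~` (g @^-1` [set 0])); last first.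
    by apply/seteqP; split => x /= /eqP.
  by apply: measurableC; exact: measurable_fun_preimage mg _.
exists Z; split => //.
  rewrite /sphere_measure/= /mscale/= /cone_measure /pushforward /mrestr.
  rewrite (_ : leb _ = 0%E) ?mule0//.
  apply: (subset_measure0 _ mN _ N0).
    apply: measurableI; last exact: measurable_unit_eball.
    exact: measurable_fun_preimage (@measurable_sphere_proj R d) mZ.
  move=> u [/= gu u1]; apply: sN => /=.
  have u0 : u != 0 by apply/eqP => u0; move: gu; rewrite /Z/= u0 g_proj0 eqxx.
  rewrite enorm_gt0 u0/=; split; first by move: u1; rewrite /eball/= subr0.
  move: gu; rewrite /Z/= g_proj// /H (negbTE u0) => Om0; apply/eqP.
  by rewrite mulf_neq0// invr_neq0// expf_neq0// enorm_eq0.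
move=> x /= /not_implyP [sx Omx]; rewrite /Z/= /g patchE mem_set//.
exact/eqP.
Qed.

(** One ball [eball z (2 * s)] serves all scales. With [l = r / s] and [x0 = y0 + l z], the vector
    [(x - y) / l] stays within [2 s] of [z] for [x] and [y] in the two balls, and homogeneity of
    degree [-d] turns closeness of [H] to [c] into closeness of [h] to [l^-d c]. *)
Lemma rough_almost_constant (h : vec * vec -> R) (kappa eps : R) :
  (forall x y, h (x, y) = H (x - y)) -> 0 < kappa -> 0 < eps ->
  exists2 c1, 0 < c1 & forall (y0 : vec) (r : R), 0 < r -> exists (x0 : vec) (h0 : R),
  [/\ kappa * r <= set_dist (eball y0 r) (eball x0 r),
      c1 <= `|h0| * r ^+ d,
      (forall y, eball y0 r y -> \int[leb]_(x in eball x0 r) `|h (x, y) - h0|%:E <=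
         (eps * `|h0| * (vol * r ^+ d))%:E)%E &
      (forall x, eball x0 r x -> \int[leb]_(y in eball y0 r) `|h (x, y) - h0|%:E <=
         (eps * `|h0| * (vol * r ^+ d))%:E)%E].
Proof.
move=> hE kappa0 eps0.
have mH := measurable_rough_profile.
have eta0 : 0 < eps * vol by rewrite mulr_gt0// unit_vol_gt0.
have L0 : 0 < kappa + 2 by rewrite addr_gt0.
have [z [s [c [s0 c0 sz Hc]]]] :=
  exists_lebesgue_ball mH rough_profile_int rough_profile_neq0 eta0 L0.
exists (`|c| * s ^+ d); first by rewrite mulr_gt0 ?normr_gt0// exprn_gt0.
move=> y0 r r0.
have [l l0 rE] : exists2 l, 0 < l & r = l * s.
  by exists (r / s); rewrite ?divr_gt0// divfK// gt_eqF.
have ld : 0 < l ^+ d by rewrite exprn_gt0.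
pose h0 := l ^- d * c.
have h0E : `|h0| = l ^- d * `|c| by rewrite /h0 normrM gtr0_norm// invr_gt0.
pose x0 := y0 + l *: z.
have mHl : measurable_fun setT (fun u => `|H u - c|%:E).
  by apply/measurable_EFinP; apply: measurableT_comp => //; exact: measurable_funB.
(* Change of variables for both integrals at once: [l' = l] in the variable [x], [l' = - l] in the
   variable [y]. *)
have key (l' : R) (a : vec) (D : set vec) (f : vec -> R) : `|l'| = l -> measurable D ->
    measurable_fun setT f -> (forall v, f (l' *: v + a) = H (l *: v)) ->
    (fun v => l' *: v + a) @^-1` D `<=` eball z (2 * s) ->
    (\int[leb]_(x in D) `|f x - h0|%:E <= (eps * `|h0| * (vol * r ^+ d))%:E)%E.
  move=> l'l mD mf fE Dz.
  have l'0 : l' != 0 by rewrite -normr_eq0 l'l gt_eqF.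
  have mF : measurable_fun D (fun x => `|f x - h0|%:E).
    apply/measurable_EFinP/measurable_funTS; apply: measurableT_comp => //.
    exact: measurable_funB.
  have mpre : measurable ((fun v => l' *: v + a) @^-1` D).
    exact: measurable_fun_preimage (measurable_affine_rV _ _) mD.
  have := @ge0_integral_affine_rV _ d l' a D (fun x => `|f x - h0|%:E) l'0 mD mF.
  have -> : (\int[leb]_(x in (fun x => l' *: x + a)%R @^-1` D) `|f (l' *: x + a) - h0|%:E)%E =
    ((l ^- d)%:E * \int[leb]_(x in (fun x => l' *: x + a)%R @^-1` D) `|H x - c|%:E)%E.
    rewrite -ge0_integralZl//; last 2 first.
    - exact: measurable_funTS.
    - by rewrite lee_fin invr_ge0 ltW.
    apply: eq_integral => v _; rewrite fE rough_profile_homo// /h0 -mulrBr normrM.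
    by rewrite gtr0_norm ?invr_gt0// EFinM.
  rewrite l'l => HH.
  have -> : (\int[leb]_(x in D) `|f x - h0|%:E)%E =
      (\int[leb]_(x in (fun x => l' *: x + a)%R @^-1` D) `|H x - c|%:E)%E.
    have fh0 x : D x -> (0 <= `|f x - h0|%:E)%E by [].
    have H2 := HH fh0.
    have : ((l ^+ d)%:E * ((l ^- d)%:E * \int[leb]_(x in D) `|f x - h0|%:E))%E =
       ((l ^+ d)%:E * ((l ^- d)%:E * \int[leb]_(x in (fun x => l' *: x + a)%R @^-1` D) `|H x - c|%:E))%E.
      by rewrite H2.
    by rewrite !muleA -EFinM mulfV ?gt_eqF// !mul1e.
  apply: (@le_trans _ _ (\int[leb]_(x in eball z (2 * s)) `|H x - c|%:E)%E).
    apply: ge0_subset_integral => //; first exact: measurable_eball.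
    exact: measurable_funTS.
  apply: (le_trans Hc); rewrite lee_fin h0E rE exprMn le_eqVlt; apply/orP; left; apply/eqP.
  by field; rewrite gt_eqF.
have mhH (l' : R) (a : vec) : measurable_fun setT (fun x : vec => H (l' *: x + a)).
  exact: (measurableT_comp mH (measurable_affine_rV _ _)).
exists x0, h0; split.
- apply: set_dist_eball => //.
  have -> : x0 - y0 = l *: z by rewrite /x0 addrC addKr.
  rewrite enormZ gtr0_norm// rE.
  have : (kappa + 2) * s * l <= enorm z * l by rewrite ler_pM2r.
  lra.
- by rewrite h0E rE exprMn le_eqVlt; apply/orP; left; apply/eqP; field; rewrite gt_eqF.
- move=> y yy.
  under eq_integral do rewrite hE.
  apply: (key l y (eball x0 r) (fun x => H (x - y))).
  + exact: gtr0_norm.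
  + exact: measurable_eball.
  + rewrite (_ : (fun x => H (x - y)) = (fun x : vec => H (1 *: x + - y)))//.
    by apply/funext => x; rewrite scale1r.
  + by move=> v; rewrite addrK.
  + move=> v; move: yy; rewrite /eball/= => yy vx.
    have : enorm (l *: (v - z)) < l * (2 * s).
      rewrite (_ : _ *: _ = (l *: v + y - x0) - (y - y0)); last first.
        by apply/rowP => i; rewrite !mxE; ring.
      by rewrite (le_lt_trans (ler_enormB _ _))//; rewrite rE in yy vx; lra.
    by rewrite enormZ gtr0_norm// ltr_pM2l.
- move=> x xx.
  under eq_integral do rewrite hE.
  apply: (key (- l) x (eball y0 r) (fun y => H (x - y))).
  + by rewrite normrN gtr0_norm.
  + exact: measurable_eball.
  + rewrite (_ : (fun y => H (x - y)) = (fun y : vec => H (-1 *: y + x)))//.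
    by apply/funext => y; rewrite scaleN1r addrC.
  + by move=> v; rewrite opprD addrCA subrr addr0 scaleNr opprK.
  + move=> v; move: xx; rewrite /eball/= => xx vx.
    have : enorm (l *: (v - z)) < l * (2 * s).
      rewrite (_ : _ *: _ = (x - x0) - (- l *: v + x - y0)); last first.
        by apply/rowP => i; rewrite !mxE; ring.
      by rewrite (le_lt_trans (ler_enormB _ _))//; rewrite rE in xx vx; lra.
    by rewrite enormZ gtr0_norm// ltr_pM2l.
Qed.

End rough_kernels.

(** * The two kinds of non-degenerate kernels together *)

Section nondegenerate_kernels.
Context {R : realType} {d : nat}.
Local Notation vec := 'rV[R]_d.
Local Notation leb := (lebesgue_rV (R := R) d).
Local Notation vol := (unit_vol (R := R) (d := d)).

Let Re_divC (w : R[i]) (t : R) : complex.Re (w / t%:C%C) = complex.Re w / t.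
Proof.
rewrite (_ : t%:C%C^-1 = (t^-1)%:C%C); last by rewrite fmorphV.
by case: w => a b /=; rewrite mulr0 subr0.
Qed.

Let Im_divC (w : R[i]) (t : R) : complex.Im (w / t%:C%C) = complex.Im w / t.
Proof.
rewrite (_ : t%:C%C^-1 = (t^-1)%:C%C); last by rewrite fmorphV.
by case: w => a b /=; rewrite mulr0 add0r.
Qed.

(** In the rough case the real and imaginary parts of [Omega] cannot both vanish almost everywhere
    on the sphere; one that does not supplies [h]. *)
Lemma nondegenerate_almost_constant (K : vec -> vec -> R[i]) :
  (0 < d)%N -> nondegenerate_CZ_kernel K ->
  measurable_funC setT (fun z => offdiag K z.1 z.2) /\
  forall kappa eps : R, 0 < kappa -> 0 < eps ->
    exists2 c1, 0 < c1 & almost_constant_kernel (offdiag K) kappa eps c1.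
Proof.
move=> d0 [[omega [HK om [c0 c00 hc0]]]|[Om [KE Om_homo [intR intI] Om0]]].
  split; last by move=> kappa eps kappa0 eps0; exact: (CZ_almost_constant HK om c00 hc0).
  by apply: measurable_offdiag; case: HK.
have homo (c : R[i] -> R) (t : R) (x : vec) : 0 < t -> c (Om (t *: x)) = c (Om x).
  by move=> t0; rewrite Om_homo.
have ReE x y : complex.Re (offdiag K x y) = rough_profile (@complex.Re R \o Om) (x - y).
  rewrite /offdiag /rough_profile subr_eq0; case: eqP => // xy.
  by rewrite KE// -rmorphXn/= Re_divC.
have ImE x y : complex.Im (offdiag K x y) = rough_profile (@complex.Im R \o Om) (x - y).
  rewrite /offdiag /rough_profile subr_eq0; case: eqP => // xy.
  by rewrite KE// -rmorphXn/= Im_divC.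
have mprof (f : vec -> R) : measurable_fun setT f ->
    measurable_fun setT (fun z : vec * vec => f (z.1 - z.2)).
  by move=> mf; exact: (measurableT_comp mf measurable_fun_rV_sub).
have mR := measurable_rough_profile (homo (@complex.Re R)) intR.
have mI := measurable_rough_profile (homo (@complex.Im R)) intI.
split.
  split.
    rewrite (_ : (fun _ => _) = (fun z : vec * vec => rough_profile (@complex.Re R \o Om) (z.1 - z.2))).
      exact: mprof.
    by apply/funext => z; rewrite ReE.
  rewrite (_ : (fun _ => _) = (fun z : vec * vec => rough_profile (@complex.Im R \o Om) (z.1 - z.2))).
    exact: mprof.
  by apply/funext => z; rewrite ImE.
move=> kappa eps kappa0 eps0.
have [aeR|naeR] := pselect {ae sphere_measure R d, forall x, sphere R d x -> (@complex.Re R \o Om) x = 0}; last first.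
  have [c1 c10 hc1] := rough_almost_constant d0 (homo (@complex.Re R)) intR naeR
    (h := fun z => complex.Re (offdiag K z.1 z.2)) (fun x y => ReE x y) kappa0 eps0.
  exists c1 => // y0 r r0; have [x0 [h0 [h1 h2 h3 h4]]] := hc1 y0 r r0.
  by exists x0, (fun z => complex.Re (offdiag K z.1 z.2)), h0; split => //; left.
have [aeI|naeI] := pselect {ae sphere_measure R d, forall x, sphere R d x -> (@complex.Im R \o Om) x = 0}; last first.
  have [c1 c10 hc1] := rough_almost_constant d0 (homo (@complex.Im R)) intI naeI
    (h := fun z => complex.Im (offdiag K z.1 z.2)) (fun x y => ImE x y) kappa0 eps0.
  exists c1 => // y0 r r0; have [x0 [h0 [h1 h2 h3 h4]]] := hc1 y0 r r0.
  by exists x0, (fun z => complex.Im (offdiag K z.1 z.2)), h0; split => //; right.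
exfalso; apply: Om0; move: aeR aeI; apply: filterS2 => x /= hR hI sx.
by have := hR sx; have := hI sx; case: (Om x) => a b /= -> ->.
Qed.

End nondegenerate_kernels.

(** * From the tested form to mean oscillations *)

Section commutator.
Context {R : realType} {d : nat}.
Local Notation vec := 'rV[R]_d.
Local Notation leb := (lebesgue_rV (R := R) d).
Local Notation vol := (unit_vol (R := R) (d := d)).
Implicit Types (K : vec -> vec -> R[i]) (b : vec -> R).

Lemma commutator_form_offdiag k b K f g : (0 < k)%N ->
  commutator_form k b K f g = commutator_form k b (offdiag K) f g.
Proof.
move=> k0; rewrite /commutator_form; congr integralC; apply/funext => z.
rewrite /offdiag; case: eqP => // ->.
by rewrite subrr expr0n gtn_eqF//= !mul0r.
Qed.

Let ind (E : set vec) (x : vec) : R[i] := (\1_E x : R)%:C%C.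

(** Only an inequality: the norm is zero when [E] is null. *)
Let Linfty_norm_ind E : (Linfty_norm (ind E) <= 1)%E.
Proof.
rewrite /Linfty_norm unlock /Lnorm; case: ifPn => // _.
apply/ess_supP; apply: nearW => x /=.
rewrite lee_fin /ind /normc/= expr0n addr0 sqrtr_sqr indicE.
by case: (x \in E); rewrite ?normr1 ?normr0.
Qed.

Let Linfty_on_ind (B E : set vec) : measurable E -> E `<=` B -> Linfty_on B (ind E).
Proof.
move=> mE EB; split.
- by split; [exact: measurable_indic|exact: measurable_cst].
- exact: le_lt_trans (Linfty_norm_ind E) (ltry _).
- by move=> x Bx; rewrite /ind indicE memNset// => /EB.
Qed.

Let ind_mul (z : R[i]) (s t : R) : complex.Re (z * s%:C%C * t%:C%C) = complex.Re z * s * t /\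
  complex.Im (z * s%:C%C * t%:C%C) = complex.Im z * s * t.
Proof. by case: z => a b /=; rewrite !(mulr0, mul0r, subr0, add0r). Qed.

Let real_mul (s : R) (z : R[i]) : complex.Re (s%:C%C * z) = s * complex.Re z /\
  complex.Im (s%:C%C * z) = s * complex.Im z.
Proof. by case: z => a b /=; rewrite !(mulr0, mul0r, subr0, addr0). Qed.

Lemma commutator_form_indic k b K (E F : set vec) (h : vec * vec -> R) :
  h = (fun z => complex.Re (K z.1 z.2)) \/ h = (fun z => complex.Im (K z.1 z.2)) ->
  `|\int[(leb \x leb)%E]_z ((b z.1 - b z.2) ^+ k * h z * \1_E z.2 * \1_F z.1)| <=
  normc (commutator_form k b K (ind E) (ind F)).
Proof.
case=> ->; [apply: le_trans (normc_ge_absRe _)|apply: le_trans (normc_ge_absIm _)].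
  rewrite le_eqVlt; apply/orP; left; apply/eqP; congr `| _ |.
  by apply: eq_Rintegral => z _; rewrite (ind_mul _ _ _).1 (real_mul _ _).1.
rewrite le_eqVlt; apply/orP; left; apply/eqP; congr `| _ |.
by apply: eq_Rintegral => z _; rewrite (ind_mul _ _ _).2 (real_mul _ _).2.
Qed.

Lemma osc_eball_lty k b (c : vec) (r a : R) : locally_Lpow k b ->
  (osc leb b k (eball c r) a < +oo)%E.
Proof.
move=> [mb hb]; have [A [cA mA BA]] := sub_eball_compact c r.
have mB := measurable_eball c r.
apply: (@le_lt_trans _ _ (\int[leb]_(x in eball c r)
   ((2 ^+ k)%:E * ((`|b x| ^+ k)%:E + (`|a| ^+ k)%:E)))%E).
  apply: ge0_le_integral => //.
  - apply/measurable_EFinP/measurable_funTS; apply: measurable_funX.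
    apply: measurableT_comp => //; exact: measurable_funB.
  - apply: measurable_funTS; apply: measurable_funeM; apply: emeasurable_funD => //.
    by apply/measurable_EFinP; apply: measurable_funX; exact: measurableT_comp.
  - move=> x _; rewrite -EFinD -EFinM lee_fin -[in leRHS](normrN a).
    exact: ler_normD_expn.
have mbk : measurable_fun setT (fun x => (`|b x| ^+ k)%:E).
  by apply/measurable_EFinP; apply: measurable_funX; exact: measurableT_comp.
rewrite ge0_integralZl//; last 2 first.
- by apply: emeasurable_funD => //; exact: measurable_funTS.
- by move=> x _; rewrite adde_ge0.
rewrite ge0_integralD//; last exact: measurable_funTS.
rewrite lte_mul_pinfty ?lee_fin ?exprn_ge0// lte_add_pinfty//.
  apply: le_lt_trans (hb A cA); apply: ge0_subset_integral => //.
  exact: measurable_funTS.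
by rewrite integral_cst// lte_mul_pinfty// lebesgue_eball_lty.
Qed.

Lemma mean_oscillation_bound K k (p q kappa : R) :
  (0 < d)%N -> nondegenerate_CZ_kernel K -> (0 < k)%N -> 1 < p -> p <= q -> 0 < kappa ->
  exists2 C : R, 0 < C & forall b (Theta : R),
    locally_Lpow k b -> 0 <= Theta ->
    (forall (c c' : vec) (r : R) (f g : vec -> R[i]),
      0 < r ->
      kappa * r <= set_dist (eball c r) (eball c' r) ->
      Linfty_on (eball c r) f -> Linfty_on (eball c' r) g ->
      ((normc (commutator_form k b K f g))%:E <=
       Theta%:E *
       (Linfty_norm f * (leb (eball c r)) `^ p^-1) *
       (Linfty_norm g * (leb (eball c' r)) `^ (q / (q - 1))^-1))%E) ->
    forall (c : vec) (r : R), 0 < r -> exists a,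
      (osc leb b k (eball c r) a <=
        (C * Theta * r `^ (d%:R * (p^-1 - q^-1)) * (vol * r ^+ d))%:E)%E.
Proof.
move=> d0 hK k0 p1 pq kappa0.
have [[mR mI] hconst] := nondegenerate_almost_constant d0 hK.
have [c1 c10 hc1] := hconst kappa (absorb k) kappa0 (absorb_gt0 k).
have vol0 : 0 < vol := unit_vol_gt0.
have q1 : 1 < q by exact: lt_le_trans pq.
(* With [X] the oscillation and [M = vol r^d], absorption gives [|h0| M X <= 16 t0], and
   [|h0| >= c1 / r^d] gives [c1 vol X <= 16 t0]; the power of [vol] stems from the power of [M] in
   [t0]. *)
exists (16 * vol `^ (p^-1 - q^-1) / (c1 * vol)).
  by rewrite divr_gt0 ?mulr_gt0// powR_gt0.
move=> b Theta bL Theta0 test c r r0.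
have [x0 [h [h0 [hK' kr c1h hB hB']]]] := hc1 c r r0.
have mh : measurable_fun setT h by case: hK' => ->.
pose M := vol * r ^+ d.
have rd : 0 < r ^+ d by rewrite exprn_gt0.
have M0 : 0 < M by rewrite mulr_gt0.
(* The exponent is [1/p + 1/q'], since [1/q' = 1 - 1/q]. *)
pose t0 := Theta * M `^ (1 + (p^-1 - q^-1)).
have form E F : measurable E -> measurable F -> E `<=` eball c r -> F `<=` eball x0 r ->
   `|\int[(leb \x leb)%E]_z ((b z.1 - b z.2) ^+ k * h z * \1_E z.2 * \1_F z.1)| <= t0.
  move=> mE mF EB FB'; apply: le_trans (commutator_form_indic k b E F hK') _.
  have := test c x0 r _ _ r0 kr (Linfty_on_ind mE EB) (Linfty_on_ind mF FB').
  rewrite commutator_form_offdiag// !lebesgue_eball// -/M !poweR_EFin => H.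
  rewrite -lee_fin; apply: (le_trans H).
  have Mp s : (0 <= (M `^ s)%:E)%E by rewrite lee_fin powR_ge0.
  apply: (@le_trans _ _ (Theta%:E * (1 * (M `^ p^-1)%:E) * (1 * (M `^ (q / (q - 1))^-1)%:E))%E).
    have n0 (f : vec -> R[i]) : (0 <= Linfty_norm f)%E by exact: Lnorm_ge0.
    apply: lee_pmul.
    - by rewrite mule_ge0 ?lee_fin// mule_ge0.
    - by rewrite mule_ge0.
    - by rewrite lee_wpmul2l ?lee_fin// lee_wpmul2r// Linfty_norm_ind.
    - by rewrite lee_wpmul2r// Linfty_norm_ind.
  rewrite !mul1e -!EFinM lee_fin /t0 -mulrA -powRD; last by rewrite (gt_eqF M0) implybT.
  rewrite le_eqVlt; apply/orP; left; apply/eqP; congr (_ * _ `^ _).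
  by field; rewrite !gt_eqF// ?subr_gt0// (lt_trans _ q1, lt_trans _ p1).
have MB : leb (eball c r) = M%:E by rewrite lebesgue_eball.
have MB' : leb (eball x0 r) = M%:E by rewrite lebesgue_eball.
have [a ha] := two_balls_estimate bL.1 mh (measurable_eball c r) (measurable_eball x0 r) M0 MB MB'
   (fun a => osc_eball_lty c r a bL) (fun a => osc_eball_lty x0 r a bL) hB hB' form.
exists a.
have fo : osc leb b k (eball c r) a \is a fin_num.
  by rewrite ge0_fin_numE ?osc_ge0// osc_eball_lty.
move: ha; rewrite -(fineK fo) -!EFinM !lee_fin; set X := fine _ => ha.
have X0 : 0 <= X by rewrite fine_ge0// osc_ge0.
have : c1 / r ^+ d * (M * X) <= 16 * t0.
  have MX0 : 0 <= M * X by rewrite mulr_ge0// ltW.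
  by apply: le_trans ha; rewrite ler_wpM2r// ler_pdivrMr.
have -> : c1 / r ^+ d * (M * X) = c1 * vol * X by rewrite /M; field; rewrite gt_eqF.
rewrite mulrC -ler_pdivlMr ?mulr_gt0// => /le_trans; apply.
have t0E : t0 = Theta * (M * (vol `^ (p^-1 - q^-1) * r `^ (d%:R * (p^-1 - q^-1)))).
  rewrite /t0 powRD; last by rewrite (gt_eqF M0) implybT.
  rewrite powRr1 ?ltW// /M powRM ?ltW//; do 3 congr (_ * _).
  by rewrite powRrM powR_mulrn// ltW.
rewrite t0E -/M le_eqVlt; apply/orP; left; apply/eqP.
by field; rewrite !gt_eqF.
Qed.

End commutator.

(* [ge0_le_integral] without the measurability hypotheses. *)
Lemma ge0_le_integral_nonmeasurable (disp : measure_display) (T : measurableType disp)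
    (R : realType) (mu : {measure set T -> \bar R}) (f g : T -> \bar R) :
  (forall x, 0 <= f x)%E -> (forall x, f x <= g x)%E ->
  (\int[mu]_x f x <= \int[mu]_x g x)%E.
Proof.
move=> f0 fg; have g0 x : (0 <= g x)%E by exact: le_trans (fg x).
rewrite !ge0_integralE//; apply: ereal_sup_le => _ [h hle <-].
by exists h => // x; apply: (le_trans (hle x)); rewrite !patch_setT.
Qed.

(** The positive and negative parts are dominated by [+oo] on [N], which integrates to zero.
    Integrands of arbitrary regularity are allowed because [commutator_form_ae_constant] is stated
    for arbitrary [K], [f] and [g]. *)
Lemma integral_null_support (disp : measure_display) (T : measurableType disp)
    (R : realType) (mu : {measure set T -> \bar R}) (f : T -> \bar R) (N : set T) :
  measurable N -> mu N = 0%E -> (forall x, ~ N x -> f x = 0%E) ->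
  (\int[mu]_x f x = 0)%E.
Proof.
move=> mN N0 fN.
have ge0_case (g : T -> \bar R) : (forall x, 0 <= g x)%E -> (forall x, ~ N x -> g x = 0%E) ->
    (\int[mu]_x g x = 0)%E.
  move=> g0 gN; apply/eqP; rewrite eq_le integral_ge0// andbT.
  apply: (@le_trans _ _ (\int[mu]_x (cst +oo \_ N) x)%E).
    apply: ge0_le_integral_nonmeasurable => // x; rewrite patchE.
    by case: ifPn => [_|/negP xN]; rewrite ?leey// gN// => ?; apply: xN; exact/mem_set.
  by rewrite -integral_mkcond integral_cst// N0 mule0.
rewrite integralE !ge0_case ?sube0// => x xN.
  by rewrite funenegE fN// oppe0 maxxx.
by rewrite funeposE fN// maxxx.
Qed.

(** * From oscillation bounds to regularity *)

Section locally_Lpow_theory.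
Context {R : realType} {d : nat}.
Local Notation vec := 'rV[R]_d.
Local Notation leb := (lebesgue_rV (R := R) d).
Local Notation vol := (unit_vol (R := R) (d := d)).
Implicit Types (b : vec -> R).

(** On a ball containing the compact set, [|b| <= 1 + |b|^k]. The passage to the ball uses
    [ge0_le_integral_nonmeasurable], no measurability being assumed of the compact set. *)
Lemma locally_Lpow1 k b : (0 < k)%N -> locally_Lpow k b -> locally_Lpow 1 b.
Proof.
move=> k0 [mb hb]; split => // A cA.
have [M [_ /(_ (M + 1))]] := compact_bounded cA.
rewrite ltrDl ltr01 => /(_ isT) AM.
pose r : R := d%:R * (M + 1) + 1.
have AB : A `<=` eball 0 r.
  move=> x Ax; rewrite /eball/= subr0 /r.
  apply: (@le_lt_trans _ _ (d%:R * (M + 1))); last by rewrite ltrDl.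
  apply: enorm_le_coord => i; apply: le_trans (AM x Ax).
  rewrite /Num.norm/= mx_normrE; apply: le_trans (le_bigmax_cond _ _ (isT : xpredT (ord0, i))).
  by [].
apply: (@le_lt_trans _ _ (\int[leb]_(x in eball 0 r) (`|b x| ^+ 1)%:E)%E).
  rewrite integral_mkcond [leRHS]integral_mkcond.
  apply: ge0_le_integral_nonmeasurable => x; rewrite patchE; first by case: ifPn.
  case: ifPn => [/set_mem/AB xB|_]; first by rewrite patchE mem_set// lexx.
  by rewrite patchE; case: ifPn => //; rewrite lee_fin exprn_ge0.
have mB := measurable_eball (0 : vec) r.
have mbk : measurable_fun setT (fun x => (`|b x| ^+ k)%:E).
  by apply/measurable_EFinP; apply: measurable_funX; exact: measurableT_comp.
apply: (@le_lt_trans _ _ (\int[leb]_(x in eball 0 r) (1%:E + (`|b x| ^+ k)%:E))%E).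
  apply: ge0_le_integral => //.
  - apply/measurable_EFinP/measurable_funTS.
    by apply: measurable_funX; exact: measurableT_comp.
  - by apply: emeasurable_funD => //; exact: measurable_funTS.
  - move=> x _; rewrite -EFinD lee_fin expr1.
    have [b1|b1] := leP `|b x| 1; first by rewrite ler_wpDr// exprn_ge0.
    have b1' := ltW b1.
    by rewrite ler_wpDl// -{1}(prednK k0) exprS ler_peMr// exprn_ege1.
rewrite ge0_integralD//; last exact: measurable_funTS.
have -> : (\int[leb]_(x in eball 0 r) (`|b x| ^+ k)%:E = osc leb b k (eball 0 r) 0)%E.
  by apply: eq_integral => x _; rewrite subr0.
rewrite lte_add_pinfty ?osc_eball_lty// integral_cst// mul1e.
exact: lebesgue_eball_lty.
Qed.

Variables (k : nat) (b : vec -> R).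
Hypotheses (k0 : (0 < k)%N) (bL : locally_Lpow k b).

Let mb : measurable_fun setT b := bL.1.
Let bL1 : locally_Lpow 1 b := locally_Lpow1 k0 bL.

Let mba a (D : set vec) : measurable_fun D (fun x => `|b x - a|%:E).
Proof.
apply/measurable_EFinP/measurable_funTS; apply: measurableT_comp => //.
exact: measurable_funB.
Qed.

Lemma integral_dist_lty c r a : (\int[leb]_(x in eball c r) `|b x - a|%:E < +oo)%E.
Proof.
exact: osc_eball_lty c r a bL1.
Qed.

Lemma locally_integrable c r : leb.-integrable (eball c r) (EFin \o b).
Proof.
apply/integrableP; split; first exact/measurable_EFinP/measurable_funTS.
apply: le_lt_trans (integral_dist_lty c r 0).
by rewrite le_eqVlt; apply/orP; left; apply/eqP; apply: eq_integral => x _; rewrite subr0.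
Qed.

(** A substitute for Holder's inequality: [s^(k-1) u <= s^k + u^k] pointwise, integrated and divided
    by [s^(k-1)]. As [t] may vanish, this is done with [s > t], and [s] then decreases to [t]. *)
Lemma integral_dist_le c r a t : 0 < r -> 0 <= t ->
  (osc leb b k (eball c r) a <= (t ^+ k * (vol * r ^+ d))%:E)%E ->
  (\int[leb]_(x in eball c r) `|b x - a|%:E <= (2 * t * (vol * r ^+ d))%:E)%E.
Proof.
move=> r0 t0 ht.
have m0 : 0 < vol * r ^+ d by rewrite mulr_gt0 ?unit_vol_gt0// exprn_gt0.
have mB := measurable_eball c r.
have pos s : t <= s -> 0 < s ->
    (\int[leb]_(x in eball c r) `|b x - a|%:E <= (2 * s * (vol * r ^+ d))%:E)%E.
  move=> ts s0.
  have {}ht : (osc leb b k (eball c r) a <= (s ^+ k * (vol * r ^+ d))%:E)%E.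
    by apply: (le_trans ht); rewrite lee_fin ler_pM2r// lerXn2r// nnegrE ltW.
  have sk : 0 < s ^+ k.-1 by rewrite exprn_gt0.
  have skE : s ^+ k = s * s ^+ k.-1 by rewrite -exprS prednK.
  have H : ((s ^+ k.-1)%:E * \int[leb]_(x in eball c r) `|b x - a|%:E <=
      (s ^+ k)%:E * leb (eball c r) + osc leb b k (eball c r) a)%E.
    rewrite -ge0_integralZl//; last by rewrite lee_fin ltW.
    have mosc : measurable_fun (eball c r) (fun x => (`|b x - a| ^+ k)%:E).
      apply/measurable_EFinP/measurable_funTS; apply: measurable_funX.
      apply: measurableT_comp => //; exact: measurable_funB.
    rewrite /osc -integral_cst// -ge0_integralD//; last first.
      by move=> x _; rewrite lee_fin exprn_ge0// ltW.
    apply: ge0_le_integral => //.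
    - by move=> x _; rewrite mule_ge0// lee_fin ltW.
    - exact: measurable_funeM.
    - exact: emeasurable_funD.
    - move=> x _; rewrite -EFinM -EFinD lee_fin.
      have [u|u] := leP `|b x - a| s.
        by rewrite ler_wpDr ?exprn_ge0// skE mulrC ler_wpM2r// ltW.
      rewrite ler_wpDl ?exprn_ge0 ?(ltW s0)// -{2}(prednK k0) exprS mulrC.
      by rewrite ler_wpM2l// lerXn2r ?nnegrE ?(ltW s0) ?(ltW u).
  have fI : (\int[leb]_(x in eball c r) `|b x - a|%:E)%E \is a fin_num.
    by rewrite ge0_fin_numE ?integral_dist_lty// integral_ge0.
  move: (le_trans H (leeD2l _ ht)); rewrite lebesgue_eball// -(fineK fI).
  rewrite -!EFinM -EFinD !lee_fin skE; set X := fine _ => h.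
  rewrite -(ler_pM2l sk); apply: (le_trans h).
  by rewrite le_eqVlt; apply/orP; left; apply/eqP; ring.
apply/lee_addgt0Pr => e e0.
pose s := t + e / (2 * (vol * r ^+ d)).
have es : 0 < e / (2 * (vol * r ^+ d)) by rewrite divr_gt0// mulr_gt0.
apply: (le_trans (pos s _ _)); rewrite /s ?lerDl ?(ltW es)//; first by rewrite ltr_wpDl.
rewrite -EFinD lee_fin le_eqVlt; apply/orP; left; apply/eqP.
by field; rewrite !gt_eqF// ?unit_vol_gt0// exprn_gt0.
Qed.

Lemma average_dist c r a t : 0 < r ->
  (\int[leb]_(x in eball c r) `|b x - a|%:E <= (t * (vol * r ^+ d))%:E)%E ->
  `|average b (eball c r) - a| <= t.
Proof.
move=> r0 ht.
have m0 : 0 < vol * r ^+ d by rewrite mulr_gt0 ?unit_vol_gt0// exprn_gt0.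
have mB := measurable_eball c r.
have ia : leb.-integrable (eball c r) (EFin \o (fun=> a)).
  apply/integrableP; split; first exact: measurable_cst.
  rewrite -[X in (X < _)%E]/(\int[leb]_(x in eball c r) (cst `|a|%:E) x)%E integral_cst//.
  by rewrite lte_mul_pinfty// lebesgue_eball_lty.
have iba : leb.-integrable (eball c r) (EFin \o (fun x => b x - a)).
  have := integrableB mB (locally_integrable c r) ia.
  by apply: eq_integrable => // x _ /=; rewrite EFinB.
have fl : fine (leb (eball c r)) = vol * r ^+ d by rewrite lebesgue_eball.
have -> : average b (eball c r) - a =
    (vol * r ^+ d)^-1 * \int[leb]_(x in eball c r) (b x - a).
  rewrite /average fl RintegralB//; last exact: locally_integrable.
  rewrite (_ : \int[leb]_(x in eball c r) a = a * (vol * r ^+ d)); last first.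
    by rewrite Rintegral_cst// fl.
  by rewrite mulrBr; congr (_ - _); field; rewrite !gt_eqF// ?unit_vol_gt0// exprn_gt0.
rewrite normrM gtr0_norm ?invr_gt0// ler_pdivrMl// mulrC.
apply: (le_trans (le_normr_Rintegral mB iba)).
rewrite -lee_fin fineK//.
by rewrite ge0_fin_numE ?integral_dist_lty// integral_ge0.
Qed.

Lemma average_osc c r a t : 0 < r -> 0 <= t ->
  (osc leb b k (eball c r) a <= (t ^+ k * (vol * r ^+ d))%:E)%E ->
  (\int[leb]_(x in eball c r) `|b x - average b (eball c r)|%:E <=
    (4 * t * (vol * r ^+ d))%:E)%E.
Proof.
move=> r0 t0 ht; have h1 := integral_dist_le r0 t0 ht.
have h2 := average_dist r0 h1.
have mB := measurable_eball c r.
apply: (@le_trans _ _ (\int[leb]_(x in eball c r) (`|b x - a|%:E + (2 * t)%:E))%E).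
  apply: ge0_le_integral => //.
  - by apply: emeasurable_funD.
  - move=> x _; rewrite -EFinD lee_fin.
    have -> : b x - average b (eball c r) = (b x - a) - (average b (eball c r) - a) by ring.
    by rewrite (le_trans (ler_normB _ _))// lerD2l.
rewrite ge0_integralD//; last by move=> x _; rewrite lee_fin mulr_ge0.
rewrite [X in (_ + X <= _)%E](_ : _ = (2 * t)%:E * (vol * r ^+ d)%:E)%E; last first.
  by rewrite -(lebesgue_eball c r0) integral_cst.
rewrite -EFinM; apply: (le_trans (leeD2r _ h1)); rewrite -EFinD lee_fin le_eqVlt.
by apply/orP; left; apply/eqP; ring.
Qed.

Lemma BMO_of_osc N : 0 <= N ->
  (forall c r, 0 < r -> exists a,
    (osc leb b k (eball c r) a <= (N * (vol * r ^+ d))%:E)%E) ->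
  BMO b /\ (BMO_norm b ^+ k <= (4 ^+ k * N)%:E)%E.
Proof.
move=> N0 hN; pose t := N `^ k%:R^-1.
have t0 : 0 <= t by exact: powR_ge0.
have tk : t ^+ k = N.
  by rewrite -powR_mulrn// -powRrM mulVf ?powRr1// pnatr_eq0 gtn_eqF.
have bnd : (BMO_norm b <= (4 * t)%:E)%E.
  apply: ge_ereal_sup => _ [c [r [r0 ->]]].
  have [a ha] := hN c r r0; rewrite -tk in ha.
  have m0 : 0 < vol * r ^+ d by rewrite mulr_gt0 ?unit_vol_gt0// exprn_gt0.
  rewrite lebesgue_eball//=.
  apply: (@le_trans _ _ ((vol * r ^+ d)^-1%:E * (4 * t * (vol * r ^+ d))%:E)%E).
    rewrite lee_wpmul2l ?lee_fin ?invr_ge0 ?(ltW m0)//.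
    exact: (average_osc r0 t0 ha).
  by rewrite -EFinM lee_fin mulrCA mulVf ?mulr1// gt_eqF.
have nn : (0 <= BMO_norm b)%E.
  apply: le_ereal_sup_tmp; eexists.
    by exists 0, 1; split; [exact: ltr01|reflexivity].
  apply: mule_ge0; first by rewrite lee_fin invr_ge0 fine_ge0.
  by apply: integral_ge0 => x _; rewrite lee_fin.
have fB : BMO_norm b \is a fin_num by rewrite ge0_fin_numE// (le_lt_trans bnd)// ltry.
split; first by split => //; rewrite (le_lt_trans bnd)// ltry.
move: bnd nn; rewrite -(fineK fB) lee_fin => bnd nn.
rewrite -EFin_expe lee_fin -tk -exprMn lerXn2r ?nnegrE ?mulr_ge0//.
Qed.

End locally_Lpow_theory.

Section enorm_continuity.
Context {R : realType} {d : nat}.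
Local Notation vec := 'rV[R]_d.

(** The set [f < t] is open, hence the countable union of the dyadic cubes that it contains. *)
Lemma measurable_enorm_continuous (f : vec -> R) :
  (forall x e, 0 < e -> exists2 r, 0 < r & forall y, enorm (y - x) <= r -> `|f y - f x| < e) ->
  measurable_fun setT f.
Proof.
move=> cf; apply: (measurability (@RGenCInfty.G R)).
  exact: RGenCInfty.measurableE.
move=> _ [_ [t ->] <-]; rewrite setTI -[X in measurable X]setCK.
apply: measurableC; set U := ~` _.
have UE x : U x <-> f x < t.
  rewrite /U/= in_itv/= andbT ltNge; split => [/negP//|/negP].
  by [].
pose q n (x : vec) : nat := pickle (dyadic_index n x).
pose J n := [set j | q n @^-1` [set j] `<=` U].
have -> : U = \bigcup_n \bigcup_(j in J n) q n @^-1` [set j].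
  apply/seteqP; split => [x /UE fx|x [n _ [j Jj /Jj]]//].
  have [r r0 hr] := cf x (t - f x) ltac:(by rewrite subr_gt0).
  pose n := Num.bound (d%:R / r).
  have nr : d%:R * 2 ^- n <= r.
    rewrite ler_pdivrMr ?exprn_gt0// -ler_pdivrMl// mulrC.
    apply: (@le_trans _ _ n%:R); first by rewrite ltW// archi_boundP// divr_ge0// ltW.
    by rewrite -natrX ler_nat ltnW// ltn_expl.
  exists n => //; exists (q n x) => // y /= /(pcan_inj pickleK) yx.
  apply/UE; have : enorm (y - x) <= r.
    apply: le_trans nr; apply: enorm_le_coord => i; rewrite !mxE.
    exact: dyadic_index_coord.
  by move=> /hr; rewrite ltr_norml; lra.
apply: bigcup_measurable => n _; apply: bigcup_measurable => j _.
exact: measurable_dyadic_fiber.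
Qed.

End enorm_continuity.

(** * Campanato's argument *)

Section campanato.
Context {R : realType} {d : nat}.
Local Notation vec := 'rV[R]_d.
Local Notation leb := (lebesgue_rV (R := R) d).
Local Notation vol := (unit_vol (R := R) (d := d)).
Variables (k : nat) (b : vec -> R) (alpha M : R).
Hypotheses (k0 : (0 < k)%N) (bL : locally_Lpow k b) (alpha0 : 0 < alpha) (M0 : 0 <= M).
Hypothesis hosc : forall c r, 0 < r -> exists a,
  (osc leb b k (eball c r) a <= ((M * r `^ alpha) ^+ k * (vol * r ^+ d))%:E)%E.

Let A c r := average b (eball c r).
Let pa0 r : 0 <= r `^ alpha := powR_ge0 r alpha.

Let mdist a (D : set vec) : measurable_fun D (fun x => `|b x - a|%:E).
Proof.
apply/measurable_EFinP/measurable_funTS; apply: measurableT_comp => //.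
by apply: measurable_funB => //; exact: bL.1.
Qed.

Let avg_osc c r : 0 < r ->
  (\int[leb]_(x in eball c r) `|b x - A c r|%:E <= (4 * (M * r `^ alpha) * (vol * r ^+ d))%:E)%E.
Proof.
move=> r0; have [a ha] := hosc c r0.
by apply: (average_osc k0 bL r0 _ ha); rewrite mulr_ge0.
Qed.

Let G : R := 4 * 2 ^+ d * M.
Let G0 : 0 <= G. Proof. by rewrite !mulr_ge0// exprn_ge0. Qed.

(** The larger ball has at most [2^d] times the volume of the smaller one, whence the factor [2^d]
    in [G]. *)
Let avg_sub c c' r r' : 0 < r' -> r <= 2 * r' -> eball c' r' `<=` eball c r ->
  0 < r -> `|A c' r' - A c r| <= G * r `^ alpha.
Proof.
move=> r'0 r2 sub r0; apply: (average_dist k0 bL r'0).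
apply: (@le_trans _ _ (\int[leb]_(x in eball c r) `|b x - A c r|%:E)%E).
  by apply: ge0_subset_integral => //; exact: measurable_eball.
apply: (le_trans (avg_osc c r0)); rewrite lee_fin.
have vol0 : 0 < vol := unit_vol_gt0.
have rr : r ^+ d <= 2 ^+ d * r' ^+ d.
  by rewrite -exprMn lerXn2r ?nnegrE ?(ltW r0)// mulr_ge0// ltW.
have -> : G * r `^ alpha * (vol * r' ^+ d) =
    4 * (M * r `^ alpha) * (vol * (2 ^+ d * r' ^+ d)) by rewrite /G; ring.
by rewrite ler_wpM2l ?mulr_ge0// ler_wpM2l// ltW.
Qed.

Let rho : R := 2 `^ (- alpha).
Let rho1 : rho < 1.
Proof.
rewrite /rho powRN invf_lt1 ?powR_gt0//.
have : (1 : R) `^ alpha < 2 `^ alpha by rewrite gt0_ltr_powR ?nnegrE// ltr1n.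
by rewrite powR1.
Qed.

(** The sum of the geometric series met when radii are halved; the induction in [avg_chain] closes
    because [C1 * rho + G = C1]. *)
Let C1 : R := G / (1 - rho).
Let C10 : 0 <= C1. Proof. by rewrite divr_ge0// subr_ge0 ltW. Qed.

Let GC1 : G <= C1.
Proof.
have rho0 : 0 < rho by exact: powR_gt0.
by rewrite /C1 ler_pdivlMr ?subr_gt0// ler_piMr//; lra.
Qed.

Let half_powR r : 0 < r -> (r / 2) `^ alpha = rho * r `^ alpha.
Proof.
move=> r0; rewrite powRM ?invr_ge0 ?(ltW r0)// mulrC; congr (_ * _).
by rewrite /rho -(powR_inv1 (ler0n R 2)) -powRrM mulN1r.
Qed.

Let avg_chain n x r r' : 0 < r -> r / 2 ^+ n.+1 <= r' -> r' <= r ->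
  `|A x r' - A x r| <= C1 * r `^ alpha.
Proof.
have base s s' : 0 < s -> s / 2 <= s' -> s' <= s -> `|A x s' - A x s| <= G * s `^ alpha.
  move=> s0 h1 h2; apply: avg_sub => //; [by lra|by lra|].
  by apply: sub_eball; rewrite subrr enorm0 add0r.
elim: n r => [|n ih] r r0 h1 h2.
  by apply: (le_trans (base _ _ r0 _ h2)); rewrite ?ler_wpM2r.
have [h3|h3] := leP (r / 2) r'.
  by apply: (le_trans (base _ _ r0 h3 h2)); rewrite ler_wpM2r.
have r20 : 0 < r / 2 by rewrite divr_gt0.
have h4 : r / 2 / 2 ^+ n.+1 <= r'.
  by apply: le_trans h1; rewrite -mulrA -invfM -exprS.
have H1 := ih _ r20 h4 (ltW h3).
have H2 : `|A x (r / 2) - A x r| <= G * r `^ alpha by apply: base => //; lra.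
have -> : A x r' - A x r = (A x r' - A x (r / 2)) + (A x (r / 2) - A x r) by ring.
apply: (le_trans (ler_normD _ _)); apply: (le_trans (lerD H1 H2)).
rewrite half_powR// mulrA -mulrDl ler_wpM2r//.
rewrite le_eqVlt /C1; apply/orP; left; apply/eqP; field.
by rewrite gt_eqF// subr_gt0.
Qed.

Let avg_dist x r r' : 0 < r -> 0 < r' -> r' <= r -> `|A x r' - A x r| <= C1 * r `^ alpha.
Proof.
move=> r0 r'0 rr; pose n := Num.bound (r / r').
apply: (avg_chain (n := n)) => //; rewrite ler_pdivrMr ?exprn_gt0// -ler_pdivrMl// mulrC.
apply: (@le_trans _ _ n%:R); first by rewrite ltW// archi_boundP// divr_ge0// ltW.
rewrite -natrX ler_nat (leq_trans (ltnW (ltn_expl n (isT : (1 < 2)%N))))//.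
by rewrite leq_exp2l.
Qed.

Let lower x : set R := [set A x r - C1 * r `^ alpha | r in [set r | 0 < r]].

(* The intervals [A x r -/+ C1 * r `^ alpha] pairwise meet, so they all contain the supremum of
   their lower ends. *)
Definition holder_rep (x : vec) : R := sup (lower x).
Local Notation b' := holder_rep.

Let lower_ub x r : 0 < r -> ubound (lower x) (A x r + C1 * r `^ alpha).
Proof.
move=> r0 _ [s /= s0 <-].
have hr : 0 <= C1 * r `^ alpha by rewrite mulr_ge0.
have hs : 0 <= C1 * s `^ alpha by rewrite mulr_ge0.
have [rs|sr] := leP r s.
  by have := avg_dist x s0 r0 rs; rewrite ler_norml; lra.
by have := avg_dist x r0 s0 (ltW sr); rewrite ler_norml; lra.
Qed.

Let rep_dist x r : 0 < r -> `|A x r - b' x| <= C1 * r `^ alpha.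
Proof.
move=> r0; rewrite ler_distlC; apply/andP; split.
  apply: ub_le_sup; first by exists (A x r + C1 * r `^ alpha); exact: lower_ub.
  by exists r.
apply: ge_sup; last exact: lower_ub.
by exists (A x r - C1 * r `^ alpha), r.
Qed.

(** Times [M] this is [C1 (1 + 2^alpha) + G 2^alpha], the cost of going from [b' x] to [b' y]
    through the averages over [eball x r] and [eball y (2 * r)] with [r = enorm (x - y)]. It depends
    on [d] and [alpha] only. *)
Definition holder_const : R :=
  4 * 2 ^+ d * ((1 - 2 `^ (- alpha))^-1 * (1 + 2 `^ alpha) + 2 `^ alpha).

Lemma holder_const_ge0 : 0 <= holder_const.
Proof.
rewrite /holder_const !mulr_ge0 ?exprn_ge0// addr_ge0 ?powR_ge0//.
by rewrite mulr_ge0 ?invr_ge0 ?subr_ge0 ?(ltW rho1)// addr_ge0// powR_ge0.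
Qed.

Lemma holder_rep_dist x y : `|b' x - b' y| <= M * holder_const * enorm (x - y) `^ alpha.
Proof.
have [->|xy] := eqVneq x y.
  by rewrite !subrr normr0 mulr_ge0// mulr_ge0// holder_const_ge0.
have r0 : 0 < enorm (x - y) by rewrite enorm_gt0 subr_eq0.
set r := enorm (x - y) in r0 *.
have r20 : 0 < 2 * r by rewrite mulr_gt0.
have H1 := rep_dist x r0; have H2 := rep_dist y r20.
have H3 : `|A x r - A y (2 * r)| <= G * (2 * r) `^ alpha.
  apply: (avg_sub r0 (lexx _) _ r20); apply: sub_eball.
  by rewrite -/r mulr_natl mulr2n.
rewrite (_ : b' x - b' y = - (A x r - b' x) + (A x r - A y (2 * r)) + (A y (2 * r) - b' y)); last first.
  by move: (b' x) (A x r) (A y _) (b' y) => p1 p2 p3 p4; ring.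
apply: (le_trans (ler_normD _ _)); apply: (le_trans (lerD (ler_normD _ _) (lexx _))).
rewrite normrN; apply: (le_trans (lerD (lerD H1 H3) H2)).
rewrite powRM ?(ltW r0)// /holder_const /C1 /G -/rho le_eqVlt; apply/orP; left; apply/eqP.
by field; rewrite gt_eqF// subr_gt0.
Qed.

Lemma measurable_holder_rep : measurable_fun setT b'.
Proof.
apply: measurable_enorm_continuous => x e e0.
pose H := M * holder_const + 1.
have H0 : 0 < H by rewrite ltr_wpDl// mulr_ge0// holder_const_ge0.
exists ((e / H) `^ alpha^-1); first by rewrite powR_gt0// divr_gt0.
move=> y yx; apply: (le_lt_trans (holder_rep_dist y x)).
apply: (@le_lt_trans _ _ (M * holder_const * (e / H))).
  rewrite ler_wpM2l ?(mulr_ge0 M0 holder_const_ge0)//.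
  apply: (@le_trans _ _ (((e / H) `^ alpha^-1) `^ alpha)).
    by rewrite ge0_ler_powR ?nnegrE ?enorm_ge0 ?powR_ge0// ltW.
  by rewrite -powRrM mulVf ?gt_eqF// powRr1// divr_ge0// ltW.
by rewrite mulrCA gtr_pMr// ltr_pdivrMr// mul1r /H ltrDl.
Qed.

Let E x : R := `|b x - b' x|.
Let mE : measurable_fun setT E.
Proof.
apply: measurableT_comp => //; apply: measurable_funB; first exact: bL.1.
exact: measurable_holder_rep.
Qed.

Let C2 : R := 4 * M + C1 + M * holder_const.
Let C20 : 0 <= C2.
Proof. by rewrite /C2 !addr_ge0// mulr_ge0// holder_const_ge0. Qed.

(** On this ball both [b], in the mean, and its candidate [b'], pointwise, are within a multiple of
    [h^alpha] of the same average. *)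
Let E_ball z h : 0 < h ->
  (\int[leb]_(x in eball z h) (E x)%:E <= (C2 * h `^ alpha * (vol * h ^+ d))%:E)%E.
Proof.
move=> h0; have mB := measurable_eball z h.
pose c : R := (C1 + M * holder_const) * h `^ alpha.
have c0 : 0 <= c by rewrite mulr_ge0// addr_ge0// mulr_ge0// holder_const_ge0.
apply: (@le_trans _ _ (\int[leb]_(x in eball z h) (`|b x - A z h|%:E + c%:E))%E).
  apply: ge0_le_integral => //.
  - by move=> x _; rewrite lee_fin normr_ge0.
  - by apply/measurable_EFinP/measurable_funTS.
  - by apply: emeasurable_funD.
  - move=> x; rewrite /eball/= => xz; rewrite -EFinD lee_fin /E.
    rewrite (_ : b x - b' x = (b x - A z h) + ((A z h - b' z) - (b' x - b' z))); last first.
      by move: (b x) (b' x) (A z h) (b' z) => p1 p2 p3 p4; ring.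
    apply: (le_trans (ler_normD _ _)); rewrite lerD2l.
    apply: (le_trans (ler_normB _ _)); rewrite /c mulrDl; apply: lerD; first exact: rep_dist.
    apply: (le_trans (holder_rep_dist _ _)).
    rewrite ler_wpM2l ?(mulr_ge0 M0 holder_const_ge0)//.
    by rewrite ge0_ler_powR ?nnegrE ?enorm_ge0// ?(ltW alpha0)// ?(ltW xz)// ltW.
rewrite ge0_integralD//.
rewrite [X in (_ + X <= _)%E](_ : _ = c%:E * (vol * h ^+ d)%:E)%E; last first.
  by rewrite -(lebesgue_eball z h0) integral_cst.
rewrite -EFinM; apply: (le_trans (leeD2r _ (avg_osc z h0))).
rewrite -EFinD lee_fin le_eqVlt; apply/orP; left; apply/eqP.
by rewrite /c /C2; ring.
Qed.


(* Fubini for [E x * (|x - z| < h)] on [eball 0 n%:R], with the inner integral over [x] bounded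
   by [E_ball]. *)
Let E_small n h : 0 < h -> h <= 1 ->
  (\int[leb]_(x in eball 0 n%:R) (E x)%:E <=
   (C2 * h `^ alpha * fine (leb (eball 0 (n%:R + 1))))%:E)%E.
Proof.
move=> h0 h1; set D := eball 0 n%:R; set D1 := eball 0 (n%:R + 1).
have mD : measurable D := measurable_eball _ _.
have mD1 : measurable D1 := measurable_eball _ _.
pose S := [set z : vec * vec | enorm (z.1 - z.2) < h].
have mS : measurable S.
  rewrite (_ : S = (fun z : vec * vec => enorm (z.1 - z.2)) @^-1` `]-oo, h[%classic).
    apply: measurable_fun_preimage => //.
    exact: (measurableT_comp measurable_enorm measurable_fun_rV_sub).
  by apply/seteqP; split => z /=; rewrite in_itv.
have m0 : 0 < vol * h ^+ d by rewrite mulr_gt0 ?unit_vol_gt0// exprn_gt0.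
pose f (z : vec * vec) : R := (E z.1 * \1_D z.1) * \1_S z.
have E0 x : 0 <= E x by exact: normr_ge0.
have f0 z : 0 <= f z by rewrite !mulr_ge0.
have mED : measurable_fun setT (fun x => E x * \1_D x : R).
  by apply: measurable_funM => //; exact: measurable_indic.
have mf : measurable_fun setT f.
  apply: measurable_funM; last exact: measurable_indic.
  exact: (measurableT_comp mED measurable_fst).
have mfE : measurable_fun setT (fun z => (f z)%:E) by exact/measurable_EFinP.
have EDE : (\int[leb]_(x in D) (E x)%:E = \int[leb]_x (E x * \1_D x)%:E)%E.
  rewrite integral_mkcond; apply: eq_integral => x _.
  by rewrite patchE indicE; case: ifPn => _; rewrite ?mulr1 ?mulr0.
have I1 : (\int[leb \x leb]_z (f z)%:E =
    (vol * h ^+ d)%:E * \int[leb]_(x in D) (E x)%:E)%E.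
  rewrite (fubini_tonelli1 (fun z => (f z)%:E))//.
  rewrite EDE -ge0_integralZl//; last 3 first.
  - exact/measurable_EFinP.
  - by move=> x _; rewrite lee_fin mulr_ge0.
  - by rewrite lee_fin ltW.
  apply: eq_integral => x _; rewrite /fubini_F /f/=.
  under eq_integral do rewrite EFinM.
  have mSx : measurable_fun setT (fun y => (\1_S (x, y) : R)%:E).
    apply/measurable_EFinP.
    exact: (measurable_fun_pair2 x (measurable_indic mS)).
  rewrite ge0_integralZl//; last by rewrite lee_fin mulr_ge0.
  rewrite muleC; congr (_ * _)%E.
  rewrite -(lebesgue_eball x h0) -[RHS]mul1e -(integral_cst leb (measurable_eball x h)).
  rewrite [RHS]integral_mkcond; apply: eq_integral => y _.
  rewrite patchE indicE (_ : ((x, y) \in S) = (y \in eball x h)); last first.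
    by apply/idP/idP => /set_mem h2; apply/mem_set; move: h2; rewrite /S /eball/= enormB.
  by case: ifPn.
have I2 : (\int[leb \x leb]_z (f z)%:E <=
    (C2 * h `^ alpha * (vol * h ^+ d))%:E * leb D1)%E.
  rewrite (fubini_tonelli2 (fun z => (f z)%:E))//.
  have cc0 : 0 <= C2 * h `^ alpha * (vol * h ^+ d).
    by apply: mulr_ge0 (ltW m0); exact: mulr_ge0 C20 (pa0 h).
  rewrite -integral_cst// [leRHS]integral_mkcond; apply: ge0_le_integral => //.
  - by move=> y _; apply: integral_ge0 => x _; rewrite lee_fin f0.
  - by apply: measurable_fun_fubini_tonelli_G => // z; rewrite lee_fin f0.
  - by apply/measurable_restrict => //; exact: measurable_cst.
  move=> z _; rewrite /fubini_G patchE.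
  case: ifPn => [zD|/negP zD].
    apply: le_trans (E_ball z h0); rewrite [leRHS]integral_mkcond.
    apply: ge0_le_integral => //.
    - by move=> x _; rewrite lee_fin f0.
    - apply/measurable_EFinP; exact: (measurable_fun_pair1 z mf).
    - apply/measurable_restrict => //; first exact: measurable_eball.
      by apply: measurable_funTS; exact/measurable_EFinP.
    move=> x _; rewrite patchE /f/= !indicE.
    rewrite (_ : ((x, z) \in S) = (x \in eball z h)); last first.
      by apply/idP/idP => /set_mem h2; apply/mem_set.
    case: ifPn => _; rewrite ?mulr0// mulr1 lee_fin ler_piMr//.
    by case: (x \in D).
  rewrite integral0_eq// => x _; rewrite /f/= !indicE.
  have [xD|_] := boolP (x \in D); last by rewrite mulr0 mul0r.
  rewrite (_ : ((x, z) \in S) = false) ?mulr0//; apply/negP => /set_mem; rewrite /S/= => xz.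
  apply: zD; apply/mem_set; move: (set_mem xD); rewrite /D1 /D /eball/= !subr0 => xn.
  have := ler_enormB x (x - z); rewrite opprB addrC subrK => hz.
  by apply: (le_lt_trans hz); rewrite ltrD// (lt_le_trans xz).
have fI : (\int[leb]_(x in D) (E x)%:E)%E \is a fin_num.
  rewrite ge0_fin_numE ?integral_ge0//; last by move=> x _; rewrite lee_fin.
  rewrite ltNge leye_eq; apply/negP => /eqP Eoo.
  move: I2; rewrite I1 Eoo gt0_muley ?lte_fin// leye_eq => /eqP.
  have fD1 : leb D1 \is a fin_num by rewrite ge0_fin_numE// lebesgue_eball_lty.
  by rewrite -(fineK fD1) -EFinM.
move: I2; rewrite I1.
have fD1 : leb D1 \is a fin_num by rewrite ge0_fin_numE// lebesgue_eball_lty.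
rewrite -(fineK fI) -(fineK fD1) -!EFinM !lee_fin => I2.
rewrite -(ler_pM2l m0); apply: (le_trans I2).
by rewrite le_eqVlt; apply/orP; left; apply/eqP; rewrite /D1; ring.
Qed.

(** The left side of [E_small] does not involve [h], and its right side tends to zero with [h]. *)
Lemma holder_rep_ae : {ae leb, forall x, b' x = b x}.
Proof.
have E0 x : 0 <= E x by exact: normr_ge0.
have int0 n : (\int[leb]_(x in eball 0 n%:R) `|(E x)%:E| = 0)%E.
  have -> : (\int[leb]_(x in eball 0 n%:R) `|(E x)%:E| =
             \int[leb]_(x in eball 0 n%:R) (E x)%:E)%E.
    by apply: eq_integral => x _; rewrite gee0_abs// lee_fin.
  apply/eqP; rewrite eq_le; apply/andP; split; last first.
    by apply: integral_ge0 => x _; rewrite lee_fin.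
  apply/lee_addgt0Pr => e e0; rewrite add0e.
  set V := fine (leb (eball (0 : vec) (n%:R + 1))).
  have V0 : 0 <= V by rewrite fine_ge0.
  have W0 : 0 < C2 * V + 1 by rewrite ltr_wpDl// mulr_ge0.
  pose h := Num.min 1 ((e / (C2 * V + 1)) `^ alpha^-1).
  have eW : 0 < e / (C2 * V + 1) by rewrite divr_gt0.
  have h0 : 0 < h by rewrite lt_min ltr01 powR_gt0.
  have h1 : h <= 1 by rewrite ge_min lexx.
  apply: (le_trans (E_small n h0 h1)); rewrite -/V lee_fin.
  have ha : h `^ alpha <= e / (C2 * V + 1).
    apply: (@le_trans _ _ (((e / (C2 * V + 1)) `^ alpha^-1) `^ alpha)).
      by rewrite ge0_ler_powR ?nnegrE ?powR_ge0 ?(ltW h0) ?(ltW alpha0)// /h ge_min lexx orbT.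
    by rewrite -powRrM mulVf ?gt_eqF// powRr1// ltW.
  rewrite mulrAC; apply: (le_trans (ler_wpM2l (mulr_ge0 C20 V0) ha)).
  rewrite mulrCA ger_pMr// ler_pdivrMr// mul1r; lra.
have aen n : {ae leb, forall x, eball 0 n%:R x -> b' x = b x}.
  have mB : measurable (eball (0 : vec) n%:R) := measurable_eball _ _.
  have mEn : measurable_fun (eball 0 n%:R) (fun x => (E x)%:E).
    by apply/measurable_funTS/measurable_EFinP.
  have := (ae_eq_integral_abs leb mB mEn).1 (int0 n).
  apply: filterS => x hx Bx; have := hx Bx; rewrite /E/= => -[/eqP].
  by rewrite normr_eq0 subr_eq0 => /eqP.
have := @ae_foralln _ _ _ leb _ aen.
apply: filterS => x hx; apply: (hx (Num.bound (enorm x))).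
by rewrite /eball/= subr0 archi_boundP// enorm_ge0.
Qed.

End campanato.

(** * Holder seminorms, exponents above one, and the conclusion *)

Section holder_consequences.
Context {R : realType} {d : nat}.
Local Notation vec := 'rV[R]_d.
Local Notation leb := (lebesgue_rV (R := R) d).
Implicit Types (f b : vec -> R).

Lemma Holder_norm_bound f (alpha H : R) k : (0 < d)%N -> 0 <= H ->
  (forall x y, `|f x - f y| <= H * enorm (x - y) `^ alpha) ->
  Holder alpha f /\ (Holder_norm alpha f ^+ k <= (H ^+ k)%:E)%E.
Proof.
move=> d0 H0 hf.
have bnd : (Holder_norm alpha f <= H%:E)%E.
  apply: ge_ereal_sup => _ [[x y] /= xy <-].
  have xy0 : 0 < enorm (x - y) by rewrite enorm_gt0 subr_eq0; exact/eqP.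
  by rewrite lee_fin ler_pdivrMr ?powR_gt0.
have nn : (0 <= Holder_norm alpha f)%E.
  (* The supremum is nonnegative as soon as there are two distinct points; [0 < d] separates the
     all-ones vector from zero. *)
  pose u : vec := const_mx 1.
  apply: (@le_trans _ _ (`|f u - f 0| / enorm (u - 0) `^ alpha)%:E).
    by rewrite lee_fin divr_ge0// powR_ge0.
  apply: ereal_sup_ubound; exists (u, 0) => //= u0.
  have := congr1 (fun v : vec => v ord0 (Ordinal d0)) u0; rewrite !mxE => /eqP.
  by rewrite oner_eq0.
have fB : Holder_norm alpha f \is a fin_num by rewrite ge0_fin_numE// (le_lt_trans bnd)// ltry.
split; first by rewrite /Holder (le_lt_trans bnd)// ltry.
move: bnd nn; rewrite -(fineK fB) lee_fin => bnd nn.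
by rewrite -EFin_expe lee_fin lerXn2r ?nnegrE.
Qed.

(** Passing through the midpoint improves the constant by the factor [rho = 2^(1 - alpha) < 1], and
    iteration drives it to zero. *)
Lemma holder_gt1_constant f (alpha H : R) : 1 < alpha -> 0 <= H ->
  (forall x y, `|f x - f y| <= H * enorm (x - y) `^ alpha) -> forall x y, f x = f y.
Proof.
move=> alpha1 H0 hf x y; pose rho : R := 2 * 2^-1 `^ alpha.
have rho0 : 0 <= rho by rewrite mulr_ge0// powR_ge0.
have rho1 : rho < 1.
  have h : 2^-1 `^ alpha < 2^-1 `^ 1 :> R.
    have : (2 : R) `^ 1 < 2 `^ alpha.
      rewrite !/powR pnatr_eq0/= ltr_expR ltr_pM2r// ln_gt0//.
      by rewrite ltr1n.
    rewrite -(powR_inv1 (ler0n R 2)) -!powRrM !mulN1r !powRN ltf_pV2 ?posrE ?powR_gt0//.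
  rewrite powRr1 ?invr_ge0// in h.
  by rewrite /rho mulrC -ltr_pdivlMr// mul1r.
have iter n : forall x y, `|f x - f y| <= H * rho ^+ n * enorm (x - y) `^ alpha.
  elim: n => [|n ih] {}x {}y; first by rewrite expr0 mulr1.
  pose m : vec := 2^-1 *: (x + y).
  have xm : x - m = 2^-1 *: (x - y) by apply/rowP => i; rewrite !mxE; field.
  have my : m - y = 2^-1 *: (x - y) by apply/rowP => i; rewrite !mxE; field.
  rewrite (_ : f x - f y = (f x - f m) + (f m - f y)); last by ring.
  apply: (le_trans (ler_normD _ _)); apply: (le_trans (lerD (ih x m) (ih m y))).
  rewrite xm my enormZ gtr0_norm// powRM// ?enorm_ge0// /rho exprS.
  by rewrite le_eqVlt; apply/orP; left; apply/eqP; ring.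
apply/eqP; rewrite -subr_eq0 -normr_le0; apply/ler_addgt0Pr => e e0; rewrite add0r.
have : geometric (H * enorm (x - y) `^ alpha) rho @ \oo --> 0.
  by apply: cvg_geometric; rewrite ger0_norm.
move/cvgrPdist_lt => /(_ e e0) [n _ /(_ n (leqnn n))] /=.
rewrite sub0r normrN => /ltW hn; apply: (le_trans (iter n x y)); apply: le_trans hn.
by rewrite mulrAC ler_norm.
Qed.

Lemma commutator_form_ae_constant k b (c : R) (K : vec -> vec -> R[i]) (f g : vec -> R[i]) :
  (0 < k)%N -> {ae leb, forall x, b x = c} -> commutator_form k b K f g = 0.
Proof.
move=> k0 [N [mN N0 bN]].
pose N2 := (N `*` setT) `|` (setT `*` N) : set (vec * vec).
have mN2 : measurable N2 by apply: measurableU; exact: measurableX.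
have N20 : (leb \x leb)%E N2 = 0%E.
  apply/eqP; rewrite eq_le measure_ge0 andbT.
  apply: (le_trans (measureU2 _ _ _)); [exact: measurableX|exact: measurableX|].
  have E1 := product_measure1E leb leb mN (@measurableT _ vec).
  have E2 := product_measure1E leb leb (@measurableT _ vec) mN.
  apply: (@le_trans _ _ (leb N * leb setT + leb setT * leb N)%E).
    by apply: leeD; rewrite le_eqVlt; apply/orP; left; apply/eqP; [exact: E1|exact: E2].
  by rewrite N0 mul0e mule0 adde0.
have F0 (z : vec * vec) : ~ N2 z ->
    ((b z.1 - b z.2) ^+ k)%:C%C * K z.1 z.2 * f z.2 * g z.1 = 0.
  move=> /not_orP[n1 n2].
  have b1 : b z.1 = c by apply: contrapT => h; apply: n1; split => //; exact: bN.
  have b2 : b z.2 = c by apply: contrapT => h; apply: n2; split => //; exact: bN.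
  by rewrite b1 b2 subrr expr0n gtn_eqF//= !mul0r.
rewrite /commutator_form /integralC.
have I0 (p : R[i] -> R) : p 0 = 0 -> \int[(leb \x leb)%E]_z
    p (((b z.1 - b z.2) ^+ k)%:C%C * K z.1 z.2 * f z.2 * g z.1) = 0.
  move=> p0; rewrite /Rintegral (integral_null_support mN2)//.
  by move=> z Nz; rewrite F0// p0.
by rewrite !I0.
Qed.

End holder_consequences.

Theorem theorem4p2p1 (R : realType) (d : nat) (hd : (0 < d)%N)
    (K : 'rV[R]_d -> 'rV[R]_d -> R[i]) (hK : nondegenerate_CZ_kernel K)
    (k : nat) (hk : (0 < k)%N) (p q : R) (hp : 1 < p) (hpq : p <= q)
    (kappa : R) (hkappa : 0 < kappa) :
  let alpha : R := d%:R / k%:R * (p^-1 - q^-1) in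
  0 <= alpha /\ (alpha = 0 <-> p = q) /\
  exists C : R, forall (b : 'rV[R]_d -> R) (Theta : R),
    locally_Lpow k b -> 0 <= Theta ->
    (forall (c c' : 'rV[R]_d) (r : R) (f g : 'rV[R]_d -> R[i]),
      0 < r ->
      kappa * r <= set_dist (eball c r) (eball c' r) ->
      Linfty_on (eball c r) f -> Linfty_on (eball c' r) g ->
      ((normc (commutator_form k b K f g))%:E <=
       Theta%:E *
       (Linfty_norm f * (lebesgue_rV d (eball c r)) `^ p^-1) *
       (Linfty_norm g * (lebesgue_rV d (eball c' r)) `^ (q / (q - 1))^-1))%E) ->
    [/\ alpha = 0 -> BMO b /\ (BMO_norm b ^+ k <= (C * Theta)%:E)%E,
        0 < alpha <= 1 ->
          exists b' : 'rV[R]_d -> R,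
            [/\ {ae lebesgue_rV d, forall x, b' x = b x},
                Holder alpha b' &
                (Holder_norm alpha b' ^+ k <= (C * Theta)%:E)%E] &
        1 < alpha ->
          (exists c : R, {ae lebesgue_rV d, forall x, b x = c}) /\
          (forall f g : 'rV[R]_d -> R[i],
            measurable_funC setT f -> measurable_funC setT g ->
            commutator_form k b K f g = 0)].
Proof.
have p0 : 0 < p by exact: lt_trans hp.
have q0 : 0 < q by exact: lt_le_trans hpq.
have k0 : 0 < k%:R :> R by rewrite ltr0n.
have d0 : 0 < d%:R :> R by rewrite ltr0n.
have dk0 : 0 < d%:R / k%:R :> R by rewrite divr_gt0.
have pq0 : 0 <= p^-1 - q^-1 by rewrite subr_ge0 lef_pV2.
move=> alpha; split; first by rewrite mulr_ge0// ltW.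
split.
  split=> [/eqP|pq]; last by rewrite /alpha pq subrr mulr0.
  by rewrite mulf_eq0 (gt_eqF dk0)/= subr_eq0 => /eqP/invr_inj.
have kalpha : alpha * k%:R = d%:R * (p^-1 - q^-1).
  by rewrite /alpha mulrAC divfK ?gt_eqF.
have [C0 C00 hC0] := mean_oscillation_bound hd hK hk hp hpq hkappa.
pose hc := holder_const (d := d) alpha.
(* [C] is fixed before the cases on [alpha]: [4 ^+ k] serves BMO and [hc] the Holder case. The
   absolute value makes both summands nonnegative throughout, as [holder_const_ge0] is available for
   [alpha > 0] only. *)
exists (C0 * (4 ^+ k + `|hc| ^+ k)) => b Theta bL Theta0 test.
have osc_bound := hC0 b Theta bL Theta0 test.
pose N := C0 * Theta.
have N0 : 0 <= N by rewrite mulr_ge0// ltW.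
have CTheta : C0 * (4 ^+ k + `|hc| ^+ k) * Theta = 4 ^+ k * N + N * `|hc| ^+ k.
  by rewrite /N; ring.
have CTheta1 : 0 <= 4 ^+ k * N by rewrite mulr_ge0// exprn_ge0.
have CTheta2 : 0 <= N * `|hc| ^+ k by rewrite mulr_ge0// exprn_ge0.
pose M := N `^ k%:R^-1.
have M0 : 0 <= M by exact: powR_ge0.
have Mk : M ^+ k = N by rewrite -powR_mulrn// -powRrM mulVf ?powRr1// gt_eqF.
(* Since [k alpha = d (1/p - 1/q)], the oscillation bound is the [k]-th power of [M r^alpha], the
   form used for every value of [alpha]. *)
have osc_alpha c r : 0 < r -> exists a, (osc (lebesgue_rV d) b k (eball c r) a <=
    ((M * r `^ alpha) ^+ k * (unit_vol (R := R) (d := d) * r ^+ d))%:E)%E.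
  move=> r0; have [a ha] := osc_bound c r r0; exists a.
  by rewrite exprMn Mk -(powR_mulrn _ (powR_ge0 r alpha)) -powRrM kalpha.
have holder_case : 0 < alpha -> forall x y,
    `|holder_rep b alpha M x - holder_rep b alpha M y| <= M * hc * enorm (x - y) `^ alpha.
  by move=> alpha0; exact: (holder_rep_dist hk bL alpha0 M0 osc_alpha).
have holder_ae : 0 < alpha -> {ae lebesgue_rV d, forall x, holder_rep b alpha M x = b x}.
  by move=> alpha0; exact: (holder_rep_ae hk bL alpha0 M0 osc_alpha).
have hc0 : 0 < alpha -> 0 <= hc by move=> alpha0; exact: holder_const_ge0.
split.
- move=> alpha0; have [] := BMO_of_osc hk bL N0 _.
    move=> c r r0; have [a ha] := osc_alpha c r r0; exists a.
    by move: ha; rewrite alpha0 powRr0 mulr1 Mk.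
  by move=> bBMO hb; split => //; apply: (le_trans hb); rewrite lee_fin CTheta lerDl.
- move=> /andP[alpha0 _]; exists (holder_rep b alpha M).
  have Mhc0 : 0 <= M * hc by rewrite mulr_ge0// hc0.
  have [hH hn] := Holder_norm_bound k hd Mhc0 (holder_case alpha0).
  split => //; first exact: holder_ae.
  apply: (le_trans hn); rewrite lee_fin exprMn Mk CTheta.
  by rewrite (ger0_norm (hc0 alpha0)) lerDr.
move=> alpha1; have alpha0 : 0 < alpha by exact: lt_trans alpha1.
have Mhc0 : 0 <= M * hc by rewrite mulr_ge0// hc0.
have b_const : {ae lebesgue_rV d, forall x, b x = holder_rep b alpha M 0}.
  apply: filterS (holder_ae alpha0) => x <-.
  exact: (holder_gt1_constant alpha1 Mhc0 (holder_case alpha0)).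
split; first by exists (holder_rep b alpha M 0).
by move=> f g _ _; exact: commutator_form_ae_constant b_const.
Qed.
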